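(* Let $a=\frac{1-\alpha}{\alpha}$ and $b=\frac{1-\beta}{\beta}$, and let $\eta=(\eta_1,\dots,\eta_N)\in\{0,1\}^N$ be distributed according to the invariant measure of the boundary driven TASEP on $\{1,\dots,N\}$ with boundary parameters $\alpha,\beta$ such that $ab<1$. Let $F(x)=\int_0^x\rho(y)\,dy$ and let $\mathcal G$ be the set of absolutely continuous functions $G:[0,1]\to\mathbb R$ such that $G(0)=0$ and $0\le\dot G(x)\le 1$. Then the large deviations rate functional for the empirical measure $\hat\pi_N=\frac1N\sum_{i=1}^N\eta_i\delta_{i/N}$ is given by $$I^{\mathrm{TASEP}}(\rho)=\inf_{G\in\mathcal G}\Big\{\int_0^1\big[H(\dot F(y))+H(\dot G(y))\big]\,dy+\ln(ab)\,\min_{x\in[0,1]}[F(x)-G(x)]-\ln(b)\,\big(F(1)-G(1)\big)\Big\}.$$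
   Context: The boundary driven TASEP with positive parameters $\alpha,\beta\le1$ is the continuous time Markov process on $\{0,1\}^N$ with generator $$\mathcal L_Nf(\eta)=\sum_{i=1}^{N-1}\eta_i(1-\eta_{i+1})[f(\eta^{i,i+1})-f(\eta)]+\alpha[f(\eta^{1,+})-f(\eta)]+\beta[f(\eta^{N,-})-f(\eta)],$$ where $\eta^{i,i+1}$ is $\eta$ with the values at $i$ and $i+1$ exchanged, $\eta^{1,+}$ is $\eta$ with the value at site $1$ set to $1$, and $\eta^{N,-}$ is $\eta$ with the value at site $N$ set to $0$. $H(u)=u\log u+(1-u)\log(1-u)$, and $\ln=\log$ is the natural logarithm. The empirical measure $\hat\pi_N$ is a random element of the set of positive measures on $[0,1]$ with the weak topology, and the large deviations are at speed $N$ as $N\to\infty$. The symbol $\rho$ denotes the density of an absolutely continuous measure $\rho(x)dx$ on $[0,1]$ with $0\le\rho\le1$; the rate functional is $+\infty$ on all other measures.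
   Formalization: The rate functional proved is I^TASEP minus its infimum: the displayed formula is negative at F=G=x/2 (value -2 ln 2), so it holds only up to an additive constant. If a=0 or b=0, the boundary terms are read as ln(a)m+ln(b)(m-F(1)+G(1)), m=min(F-G), with ln 0=-∞ and -∞·0=0. *)

(* Defs.v *)
From HB Require Import structures.
From mathcomp Require Import all_boot all_order all_algebra all_fingroup.
From mathcomp Require Import all_classical all_reals all_analysis.

Set Implicit Arguments.
Unset Strict Implicit.
Unset Printing Implicit Defensive.

Import Order.TTheory GRing.Theory Num.Theory.
Import numFieldNormedType.Exports.

Local Open Scope classical_set_scope.
Local Open Scope ring_scope.

(* Configurations on N = n.+1 sites; the ordinal i stands for the site i + 1. *)
Definition config (n : nat) := {ffun 'I_n.+1 -> bool}.

Definition swap_sites (n : nat) (i j : 'I_n.+1) (eta : config n) : config n :=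
  [ffun k => eta (tperm i j k)].

Definition set_site (n : nat) (i : 'I_n.+1) (v : bool) (eta : config n) :
    config n :=
  [ffun k => if k == i then v else eta k].

Definition tasep_generator (R : realType) (alpha beta : R) (n : nat)
    (f : config n -> R) (eta : config n) : R :=
  \sum_(i < n)
    (let x := widen_ord (leqnSn n) i in
     let y := lift ord0 i in
     (eta x)%:R * (1 - (eta y)%:R) * (f (swap_sites x y eta) - f eta))
  + alpha * (f (set_site ord0 true eta) - f eta)
  + beta * (f (set_site ord_max false eta) - f eta).

(* mu is the mass function of an invariant probability measure. *)
Definition tasep_invariant (R : realType) (alpha beta : R) (n : nat)
    (mu : config n -> R) : Prop :=
  [/\ forall eta, 0 <= mu eta,
      \sum_eta mu eta = 1
    & forall f : config n -> R,
        \sum_eta mu eta * tasep_generator alpha beta f eta = 0].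

(* Finite positive measures on [0, 1], seen as the finite Borel measures on the
   line that give no mass to the complement of [0, 1]. *)
Definition unit_measure (R : realType) : Type :=
  {mu : {finite_measure set (measurableTypeR R) -> \bar R}
      | mu (~` `[0%R, 1%R]) = 0%E}.

Definition test_function (R : realType) : Type :=
  {f : R -> R | {within `[0, 1], continuous f}}.

HB.instance Definition _ (R : realType) := gen_eqMixin (test_function R).

Definition pairing (R : realType) (mu : unit_measure R) :
    {ptws test_function R -> R} :=
  fun f => \int[sval mu]_(x in `[0, 1]) sval f x.

HB.instance Definition _ (R : realType) := gen_eqMixin (unit_measure R).
HB.instance Definition _ (R : realType) := gen_choiceMixin (unit_measure R).
(* The weak topology: the coarsest one for which mu |-> \int f dmu is continuous
   for every continuous f on [0, 1]. *)
HB.instance Definition _ (R : realType) :=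
  Topological.copy (unit_measure R) (initial_topology (@pairing R)).

Section empirical_measure.
Context (R : realType) (n : nat) (eta : config n).

Definition empirical : set (measurableTypeR R) -> \bar R :=
  mscale (n.+1%:R^-1)%:nng
    (msum (fun i => mscale ((eta (inord i))%:R)%:nng
                      (dirac (i.+1%:R / n.+1%:R : measurableTypeR R))) n.+1).

HB.instance Definition _ := Measure.on empirical.

Lemma empiricalE (A : set R) :
  empirical A = ((n.+1%:R)^-1%:E *
    \sum_(i < n.+1) ((eta i)%:R%:E *
      dirac (i.+1%:R / n.+1%:R : measurableTypeR R)%R A))%E.
Proof.
rewrite /empirical /mscale /msum /=; congr (_ * _)%E.
by apply: eq_bigr => i _; rewrite inord_val.
Qed.

Lemma empirical_fin : fin_num_fun empirical.
Proof.
apply: lty_fin_num_fun; rewrite [X in (X < _)%E]empiricalE.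
under eq_bigr do rewrite diracT mule1.
by rewrite sumEFin -EFinM ltry.
Qed.

HB.instance Definition _ := Measure_isFinite.Build _ _ _ empirical empirical_fin.

Lemma empirical_unit : empirical (~` `[0%R, 1%R]) = 0%E.
Proof.
rewrite empiricalE big1 ?mule0// => i _.
rewrite diracE memNset ?mule0//= => -[]; rewrite in_itv/=.
by rewrite divr_ge0//= ler_pdivrMr// mul1r ler_nat ltn_ord.
Qed.

Definition empirical_measure : unit_measure R :=
  exist _ (empirical : {finite_measure set (measurableTypeR R) -> \bar R})
    empirical_unit.

End empirical_measure.

Definition empirical_law (R : realType) (n : nat) (mu : config n -> R)
    (A : set (unit_measure R)) : R :=
  \sum_(eta : config n | empirical_measure R eta \in A) mu eta.

(* The law P n satisfies the large deviation principle with speed v n and rate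
   functional I. *)
Definition large_deviations (R : realType) (X : topologicalType)
    (v : nat -> R) (P : nat -> set X -> R) (I : X -> \bar R) : Prop :=
  [/\ forall x, (0 <= I x)%E,
      lower_semicontinuous I,
      forall C : set X, closed C ->
        (limn_esup (fun n => (v n)^-1%:E * lne (P n C)%:E)
          <= - ereal_inf [set I x | x in C])%E
    & forall U : set X, open U ->
        (- ereal_inf [set I x | x in U]
          <= limn_einf (fun n => (v n)^-1%:E * lne (P n U)%:E))%E].

(* ln 0 = 0 in the library, so that entropy 0 = entropy 1 = 0. *)
Definition entropy (R : realType) (u : R) : R :=
  u * ln u + (1 - u) * ln (1 - u).

Definition abs_continuous01 (R : realType) (G : R -> R) : Prop :=
  forall e : R, 0 < e -> exists2 d : R, 0 < d &
    forall (k : nat) (u v : 'I_k -> R),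
      (forall i, 0 <= u i /\ u i <= v i /\ v i <= 1) ->
      (forall i j, i != j -> v i <= u j \/ v j <= u i) ->
      \sum_(i < k) (v i - u i) < d ->
      \sum_(i < k) `|G (v i) - G (u i)| < e.

Definition calG (R : realType) : set (R -> R) :=
  [set G | [/\ abs_continuous01 G, G 0 = 0
    & {ae lebesgue_measure, forall x : R, x \in `]0, 1[ ->
        derivable G x 1 /\ 0 <= derive1 G x <= 1}]].

Definition primitive (R : realType) (rho : R -> R) (x : R) : R :=
  \int[lebesgue_measure]_(y in `[0, x]) rho y.

(* The term ln (a b) min (F - G) - ln b (F 1 - G 1), where m = min (F - G) and
   d = F 1 - G 1.  When a or b vanishes it is read as the limit from positive
   parameters: it is regrouped as ln a m + ln b (m - d), with m <= 0 and
   m - d <= 0, and ln 0 = -oo, -oo * 0 = 0. *)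
Definition boundary_term (R : realType) (a b m d : R) : \bar R :=
  if (0 < a) && (0 < b) then (ln (a * b) * m - ln b * d)%:E
  else (lne a%:E * m%:E + lne b%:E * (m - d)%:E)%E.

(* For F and G continuous the inf over [0, 1] below is attained. *)
Definition tasep_cost (R : realType) (a b : R) (F G : R -> R) : \bar R :=
  ((\int[lebesgue_measure]_(y in `[0%R, 1%R])
      (entropy (derive1 F y) + entropy (derive1 G y)))%:E
   + boundary_term a b (inf [set (F x - G x)%R | x in `[0%R, 1%R]])
       (F 1%R - G 1%R))%E.

Definition I_tasep (R : realType) (a b : R) (rho : R -> R) : \bar R :=
  ereal_inf [set tasep_cost a b (primitive rho) G | G in @calG R].

Definition has_density (R : realType) (nu : unit_measure R) (rho : R -> R) :
    Prop :=
  [/\ measurable_fun (`[0, 1] : set (measurableTypeR R))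
        (rho : measurableTypeR R -> measurableTypeR R),
      forall x, x \in `[0, 1] -> 0 <= rho x <= 1
    & forall A : set (measurableTypeR R), measurable A -> A `<=` `[0, 1] ->
        sval nu A = (\int[lebesgue_measure]_(x in A) (rho x)%:E)%E].

(* I_tasep as a functional of measures.  Two densities of nu are equal almost
   everywhere and have the same I_tasep; the infimum is +oo if there is none. *)
Definition I_tasep_measure (R : realType) (a b : R) (nu : unit_measure R) :
    \bar R :=
  ereal_inf [set I_tasep a b rho | rho in has_density nu].

(* Rate functionals are given up to an additive constant, which is fixed by
   requiring that the infimum be zero, as it is for the rate functional of any
   sequence of probability measures.  Here the constant does not vanish: for
   F x = G x = x / 2 the functional is at most - 2 ln 2. *)
Definition normalized (R : realType) (X : Type) (I : X -> \bar R) (x : X) :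
    \bar R :=
  (I x - ereal_inf (range I))%E.

(* Main.v *)
From HB Require Import structures.
Require Import Defs.
From mathcomp Require Import all_boot all_order all_algebra all_fingroup.
From mathcomp Require Import all_classical all_reals all_analysis.
From mathcomp Require Import measurable_realfun.
From mathcomp Require Import ring lra zify.

Set Implicit Arguments.
Unset Strict Implicit.
Unset Printing Implicit Defensive.

Import Order.TTheory GRing.Theory Num.Theory.
Import numFieldNormedType.Exports.

Local Open Scope classical_set_scope.
Local Open Scope ring_scope.

(** The invariant measure has a second row. For words s and t of length N write
    |s| for the number of particles of s and D for the maximum over all prefixes
    of the number of particles of t minus that of s. Up to normalization the
    invariant measure of s is the sum over all t of

      a ^ D * b ^ (D + |s| - |t|).

    This sum is a matrix product whose matrices act on the height from which the
    difference of the two rows starts; they satisfy the relations of the matrix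
    product ansatz, which gives stationarity, and the process is irreducible, so
    there is no other invariant measure ([invariant_weight]).

    If F and G are the rescaled particle counts of s and t, then D / N is minus
    the minimum of F - G, and the weight of (s, t) is exactly exp (- N B), where B
    is the boundary term of the cost of (F, G) ([admissible_pair_weight]). About
    exp (- N S) pairs of words are close to (F, G), for S the integral of
    H(F') + H(G'). Hence the weight of the configurations close to F is
    exp (- N inf_G (S + B)): the infimum over G is the sum over the second row,
    evaluated by its largest term. Dividing by the total weight normalizes the
    rate functional.

    Entropies are handled on dyadic grids. The block entropy n H(p / n) is
    subadditive, so the entropy of the piecewise linear interpolation of F
    increases with the level of the grid, and its limit is the entropy integral
    ([entropy_integral_cvg]). The statement that the cost of (F, G) is at most c
    thus becomes a family of inequalities without derivatives, [cost_le], closed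
    under pointwise limits. By [calG_profile] and [cdf_density] the functions that
    occur are exactly the ones with increments in [0, y - x] ([profile]), which
    form a compact set. Lower semicontinuity ([rate_lsc]) and the upper bound
    ([pair_bound], [config_weight_closed]) follow by taking limits along ultrafilters;
    for the latter, the Chernoff bound shows that exp (entropy), summed over all
    words, is polynomial in N ([split_chernoff]).

    For the lower bound, words with the block counts of F and G are counted by
    binomial coefficients ([config_weight_lb], [config_weight_open]). When a or b
    vanishes only pairs with D = 0, respectively D = |t| - |s|, have a weight, and
    the rounded block counts may miss these equalities. Both rows are therefore
    padded by a small fraction of the sites, such that the equalities hold. *)

(** * Two-row weights *)

Fixpoint words (n : nat) : seq (seq bool) :=
  if n is m.+1 then map (cons true) (words m) ++ map (cons false) (words m)
  else [:: [::]].

Lemma mem_words n s : (s \in words n) = (size s == n).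
Proof.
elim: n s => [|n IHn] [|x s] //=; rewrite mem_cat.
  by apply/negbTE; rewrite negb_or; apply/andP; split; apply/mapP => -[].
rewrite eqSS -IHn; apply/orP/idP => [[] /mapP[t ts [_ ->]] //|ss].
by case: x; [left|right]; rewrite map_f.
Qed.

Lemma words_uniq n : uniq (words n).
Proof.
elim: n => //= n IHn; rewrite cat_uniq !map_inj_uniq ?IHn; try by move=> ? ? [].
by rewrite andbT; apply/hasPn => _ /mapP[t _ ->]; apply/mapP => -[].
Qed.

(** The maximum of particles (take i t) - particles (take i s) over all i, see
    [deficit_ge] and [deficit_ex]; the empty prefix makes it nonnegative, which
    is what the truncated subtraction expresses. *)
Fixpoint deficit (s t : seq bool) : nat :=
  match s, t with
  | x :: s', y :: t' => (y + deficit s' t' - x)%N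
  | _, _ => 0%N
  end.

Definition particles (s : seq bool) : nat := count id s.

Section weights.
Variables (R : realType) (a b : R).

(** For h = 0, with D the deficit, this is a ^ D * b ^ (D + particles s -
    particles t): the boundary term of the rate functional, before taking the
    logarithm. A general h is the height from which the difference of the
    particle numbers of the two words starts; the recursions below only close
    when all heights are considered. Of the subtractions of naturals only the
    one of h truncates. *)
Definition pair_weight (h : nat) (s t : seq bool) : R :=
  a ^+ (deficit s t - h) *
  b ^+ (h + particles s + (deficit s t - h) - particles t).

Definition weight (h : nat) (s : seq bool) : R :=
  \sum_(t <- words (size s)) pair_weight h s t.

Lemma particles_deficit s t : size s = size t ->
  (particles t <= particles s + deficit s t)%N.
Proof.
elim: s t => [|x s IHs] [|y t] //= [/IHs]; rewrite /particles/=.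
by case: x; case: y => /=; lia.
Qed.

Lemma weight_nil h : weight h [::] = b ^+ h.
Proof. by rewrite /weight/= big_seq1 /pair_weight/= sub0n expr0 mul1r !addn0 subn0. Qed.

Lemma pair_weight_cons h (x y : bool) s t : size s = size t ->
  pair_weight h (x :: s) (y :: t) = a ^+ (y - (h + x)) * pair_weight (h + x - y) s t.
Proof.
move/particles_deficit; rewrite /pair_weight/particles/= mulrA -exprD => ?.
by case: x; case: y; congr (a ^+ _ * b ^+ _) => /=; lia.
Qed.

Lemma weight_cons h (x : bool) s :
  weight h (x :: s) = a ^+ (1 - (h + x)) * weight (h + x - 1) s + weight (h + x) s.
Proof.
rewrite /weight /= big_cat !big_map mulr_sumr; congr (_ + _); apply: eq_big_seq => t;
  rewrite mem_words => /eqP/esym st; rewrite pair_weight_cons//=.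
by rewrite sub0n subn0 expr0 mul1r.
Qed.

(** [weight1], [weight0S] and [weight00] sum over the first site of the second
    row. They say that weight is a matrix product: a particle of s acts on
    functions of the height h by 1 + (shift up), a hole by 1 + (shift down),
    and at height 0 the missing shift is replaced by the factor a. *)
Lemma weight1 h s : weight h (true :: s) = weight h s + weight h.+1 s.
Proof. by rewrite weight_cons/= addn1 subn1 subSS sub0n expr0 mul1r. Qed.

Lemma weight0S h s : weight h.+1 (false :: s) = weight h.+1 s + weight h s.
Proof. by rewrite weight_cons/= addn0 subn1 subSS sub0n expr0 mul1r addrC. Qed.

Lemma weight00 s : weight 0 (false :: s) = (1 + a) * weight 0 s.
Proof. by rewrite weight_cons/= addn0 subn0 sub0n expr1 mulrDl mul1r addrC. Qed.

(** The bulk relation D E = D + E of the matrix product ansatz. *)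
Lemma weight10 h s :
  weight h [:: true, false & s] = weight h (false :: s) + weight h (true :: s).
Proof. by rewrite 2!weight1 weight0S [X in _ + X]addrC. Qed.

(** With [weight00], the two boundary relations of the matrix product ansatz.
    *)
Lemma weight_rcons1 h s : weight h (rcons s true) = (1 + b) * weight h s.
Proof.
elim: s h => [|x s IHs] h; first by rewrite weight1 !weight_nil exprS; ring.
case: x => /=; first by rewrite !weight1 !IHs; ring.
by case: h => [|h]; rewrite ?weight00 ?weight0S !IHs; ring.
Qed.

Lemma weight_cat10 h p s :
  weight h (p ++ [:: true, false & s]) =
  weight h (p ++ false :: s) + weight h (p ++ true :: s).
Proof.
elim: p h => [|x p IHp] h /=; first exact: weight10.
case: x; first by rewrite !weight1 !IHp; ring.
by case: h => [|h]; rewrite ?weight00 ?weight0S !IHp; ring.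
Qed.

Hypotheses (a0 : 0 <= a) (b0 : 0 <= b).

Lemma pair_weight_ge0 h s t : 0 <= pair_weight h s t.
Proof. by rewrite mulr_ge0// exprn_ge0. Qed.

Lemma deficitss s : deficit s s = 0%N.
Proof. by elim: s => //= x s ->; rewrite addn0 subnn. Qed.

(** The term t = s of the sum is 1, also when a or b vanishes. *)
Lemma weight_gt0 s : 0 < weight 0 s.
Proof.
apply: (@lt_le_trans _ _ (pair_weight 0 s s)).
  by rewrite /pair_weight deficitss sub0n add0n addn0 subnn mulr1.
rewrite /weight (bigD1_seq s) ?mem_words ?words_uniq//= lerDl.
by apply: sumr_ge0 => t _; exact: pair_weight_ge0.
Qed.

End weights.

(** * Stationarity of the weights *)

Definition word (n : nat) (eta : config n) : seq bool :=
  mkseq (fun k => eta (inord k)) n.+1.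

Lemma size_word n (eta : config n) : size (word eta) = n.+1.
Proof. exact: size_mkseq. Qed.

Lemma nth_word n (eta : config n) (i : 'I_n.+1) : nth false (word eta) i = eta i.
Proof. by rewrite nth_mkseq// inord_val. Qed.

Lemma word_inj n : injective (@word n).
Proof. by move=> x y e; apply/ffunP => i; rewrite -!nth_word e. Qed.

Lemma perm_words n :
  perm_eq [seq word eta | eta <- index_enum (config n)] (words n.+1).
Proof.
apply: uniq_perm; rewrite ?words_uniq//.
  by rewrite (map_inj_uniq (@word_inj n)) index_enum_uniq.
move=> s; rewrite mem_words; apply/mapP/eqP => [[eta _ ->]|ss].
  by rewrite size_word.
exists [ffun i : 'I_n.+1 => nth false s i]; first by rewrite mem_index_enum.
apply: (@eq_from_nth _ false); rewrite ?size_word// ss => i ilt.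
by rewrite nth_mkseq// ffunE inordK.
Qed.

Lemma sum_config (V : zmodType) n (F : seq bool -> V) :
  \sum_(eta : config n) F (word eta) = \sum_(s <- words n.+1) F s.
Proof. by rewrite -(perm_big _ (perm_words n)) big_map. Qed.

Lemma word_split n (eta : config n) (i : nat) : (i < n)%N ->
  exists2 q, word eta = mkseq (fun k => eta (inord k)) i ++
    [:: eta (inord i), eta (inord i.+1) & q] &
  forall zeta : config n,
    (forall k, k != inord i -> k != inord i.+1 -> zeta k = eta k) ->
    word zeta = mkseq (fun k => eta (inord k)) i ++
    [:: zeta (inord i), zeta (inord i.+1) & q].
Proof.
move=> ilt.
have iE : iota 0 n.+1 = iota 0 i ++ [:: i, i.+1 & iota i.+2 (n.-1 - i)].
  by rewrite (_ : n.+1 = i + (n.-1 - i).+2)%N ?iotaD//; lia.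
exists [seq eta (inord k) | k <- iota i.+2 (n.-1 - i)].
  by rewrite /word /mkseq iE map_cat.
move=> zeta ze; rewrite /word /mkseq iE map_cat /=; congr (_ ++ [:: _, _ & _]).
  apply/eq_in_map => k; rewrite mem_iota add0n => /andP[_ ki]; apply: ze.
    by rewrite -val_eqE/= !inordK//; lia.
  by rewrite -val_eqE/= !inordK//; lia.
apply/eq_in_map => k; rewrite mem_iota => /andP[ki kn]; apply: ze.
  by rewrite -val_eqE/= !inordK//; lia.
by rewrite -val_eqE/= !inordK//; lia.
Qed.

Lemma word_behead n (eta zeta : config n) :
  (forall k, k != ord0 -> zeta k = eta k) ->
  word zeta = zeta ord0 :: behead (word eta).
Proof.
move=> ze; rewrite /word /mkseq /=; congr (_ :: _).
  by congr (zeta _); apply/val_inj; rewrite /= inordK.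
apply/eq_in_map => k; rewrite mem_iota => /andP[ki kn]; apply: ze.
by rewrite -val_eqE/= inordK//; lia.
Qed.

Lemma word_rcons n (eta zeta : config n) :
  (forall k, k != ord_max -> zeta k = eta k) ->
  word zeta = rcons (mkseq (fun k => eta (inord k)) n) (zeta ord_max).
Proof.
move=> ze; rewrite /word mkseqS; congr (rcons _ _).
  apply/eq_in_map => k; rewrite mem_iota => /andP[ki kn]; apply: ze.
  by rewrite -val_eqE/= inordK//; lia.
by congr (zeta _); apply/val_inj; rewrite /= inordK.
Qed.

Section stationarity.
Variables (R : realType) (alpha beta a b : R) (n : nat).
Hypotheses (aE : alpha * (1 + a) = 1) (bE : beta * (1 + b) = 1).

Let W (eta : config n) : R := weight a b 0 (word eta).

(** The weight with the site i deleted, with a sign; each bond contributes a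
    difference of these to the sum in [stationarity]. *)
Definition del_weight (i : nat) (eta : config n) : R :=
  (if eta (inord i) then -1 else 1) *
  weight a b 0 (take i (word eta) ++ drop i.+1 (word eta)).

(** The swap of i and j is an involution of the configurations; reindexing by
    it moves a bond of the generator from the test function to the weights. *)
Lemma sum_swap (i j : 'I_n.+1) (f V : config n -> R) : i != j ->
  \sum_eta V eta * ((eta i)%:R * (1 - (eta j)%:R)
     * (f (swap_sites i j eta) - f eta)) =
  \sum_eta f eta * ((1 - (eta i)%:R) * (eta j)%:R * V (swap_sites i j eta)
     - (eta i)%:R * (1 - (eta j)%:R) * V eta).
Proof.
move=> ij.
under eq_bigr do rewrite mulrBr mulrBr.
under [RHS]eq_bigr do rewrite mulrBr.
rewrite !sumrB; congr (_ - _); last by apply: eq_bigr => eta _; ring.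
have K : involutive (@swap_sites n i j).
  by move=> eta; apply/ffunP => k; rewrite !ffunE tpermK.
rewrite (reindex_inj (inv_inj K)); apply: eq_bigr => eta _.
by rewrite K !ffunE tpermL tpermR; ring.
Qed.

(** Flipping the value at i exchanges the configurations with and without the
    value v there; this moves a boundary term of the generator to the weights.
    *)
Lemma sum_set_site (i : 'I_n.+1) v (f V : config n -> R) :
  \sum_eta V eta * (f (set_site i v eta) - f eta) =
  \sum_eta f eta * (if eta i == v then V (set_site i (~~ v) eta) else - V eta).
Proof.
pose flip (eta : config n) := set_site i (~~ eta i) eta.
have flipi eta : flip eta i = ~~ eta i by rewrite ffunE eqxx.
have flipK : involutive flip.
  by move=> eta; apply/ffunP => k; rewrite !ffunE eqxx negbK; case: eqP => // ->.
have neg (x y : bool) : (x != y) = (y == ~~ x) by case: x; case: y.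
have stay (eta : config n) : eta i = v -> set_site i v eta = eta.
  by move=> ev; apply/ffunP => k; rewrite ffunE; case: eqP => // ->.
have move_ (eta : config n) : eta i != v -> set_site i v eta = flip eta.
  by rewrite neg => /eqP ->.
transitivity (\sum_(eta : config n) (if eta i == v then 0 else V eta * f (flip eta)) -
    \sum_(eta : config n) (if eta i == v then 0 else V eta * f eta)).
  rewrite -sumrB; apply: eq_bigr => eta _; have [/stay ->|/move_ ->] := eqVneq.
    by rewrite !subrr mulr0.
  by rewrite mulrBr.
rewrite [X in X - _](reindex_inj (inv_inj flipK)) -sumrB; apply: eq_bigr => eta _.
rewrite flipi flipK; have [<-|] := eqVneq (eta i) v.
  by rewrite (_ : (~~ eta i == eta i) = false) ?subr0 1?mulrC//; case: (eta i).
by rewrite neg eq_sym => ->; rewrite sub0r mulrN mulrC.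
Qed.

(** The relation D E = D + E of [weight_cat10], applied at one bond: there the
    flow of weight is a difference of two values of [del_weight]. *)
Lemma bond_current (i : 'I_n) (eta : config n) :
  let x := widen_ord (leqnSn n) i in let y := lift ord0 i in
  (1 - (eta x)%:R) * (eta y)%:R * W (swap_sites x y eta)
     - (eta x)%:R * (1 - (eta y)%:R) * W eta =
  del_weight i eta - del_weight i.+1 eta.
Proof.
move=> x y.
have ex : x = inord i by apply/val_inj; rewrite /= inordK// ltnS ltnW.
have ey : y = inord i.+1 by apply/val_inj; rewrite /= inordK// ltnS.
have [q e1 e2] := word_split eta (ltn_ord i).
have e3 := e2 (swap_sites x y eta).
rewrite /W e3; last first.
  by move=> k; rewrite -ex -ey ffunE => kx ky; rewrite tpermD// eq_sym.
rewrite /del_weight e1 -ex -ey !ffunE tpermL tpermR.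
set p := mkseq _ _; have sp : size p = i by rewrite size_mkseq.
rewrite take_size_cat// drop_cat sp ltnNge leqnSn/= subSnn/=.
rewrite take_cat sp ltnNge leqnSn/= subSnn/= drop_cat sp.
rewrite (_ : (i.+2 < i)%N = false); last by lia.
rewrite (_ : (i.+2 - i)%N = 2%N); last by lia.
rewrite /= drop0 -catA/=.
by case: (eta x) (eta y) => -[]/=; rewrite ?weight_cat10; ring.
Qed.

(** The bond terms telescope, and what remains at the two ends cancels the
    boundary terms because 1 + a = 1 / alpha and 1 + b = 1 / beta. *)
Lemma stationarity (f : config n -> R) :
  \sum_eta W eta * tasep_generator alpha beta f eta = 0.
Proof.
rewrite /tasep_generator.
under eq_bigr do rewrite mulrDr mulrDr mulr_sumr.
rewrite big_split big_split/= exchange_big/=.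
under eq_bigr => i _.
  rewrite sum_swap; last by rewrite -val_eqE/= neq_ltn ltnSn.
  under eq_bigr do rewrite bond_current.
  over.
rewrite exchange_big/=.
under eq_bigr do rewrite -mulr_sumr -(big_mkord xpredT (fun i => del_weight i _ - del_weight i.+1 _)).
have tele eta : \sum_(0 <= i < n) (del_weight i eta - del_weight i.+1 eta) =
    del_weight 0 eta - del_weight n eta.
  rewrite -[RHS]opprB -(telescope_sumr (fun i => del_weight i eta))// -sumrN.
  by apply: eq_bigr => i _; rewrite opprB.
under eq_bigr do rewrite tele.
have -> : \sum_eta W eta * (alpha * (f (set_site ord0 true eta) - f eta)) =
    \sum_eta f eta * (- del_weight 0 eta).
  under eq_bigr do rewrite mulrCA.
  rewrite -mulr_sumr sum_set_site mulr_sumr; apply: eq_bigr => eta _.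
  rewrite mulrCA; congr (f _ * _).
  rewrite /del_weight take0 cat0s (_ : inord 0 = ord0); last first.
    by apply/val_inj; rewrite /= inordK.
  rewrite drop1; case: (boolP (eta ord0)) => e0 /=.
    rewrite /W (@word_behead _ eta); last first.
      by move=> k /negbTE k0; rewrite ffunE k0.
    by rewrite ffunE eqxx/= weight00 mulrA aE; ring.
  rewrite /W {1}(@word_behead _ eta eta)// (negbTE e0) weight00.
  by rewrite mulrN mulrA aE; ring.
have -> : \sum_eta W eta * (beta * (f (set_site ord_max false eta) - f eta)) =
    \sum_eta f eta * del_weight n eta.
  under eq_bigr do rewrite mulrCA.
  rewrite -mulr_sumr sum_set_site mulr_sumr; apply: eq_bigr => eta _.
  rewrite mulrCA; congr (f _ * _).
  rewrite /del_weight (_ : inord n = ord_max); last first.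
    by apply/val_inj; rewrite /= inordK.
  rewrite drop_oversize ?size_word// cats0.
  have -> : take n (word eta) = mkseq (fun k => eta (inord k)) n.
    rewrite (@word_rcons _ eta eta)// -cats1 take_size_cat//.
    by rewrite size_mkseq.
  case: (boolP (eta ord_max)) => e0 /=.
    by rewrite /W (@word_rcons _ eta eta)// e0 weight_rcons1 mulrN mulrA bE; ring.
  rewrite /W (@word_rcons _ eta); last first.
    by move=> k /negbTE k0; rewrite ffunE k0.
  by rewrite ffunE eqxx/= weight_rcons1 mulrA bE; ring.
rewrite -!big_split/= big1// => eta _; ring.
Qed.

End stationarity.

(** * Uniqueness of the invariant measure *)

Section uniqueness.
Variables (R : realType) (alpha beta : R) (n : nat).
Hypotheses (al0 : 0 < alpha) (be0 : 0 < beta).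

Definition tasep_step (zeta eta : config n) : Prop :=
  (exists i : 'I_n, let x := widen_ord (leqnSn n) i in let y := lift ord0 i in
     [/\ zeta x, ~~ zeta y & eta = swap_sites x y zeta]) \/
  eta = set_site ord0 true zeta \/ eta = set_site ord_max false zeta.

Definition weighted_count (c : 'I_n.+1 -> nat) (eta : config n) : nat :=
  \sum_k eta k * c k.

Lemma weighted_count_swap c (x y : 'I_n.+1) (eta : config n) : eta x -> ~~ eta y ->
  (c y < c x)%N -> (weighted_count c (swap_sites x y eta) < weighted_count c eta)%N.
Proof.
move=> ex ey cxy; have xy : y != x by apply: contraTneq ex => <-.
rewrite /weighted_count (bigD1 x)//= (bigD1 y)//= [X in (_ < X)%N](bigD1 x)//=.
rewrite [X in (_ < _ + X)%N](bigD1 y)//= !ffunE tpermL tpermR ex (negbTE ey).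
rewrite (eq_bigr (fun k => eta k * c k)%N).
  by rewrite [nat_of_bool false]/= [nat_of_bool true]/= !mul0n !mul1n !add0n ltn_add2r.
by move=> k /andP[kx ky]; rewrite ffunE tpermD// eq_sym.
Qed.

Lemma weighted_count_empty c (x : 'I_n.+1) (eta : config n) : eta x -> (0 < c x)%N ->
  (weighted_count c (set_site x false eta) < weighted_count c eta)%N.
Proof.
move=> ex cx; rewrite /weighted_count (bigD1 x)//= [X in (_ < X)%N](bigD1 x)//=.
rewrite ffunE eqxx ex mul0n mul1n add0n.
rewrite (eq_bigr (fun k => eta k * c k)%N); first by rewrite -[X in (X < _)%N]add0n ltn_add2r.
by move=> k /negbTE kx; rewrite ffunE kx.
Qed.

Let zero : config n := [ffun=> false].

Lemma not_emptyP (eta : config n) : eta != zero -> exists i, eta i.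
Proof.
move=> e0; apply/existsP; apply: contraNT e0 => /existsPn e0.
by apply/eqP/ffunP => i; rewrite ffunE; apply/negbTE.
Qed.

(** Every configuration can be emptied: move the last particle to the right end
    and out. The sum of the distances of the particles to the right exit
    decreases. *)
Lemma step_to_zero (P : config n -> Prop) :
  (forall zeta eta, tasep_step zeta eta -> P eta -> P zeta) ->
  P zero -> forall eta, P eta.
Proof.
move=> stepP P0 eta; pose c (i : 'I_n.+1) := (n.+1 - i)%N.
have [m] := ubnP (weighted_count c eta); elim: m eta => // m IHm eta; rewrite ltnS => lem.
have [->//|/not_emptyP[i0 ei0]] := eqVneq eta zero.
pose i := [arg max_(i > i0 | eta i) (i : nat)].
have [ei maxi] : eta i /\ forall j, eta j -> (j <= i)%N.
  by rewrite /i; case: arg_maxnP => // k ek mk; split.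
have ci : (0 < c i)%N by rewrite /c subn_gt0.
have [iN|iN] := eqVneq (i : nat) n.
  apply: (@stepP _ (set_site i false eta)).
    by right; right; congr (set_site _ _ _); apply/val_inj.
  by apply: IHm; apply: leq_trans lem; exact: weighted_count_empty.
have iln : (i < n)%N by have := ltn_ord i; lia.
pose j : 'I_n := Ordinal iln.
have xE : widen_ord (leqnSn n) j = i by apply/val_inj.
have ey : ~~ eta (lift ord0 j).
  by apply/negP => /maxi; rewrite /= /bump leq0n ltnn.
apply: (@stepP _ (swap_sites i (lift ord0 j) eta)).
  by left; exists j; rewrite xE.
apply: IHm; apply: leq_trans lem; apply: weighted_count_swap => //.
by rewrite /c /= /bump/=; have := ltn_ord i; lia.
Qed.

(** Every configuration can be reached from the empty one: backwards in time,
    move the first particle to the left end and out. The sum of the positions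
    decreases. *)
Lemma step_from_zero (P : config n -> Prop) :
  (forall zeta eta, tasep_step zeta eta -> P eta -> P zeta) ->
  forall eta, P eta -> P zero.
Proof.
move=> stepP eta; pose c (i : 'I_n.+1) := i.+1.
have [m] := ubnP (weighted_count c eta); elim: m eta => // m IHm eta; rewrite ltnS => lem Peta.
have [<-//|/not_emptyP[i0 ei0]] := eqVneq eta zero.
pose i := [arg min_(i < i0 | eta i) (i : nat)].
have [ei mini] : eta i /\ forall j, eta j -> (i <= j)%N.
  by rewrite /i; case: arg_minnP => // k ek mk; split.
have [i00|iN] := eqVneq (i : nat) 0%N.
  apply: (IHm (set_site i false eta)).
    by apply: leq_trans lem; exact: weighted_count_empty.
  apply: stepP Peta; right; left; have -> : i = ord0 by apply/val_inj.
  apply/ffunP => k; rewrite !ffunE; case: eqP => // ->.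
  by rewrite -ei; congr (eta _); apply/val_inj.
have iln : (i.-1 < n)%N by have := ltn_ord i; lia.
pose j : 'I_n := Ordinal iln.
have yE : lift ord0 j = i by apply/val_inj; rewrite /= /bump/=; lia.
pose x := widen_ord (leqnSn n) j.
have ex : ~~ eta x by apply/negP => /mini; rewrite /=; lia.
apply: (IHm (swap_sites i x eta)).
  apply: leq_trans lem; apply: weighted_count_swap => //.
  by rewrite /c /=; lia.
apply: stepP Peta; left; exists j; rewrite yE -/x; split.
- by rewrite ffunE tpermR.
- by rewrite ffunE tpermL.
- by apply/ffunP => k; rewrite !ffunE tpermC tpermK.
Qed.

Variable nu : config n -> R.
Hypothesis nu0 : forall eta, 0 <= nu eta.
Hypothesis nuL : forall f : config n -> R,
  \sum_eta nu eta * tasep_generator alpha beta f eta = 0.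

(** If nu vanishes at eta, the invariance equation for the indicator of eta
    only has nonnegative terms, and the one of zeta has a positive rate. *)
Lemma null_step zeta eta : tasep_step zeta eta -> nu eta = 0 -> nu zeta = 0.
Proof.
move=> st nueta; have [->//|ze] := eqVneq zeta eta.
pose f (xi : config n) : R := (xi == eta)%:R.
have rate0 xi : xi != eta -> forall z, 0 <= f z - f xi.
  by move=> xe z; rewrite /f (negbTE xe) subr0 ler0n.
have bond0 xi (x y : 'I_n.+1) : xi != eta ->
    0 <= (xi x)%:R * (1 - (xi y)%:R) * (f (swap_sites x y xi) - f xi).
  move=> xe; rewrite !mulr_ge0 ?rate0 ?ler0n//.
  by case: (xi y); rewrite /= ?subrr ?subr0.
have gen0 xi : xi != eta -> 0 <= tasep_generator alpha beta f xi.
  move=> xe; rewrite /tasep_generator !addr_ge0//.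
  - by apply: sumr_ge0 => i _; exact: bond0.
  - by rewrite mulr_ge0 ?rate0// ltW.
  - by rewrite mulr_ge0 ?rate0// ltW.
have := nuL f; rewrite (bigD1 eta)//= nueta mul0r add0r => /eqP.
rewrite psumr_eq0; last by move=> xi xe; rewrite mulr_ge0// gen0.
move=> /allP/(_ zeta (mem_index_enum _)); rewrite ze/= mulf_eq0 => /orP[/eqP//|].
suff: 0 < tasep_generator alpha beta f zeta by move=> /lt0r_neq0/negbTE ->.
have fze : f eta - f zeta = 1 by rewrite /f eqxx (negbTE ze) subr0.
rewrite /tasep_generator; case: st => [[i [zx zy E]]|[E|E]].
- rewrite -addrA ltr_pwDl//; last first.
    by rewrite addr_ge0// mulr_ge0 ?rate0// ltW.
  rewrite (bigD1 i)//= ltr_pwDl//; last first.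
    by apply: sumr_ge0 => k _; exact: bond0.
  by rewrite -E zx (negbTE zy) subr0 !mul1r fze.
- rewrite ltr_pwDl//; last by rewrite mulr_ge0 ?rate0// ltW.
  rewrite ltr_wpDl//; first by apply: sumr_ge0 => k _; exact: bond0.
  by rewrite -E fze mulr1.
- rewrite ltr_wpDl//; last by rewrite -E fze mulr1.
  rewrite addr_ge0//; first by apply: sumr_ge0 => k _; exact: bond0.
  by rewrite mulr_ge0 ?rate0// ltW.
Qed.

Lemma null_everywhere eta0 : nu eta0 = 0 -> forall eta, nu eta = 0.
Proof.
move=> e0; apply: (step_to_zero null_step).
exact: (step_from_zero null_step e0).
Qed.

End uniqueness.

(** Let c be the minimum of mu / W, for W the weights of the configurations.
    Then mu - c W is nonnegative, solves the invariance equation and vanishes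
    at some configuration, hence everywhere since the process is irreducible.
    *)
Lemma invariant_weight (R : realType) (alpha beta a b : R) (n : nat)
    (mu : config n -> R) :
  0 < alpha -> 0 < beta -> 0 <= a -> 0 <= b ->
  alpha * (1 + a) = 1 -> beta * (1 + b) = 1 ->
  tasep_invariant alpha beta mu ->
  forall eta, mu eta =
    weight a b 0 (word eta) / \sum_(s <- words n.+1) weight a b 0 s.
Proof.
move=> al0 be0 a0 b0 aE bE [mu0 mu1 muL].
pose W (eta : config n) := weight a b 0 (word eta).
have W0 eta : 0 < W eta by exact: weight_gt0.
pose eta0 : config n := [arg min_(e < [ffun=> false]) (mu e / W e)]%O.
pose c := mu eta0 / W eta0.
have cmin eta : c <= mu eta / W eta.
  by rewrite /c /eta0; case: arg_minP => // i _; apply.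
have muE eta : mu eta = c * W eta.
  apply/eqP; rewrite -subr_eq0; apply/eqP.
  apply: (@null_everywhere R alpha beta n al0 be0 (fun e => mu e - c * W e) _ _ eta0).
  - by move=> e; rewrite subr_ge0 -ler_pdivlMr.
  - move=> f; under eq_bigr do rewrite mulrBl -mulrA.
    by rewrite sumrB muL -mulr_sumr (stationarity aE bE) mulr0 subr0.
  - by rewrite /c divfK ?subrr// gt_eqF.
have c1 : c * \sum_(s <- words n.+1) weight a b 0 s = 1.
  rewrite -(@sum_config R n (fun s => weight a b 0 s)) -mu1 mulr_sumr.
  by apply: eq_bigr => eta _; rewrite muE.
move=> eta; rewrite muE mulrC; congr (_ * _).
have: \sum_(s <- words n.+1) weight a b 0 s != 0.
  by apply: contra_eq_neq c1 => ->; rewrite mulr0 eq_sym oner_eq0.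
by move=> Z0; apply: (mulIf Z0); rewrite mulVf.
Qed.

(** * The entropy of a block *)

Section block_entropy.
Context {R : realType}.
Implicit Types (n p x y theta : R).

Definition xlnx x : R := x * ln x.

Lemma xlnx0 : xlnx 0 = 0. Proof. exact: mul0r. Qed.

(** From ln y < y at y = x and at y = 1 / sqrt x. The bound vanishes at 0,
    where it yields continuity. *)
Lemma xlnx_bound x : `|xlnx x| <= 2 * Num.sqrt `|x| + x ^+ 2.
Proof.
have [x0|x0] := leP x 0.
  rewrite /xlnx ln0// mulr0 normr0.
  by apply: addr_ge0; [apply: mulr_ge0 => //; exact: sqrtr_ge0|exact: sqr_ge0].
rewrite (gtr0_norm x0) ler_norml; apply/andP; split; last first.
  apply: (@le_trans _ _ (x ^+ 2)); last by rewrite lerDr mulr_ge0// sqrtr_ge0.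
  by rewrite /xlnx expr2 ler_pM2l// ltW// ln_sublinear.
set s := Num.sqrt x; have s0 : 0 < s by rewrite sqrtr_gt0.
have xE : x = s ^+ 2 by rewrite sqr_sqrtr// ltW.
have h : ln s^-1 < s^-1 by rewrite ln_sublinear// invr_gt0.
have -> : xlnx x = - (2 * s * (s * ln s^-1)).
  by rewrite /xlnx lnV// {1 2}xE lnXn// mulr2n; ring.
rewrite lerN2; apply: (@le_trans _ _ (2 * s)); last by rewrite lerDl sqr_ge0.
rewrite ger_pMr; last by rewrite mulr_gt0.
by rewrite -(@ler_pM2l _ s^-1) ?invr_gt0// mulrA mulVf ?gt_eqF// mul1r mulr1 ltW.
Qed.

Lemma xlnx_continuous : continuous xlnx.
Proof.
move=> x; have [x0|x0|->] := ltgtP x 0.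
- rewrite /continuous_at {2}/xlnx ln0 ?ltW// mulr0.
  apply: cvg_near_cst; near=> y; rewrite /xlnx ln0 ?mulr0//.
  by apply/ltW; near: y; exact: lt_nbhsl.
- by apply: cvgM; [exact: cvg_id|exact: continuous_ln].
- rewrite /continuous_at xlnx0; apply/norm_cvg0P.
  pose g (y : R) := 2 * Num.sqrt `|y| + y ^+ 2.
  apply: (@squeeze_cvgr _ _ _ _ (fun=> 0) g).
  + by near=> y; rewrite normr_ge0/= xlnx_bound.
  + exact: cvg_cst.
  + have g0 : g 0 = 0 by rewrite /g normr0 sqrtr0 mulr0 expr0n/= addr0.
    rewrite -[X in _ --> X]g0; apply: cvgD; last exact: exprn_continuous.
    apply: cvgMr; apply: continuous_cvg; first exact: sqrt_continuous.
    exact: norm_continuous.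
Unshelve. all: by end_near. Qed.

(** For n > 0 this is n H(p / n). The homogeneous form has no division, is
    continuous in (n, p) and makes sense for empty blocks. *)
Definition block_entropy n p : R := xlnx p + xlnx (n - p) - xlnx n.

Lemma entropyE p : entropy p = block_entropy 1 p.
Proof. by rewrite /block_entropy /xlnx ln1 mulr0 subr0. Qed.

Lemma block_entropy0 n : block_entropy n 0 = 0.
Proof. by rewrite /block_entropy subr0 xlnx0 add0r subrr. Qed.

Lemma block_entropyn n : block_entropy n n = 0.
Proof. by rewrite /block_entropy subrr xlnx0 addr0 subrr. Qed.

Lemma block_entropyZ (c n p : R) : 0 < c -> 0 <= p <= n ->
  block_entropy (c * n) (c * p) = c * block_entropy n p.
Proof.
move=> c0 /andP[p0 pn].
have E y : 0 <= y -> xlnx (c * y) = c * xlnx y + c * ln c * y.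
  rewrite le_eqVlt => /predU1P[<-|y0]; first by rewrite !(mulr0, xlnx0) addr0.
  by rewrite /xlnx lnM//; ring.
by rewrite /block_entropy -mulrBr !E ?subr_ge0//; [ring|exact: le_trans pn].
Qed.

(** By convexity the function is above its tangent at c. *)
Lemma xlnx_ge (p c : R) : 0 <= p -> 0 < c -> p * ln c + p - c <= xlnx p.
Proof.
rewrite le_eqVlt => /predU1P[<-|p0] c0.
  by rewrite xlnx0 mul0r !add0r oppr_le0 ltW.
have h : ln (c / p) <= c / p - 1.
  rewrite -{1}(subrK 1 (c / p)) addrC; apply: le_ln1Dx.
  by rewrite ltrBrDl subrr divr_gt0.
have : p * ln (c / p) <= p * (c / p - 1) by rewrite ler_pM2l.
rewrite ln_div// /xlnx mulrBr mulrBr mulr1 mulrCA mulfV ?gt_eqF// mulr1.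
by lra.
Qed.

(** On the left is the logarithm of the probability of a word with p particles
    under the Bernoulli measure of density theta; it is largest when theta is
    the density of the word. *)
Lemma gibbs n p theta : 0 <= p <= n -> 0 < theta < 1 ->
  p * ln theta + (n - p) * ln (1 - theta) <= block_entropy n p.
Proof.
move=> /andP[p0 pn] /andP[t0 t1]; have t1' : 0 < 1 - theta by rewrite subr_gt0.
have := le_trans p0 pn; rewrite le_eqVlt => /predU1P[n0|n0].
  have pE : p = 0 by apply/le_anti; rewrite p0 n0 pn.
  by rewrite pE -n0 block_entropy0 subrr !mul0r addr0.
have := xlnx_ge p0 (mulr_gt0 n0 t0).
have := @xlnx_ge (n - p) (n * (1 - theta)).
rewrite subr_ge0 mulr_gt0// => /(_ pn isT).
by rewrite !lnM// /block_entropy /(xlnx n); lra.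
Qed.

(** In [gibbs] the left-hand side is linear in (n, p), and equality holds for
    theta = p / n. Taking for both blocks the density that is optimal for their
    union gives the inequality. *)
Lemma block_entropy_subadd n1 p1 n2 p2 : 0 <= p1 <= n1 -> 0 <= p2 <= n2 ->
  block_entropy (n1 + n2) (p1 + p2) <= block_entropy n1 p1 + block_entropy n2 p2.
Proof.
move=> h1 h2; have [/andP[p10 pn1] /andP[p20 pn2]] := (h1, h2).
have [p0|p0] := leP (p1 + p2) 0.
  have e1 : p1 = 0 by lra. have e2 : p2 = 0 by lra.
  by rewrite e1 e2 addr0 !block_entropy0 addr0.
have [pn|pn] := leP (n1 + n2) (p1 + p2).
  have e1 : p1 = n1 by lra. have e2 : p2 = n2 by lra.
  by rewrite e1 e2 !block_entropyn addr0.
have n0 : 0 < n1 + n2 by lra.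
pose t := (p1 + p2) / (n1 + n2).
have t01 : 0 < t < 1 by rewrite divr_gt0//= ltr_pdivrMr// mul1r.
have := gibbs h1 t01; have := gibbs h2 t01.
suff -> : block_entropy (n1 + n2) (p1 + p2) =
  (p1 + p2) * ln t + (n1 + n2 - (p1 + p2)) * ln (1 - t) by lra.
have -> : 1 - t = (n1 + n2 - (p1 + p2)) / (n1 + n2).
  by rewrite mulrBl mulfV// gt_eqF.
rewrite !ln_div ?posrE ?subr_gt0// /block_entropy /xlnx.
by ring.
Qed.

Lemma block_entropy_le0 n p : 0 <= p <= n -> block_entropy n p <= 0.
Proof.
move=> /andP[p0 pn].
have := @block_entropy_subadd p p (n - p) 0.
rewrite lexx p0 lexx subr_ge0 pn addrC subrK addr0 block_entropyn block_entropy0 addr0.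
exact.
Qed.

Lemma block_entropy_ge n p : 0 <= p <= n -> - n * ln 2 <= block_entropy n p.
Proof.
move=> h; have half : 0 < (2^-1 : R) < 1 by lra.
have := gibbs h half; rewrite (_ : 1 - 2^-1 = 2^-1 :> R); last by lra.
rewrite lnV ?posrE//; lra.
Qed.

Lemma cvg_block_entropy T (F : set_system T) (u v : T -> R) n p : Filter F ->
  u @ F --> n -> v @ F --> p -> (fun t => block_entropy (u t) (v t)) @ F --> block_entropy n p.
Proof.
move=> FF un vp; apply: cvgB.
  apply: cvgD; first by apply: continuous_cvg vp; exact: xlnx_continuous.
  by apply: continuous_cvg; [exact: xlnx_continuous|exact: cvgB].
by apply: continuous_cvg un; exact: xlnx_continuous.
Qed.

End block_entropy.

(** * Integrals, difference quotients and dyadic entropies *)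

Section integral_off_null.
Local Open Scope ereal_scope.
Context d (T : measurableType d) (R : realType).
Variables (mu : {measure set T -> \bar R}) (N : set T).
Hypotheses (mN : measurable N) (N0 : mu N = 0).
Import HBNNSimple.

(** Derivatives are controlled only off a null set, and the integrands built
    from them need not be measurable. So the comparison goes through the simple
    functions below f: multiplied by the indicator of the complement of N, they
    are below g and have the same integral. *)
Lemma ge0_integral_eq_off_null (f g : T -> \bar R) :
  (forall x, 0 <= f x) -> (forall x, 0 <= g x) ->
  (forall x, ~ N x -> f x = g x) -> \int[mu]_x f x = \int[mu]_x g x.
Proof.
move=> f0 g0 fg.
suff le (u v : T -> \bar R) : (forall x, 0 <= u x) -> (forall x, 0 <= v x) ->
    (forall x, ~ N x -> u x = v x) -> \int[mu]_x u x <= \int[mu]_x v x.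
  by apply/le_anti; rewrite !le// => x Nx; rewrite fg.
move=> u0 v0 uv; rewrite ge0_integralTE// ge0_integralTE//.
apply: ge_ereal_sup => _ [h /= hu <-].
have projE x : proj_nnsfun h (measurableC mN) x = (h x * \1_(~` N) x)%R by [].
apply: ereal_sup_ubound; exists (proj_nnsfun h (measurableC mN)).
  move=> x; rewrite projE indicE; case: (pselect (N x)) => Nx.
    by rewrite memNset ?mulr0//= => /(_ Nx).
  by rewrite mem_set ?mulr1// -uv.
rewrite -!integralT_nnsfun; apply: ae_eq_integral => //.
- exact/measurable_EFinP.
- exact/measurable_EFinP.
- exists N; split=> // x /= /not_implyP[_]; apply: contra_notP => Nx.
  by rewrite /= mindicE mem_set ?mulr1.
Qed.

Lemma integral_eq_off_null (D : set T) (f g : T -> \bar R) :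
  (forall x, D x -> ~ N x -> f x = g x) ->
  \int[mu]_(x in D) f x = \int[mu]_(x in D) g x.
Proof.
move=> fg; rewrite integralE [RHS]integralE.
congr (_ - _); rewrite integral_mkcond [RHS]integral_mkcond.
  apply: ge0_integral_eq_off_null.
  - by move=> x; rewrite patchE; case: ifP => // _; rewrite funeposE le_max lexx orbT.
  - by move=> x; rewrite patchE; case: ifP => // _; rewrite funeposE le_max lexx orbT.
  - move=> x Nx; rewrite !patchE; case: ifPn => // /set_mem Dx.
    by rewrite !funeposE fg.
apply: ge0_integral_eq_off_null.
- by move=> x; rewrite patchE; case: ifP => // _; rewrite funenegE le_max lexx orbT.
- by move=> x; rewrite patchE; case: ifP => // _; rewrite funenegE le_max lexx orbT.
- move=> x Nx; rewrite !patchE; case: ifPn => // /set_mem Dx.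
  by rewrite !funenegE fg.
Qed.

End integral_off_null.

(** On both sides of x the increment is close to linear with the same slope,
    hence so is the sum of the two increments. *)
Lemma straddle (R : realType) (F : R -> R) (x : R) : derivable F x 1 ->
  forall e, 0 < e -> exists2 d, 0 < d & forall u v, u <= x <= v ->
    x - u < d -> v - x < d -> `|F v - F u - derive1 F x * (v - u)| <= e * (v - u).
Proof.
move=> dF e e0.
have inc : exists2 d, 0 < d & forall h, `|h| < d ->
    `|F (h + x) - F x - derive1 F x * h| <= e * `|h|.
  have : (fun h => h^-1 *: (F (h *: 1 + x) - F x)) @ 0^' --> derive1 F x.
    by rewrite derive1E; exact: dF.
  move/cvgrPdist_le => /(_ e e0); rewrite /at_right near_withinE.
  move=> /nbhs_ballP[d /= d0 H]; exists d => // h hd.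
  have [->|h0] := eqVneq h 0.
    by rewrite add0r subrr mulr0 subrr normr0 mulr0.
  have : ball (0 : R) d h by rewrite /ball/= sub0r normrN.
  move=> /H /(_ h0); rewrite [h *: 1]mulr1 => H1.
  have -> : F (h + x) - F x - derive1 F x * h =
      - (derive1 F x - h^-1 *: (F (h + x) - F x)) * h.
    by rewrite /GRing.scale/=; field.
  by rewrite normrM normrN ler_wpM2r.
have [d d0 H] := inc; exists d => // u v /andP[ux xv] xud vxd.
have h1 := H (v - x); rewrite subrK ger0_norm ?subr_ge0// in h1.
have h2 := H (u - x).
rewrite subrK (@ler0_norm _ (u - x)) ?subr_le0// opprB in h2.
have := h1 vxd; have := h2 xud; rewrite !ler_norml => /andP[a1 a2] /andP[a3 a4].
by apply/andP; split; lra.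
Qed.

Section dyadic.
Context {R : realType}.
Implicit Types F G : R -> R.

(** These are, on [0, 1], the primitives of functions with values in [0, 1]. *)
Definition profile F := F 0 = 0 /\
  forall x y, 0 <= x -> x <= y -> y <= 1 -> 0 <= F y - F x <= y - x.

Definition dyadic (k j : nat) : R := j%:R / 2 ^+ k.

Definition increment F k j := F (dyadic k j.+1) - F (dyadic k j).

(** The entropy integral of the piecewise linear interpolation of F on the grid
    of mesh 2 ^- k. *)
Definition dyadic_entropy k F : R :=
  \sum_(j < 2 ^ k) block_entropy (2 ^- k) (increment F k j).

Lemma half_power_cvg : (fun k => 2^-1 ^+ k : R) @ \oo --> 0.
Proof. by apply: cvg_expr; rewrite ger0_norm ?invr_ge0// invf_lt1// ltr1n. Qed.

Lemma dyadicS k j : dyadic k j.+1 = dyadic k j + 2 ^- k.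
Proof. by rewrite /dyadic -natr1 mulrDl mul1r. Qed.

Lemma dyadic_double k j : dyadic k.+1 (j.*2) = dyadic k j.
Proof.
rewrite /dyadic -muln2 natrM exprS invfM mulrA.
by rewrite -(mulrA j%:R) mulfV ?mulr1.
Qed.

Lemma dyadic_ge0 k j : 0 <= dyadic k j.
Proof. by rewrite divr_ge0// exprn_ge0. Qed.

Lemma dyadic_le k i j : (i <= j)%N -> dyadic k i <= dyadic k j.
Proof. by move=> ij; rewrite ler_pM2r ?ler_nat// invr_gt0 exprn_gt0. Qed.

Lemma dyadic_le1 k j : (j <= 2 ^ k)%N -> dyadic k j <= 1.
Proof. by move=> jk; rewrite ler_pdivrMr ?exprn_gt0// mul1r -natrX ler_nat. Qed.

Lemma increment_itv F k j : profile F -> (j < 2 ^ k)%N ->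
  0 <= increment F k j <= 2 ^- k.
Proof.
move=> [_ pF] jk; have := pF _ _ (dyadic_ge0 k j) (dyadic_le k (leqnSn j)) (dyadic_le1 jk).
by rewrite dyadicS addrAC subrr add0r -dyadicS.
Qed.

Lemma sum_double (V : nmodType) (g : nat -> V) m :
  \sum_(j < m.*2) g j = \sum_(j < m) (g j.*2 + g j.*2.+1).
Proof.
elim: m => [|m IHm]; first by rewrite !big_ord0.
by rewrite doubleS !big_ord_recr/= IHm addrA.
Qed.

(** Each block is cut into two halves, and block entropies are subadditive. *)
Lemma dyadic_entropyS F k : profile F -> dyadic_entropy k F <= dyadic_entropy k.+1 F.
Proof.
move=> pF; rewrite /dyadic_entropy expnS mul2n.
rewrite (sum_double (fun j => block_entropy (2 ^- k.+1) (increment F k.+1 j))).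
apply: ler_sum => j _.
have j2 : (j.*2.+1 < 2 ^ k.+1)%N by rewrite expnS mul2n; have := ltn_ord j; lia.
have -> : 2 ^- k = 2 ^- k.+1 + 2 ^- k.+1 :> R.
  by rewrite exprS invfM; lra.
have -> : increment F k j = increment F k.+1 j.*2 + increment F k.+1 j.*2.+1.
  rewrite /increment -2!(dyadic_double k) doubleS.
  by ring.
by apply: block_entropy_subadd; apply: increment_itv => //; exact: ltnW.
Qed.

Lemma dyadic_entropy_nd F : profile F ->
  {homo dyadic_entropy ^~ F : k l / (k <= l)%N >-> k <= l}.
Proof.
move=> pF; apply: homo_leq => [//|? ? ?|k]; first exact: le_trans.
exact: dyadic_entropyS.
Qed.

Lemma dyadic_block k x : 0 < x < 1 -> exists2 j, (j < 2 ^ k)%N &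
  dyadic k j <= x < dyadic k j.+1.
Proof.
move=> /andP[x0 x1]; have xk0 : 0 <= x * 2 ^+ k by rewrite mulr_ge0 ?exprn_ge0// ltW.
have /andP[h1 h2] := truncn_itv xk0; exists (Num.truncn (x * 2 ^+ k)).
  rewrite -(ltr_nat R) natrX; apply: (le_lt_trans h1).
  by rewrite gtr_pMl// exprn_gt0.
by rewrite ler_pdivrMr ?ltr_pdivlMr ?exprn_gt0// h1.
Qed.

Lemma dyadic_block_uniq k x i j : dyadic k i <= x < dyadic k i.+1 ->
  dyadic k j <= x < dyadic k j.+1 -> i = j.
Proof.
move=> /andP[a1 a2] /andP[b1 b2].
have := le_lt_trans a1 b2; have := le_lt_trans b1 a2.
rewrite !ltr_pM2r ?invr_gt0 ?exprn_gt0// !ltr_nat !ltnS => h1 h2.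
by apply/eqP; rewrite eqn_leq h1 h2.
Qed.

End dyadic.

(** * The entropy integral as a limit of dyadic entropies *)

Section entropy_integral.
Context {R : realType}.
Implicit Types F G : R -> R.

Definition I01 : set (measurableTypeR R) := [set` `[0%R, 1%R]].

Lemma measurable_I01 : measurable I01.
Proof. exact: measurable_itv. Qed.

Lemma mitv (i : interval R) : measurable ([set` i] : set (measurableTypeR R)).
Proof. exact: measurable_itv. Qed.

Lemma lebesgue_ocitv (x y : R) : x <= y ->
  lebesgue_measure (`]x, y]%classic : set (measurableTypeR R)) = (y - x)%:E.
Proof.
move=> xy; rewrite lebesgue_measure_itv/= lte_fin; case: ltP => // h.
by rewrite (_ : x = y) ?subrr//; apply/le_anti; rewrite xy h.
Qed.

Lemma null_with_endpoints (N : set (measurableTypeR R)) : measurable N ->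
  lebesgue_measure N = 0%E ->
  measurable (N `|` [set 0; 1]) /\ lebesgue_measure (N `|` [set 0; 1]) = 0%E.
Proof.
move=> mN N0; have m1 (x : R) : measurable ([set x] : set (measurableTypeR R)).
  exact: measurable_set1.
have m2 : measurable ([set 0; 1] : set (measurableTypeR R)) by exact: measurableU.
split; first exact: measurableU.
by apply: null_set_setU => //; apply: null_set_setU => //; exact: lebesgue_measure_set1.
Qed.

Lemma lebesgue_I01 : lebesgue_measure I01 = 1%E.
Proof. by rewrite /I01 lebesgue_measure_itv/= lte_fin ltr01 -EFinB subr0. Qed.

Lemma integrable_I01 (f : R -> R) (M : R) : measurable_fun I01 f ->
  (forall x, I01 x -> `|f x| <= M) -> lebesgue_measure.-integrable I01 (EFin \o f).
Proof.
move=> mf fM; apply: measurable_bounded_integrable => //.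
- exact: measurable_I01.
- by rewrite [X in (X < _)%E]lebesgue_I01 ltry.
- exists M; split; first exact: num_real.
  by move=> y My x /fM h /=; apply: (le_trans h); exact: ltW.
Qed.

Definition ae_derivable F :=
  {ae lebesgue_measure, forall x : R, x \in `]0, 1[ -> derivable F x 1}.

Lemma entropy_continuous : continuous (@entropy R).
Proof.
move=> u; rewrite (_ : @entropy R = block_entropy 1); last first.
  by apply/funext => x; rewrite entropyE.
by apply: cvg_block_entropy; [exact: cvg_cst|exact: cvg_id].
Qed.

Lemma entropy_bound (u : R) : 0 <= u <= 1 -> `|entropy u| <= ln 2.
Proof.
move=> h; rewrite entropyE ler0_norm ?block_entropy_le0// lerNl.
by rewrite -[X in X <= _]mul1r mulrN -mulNr; apply: block_entropy_ge.
Qed.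

Lemma slope_itv F k j : profile F -> (j < 2 ^ k)%N ->
  0 <= 2 ^+ k * increment F k j <= 1.
Proof.
move=> pF jk; have /andP[h1 h2] := increment_itv pF jk.
by rewrite mulr_ge0 ?exprn_ge0//= mulrC -ler_pdivlMr ?exprn_gt0// mul1r.
Qed.

Definition dyadic_itv (k j : nat) : set R :=
  [set` `[dyadic k j, dyadic k j.+1[%R].

Lemma lebesgue_dyadic_itv k j :
  lebesgue_measure (dyadic_itv k j) = (2 ^- k)%:E.
Proof.
have lt : dyadic k j < dyadic k j.+1 :> R.
  by rewrite dyadicS ltrDl invr_gt0 exprn_gt0.
rewrite /dyadic_itv lebesgue_measure_itv/= lte_fin lt -EFinB.
by rewrite dyadicS addrAC subrr add0r.
Qed.

(** The entropy integrand of the piecewise linear interpolations of F and G;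
    their slopes are 2 ^ k times the increments. *)
Definition step_entropy F G k (x : R) : R :=
  \sum_(j < 2 ^ k) (entropy (2 ^+ k * increment F k j) +
                    entropy (2 ^+ k * increment G k j)) * \1_(dyadic_itv k j) x.

Lemma step_entropyE F G k x j : (j < 2 ^ k)%N -> dyadic k j <= x < dyadic k j.+1 ->
  step_entropy F G k x = entropy (2 ^+ k * increment F k j) +
                         entropy (2 ^+ k * increment G k j).
Proof.
move=> jk xj; rewrite /step_entropy (bigD1 (Ordinal jk))//= big1 ?addr0.
  by rewrite indicE mem_set ?mulr1//= /dyadic_itv/= in_itv.
move=> i ij; rewrite indicE memNset ?mulr0// /dyadic_itv/= in_itv/= => xi.
by move/negP : ij; apply; rewrite -val_eqE/=; apply/eqP; exact: dyadic_block_uniq xi xj.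
Qed.

Lemma integral_step_entropy F G k : profile F -> profile G ->
  (\int[lebesgue_measure]_(x in `[0%R, 1%R]) (step_entropy F G k x)%:E =
   (dyadic_entropy k F + dyadic_entropy k G)%:E)%E.
Proof.
move=> pF pG; rewrite /step_entropy.
under eq_integral do rewrite -sumEFin.
rewrite integral_sum//; last first.
  move=> j; set c := (_ + _).
  apply: (@integrable_I01 (fun x => c * \1_(dyadic_itv k j) x) `|c|).
    apply: measurable_funM; first exact: measurable_cst.
    exact: measurable_indic (measurable_itv _).
  by move=> x _; rewrite indicE; case: (_ \in _); rewrite ?mulr1 ?mulr0 ?normr0.
rewrite -big_split/= -sumEFin; apply: eq_bigr => j _.
under eq_integral do rewrite EFinM.
rewrite integralZl//; last first.
  apply: (@integrable_I01 (\1_(dyadic_itv k j)) 1).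
    exact: measurable_indic (measurable_itv _).
  by move=> x _; rewrite indicE; case: (_ \in _); rewrite ?normr1 ?normr0.
rewrite integral_indic//; last exact: measurable_itv.
rewrite setIidl; last first.
  move=> x /=; rewrite /dyadic_itv/= !in_itv/= => /andP[x0 x1].
  rewrite (le_trans (dyadic_ge0 k j) x0)/= (le_trans (ltW x1))//.
  exact: dyadic_le1.
rewrite [X in (_ * X)%E]lebesgue_dyadic_itv -EFinM; congr _%:E; rewrite !entropyE.
have E (H : R -> R) : profile H -> block_entropy (2 ^- k) (increment H k j) =
    2 ^- k * block_entropy 1 (2 ^+ k * increment H k j).
  move=> pH; have h := slope_itv pH (ltn_ord j).
  by rewrite -block_entropyZ ?invr_gt0 ?exprn_gt0// mulr1 mulrA mulVf ?mul1r.
rewrite (E F)// (E G)//.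
by ring.
Qed.

(** The point x need not be an end of its dyadic block, which is why the
    straddle lemma is used. *)
Lemma slope_cvg F x (j : nat -> nat) : derivable F x 1 ->
  (forall k, dyadic k (j k) <= x < dyadic k (j k).+1) ->
  2 ^+ k * increment F k (j k) @[k --> \oo] --> derive1 F x.
Proof.
move=> dF jx; apply/cvgrPdist_le => e e0.
have [d d0 H] := straddle dF e0.
have [k0 _ hk0] : \forall k \near \oo, 2 ^- k < d :> R.
  have := @half_power_cvg R; move/cvgrPdist_lt => /(_ d d0); apply: filterS => k.
  by rewrite sub0r normrN exprVn ger0_norm// invr_ge0 exprn_ge0.
near=> k.
have kd : 2 ^- k < d by apply: hk0; near: k; exists k0.
have /andP[jx1 jx2] := jx k; have jS := dyadicS k (j k) : _ = _ :> R.
have := H (dyadic k (j k)) (dyadic k (j k).+1).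
rewrite jx1 ltW// => /(_ isT).
have -> : dyadic k (j k).+1 - dyadic k (j k) = 2 ^- k :> R by rewrite jS; ring.
move=> /(_ ltac:(lra) ltac:(lra)); rewrite -/(increment F k (j k)) => h.
have k0' : 0 < 2 ^+ k :> R by rewrite exprn_gt0.
have -> : derive1 F x - 2 ^+ k * increment F k (j k) =
   - 2 ^+ k * (increment F k (j k) - derive1 F x * 2 ^- k).
  by field; rewrite gt_eqF.
by rewrite normrM normrN (gtr0_norm k0') mulrC -ler_pdivlMr.
Unshelve. all: by end_near. Qed.

Lemma step_entropy_bound F G k x : profile F -> profile G -> 0 < x < 1 ->
  `|step_entropy F G k x| <= 2 * ln 2.
Proof.
move=> pF pG x01; have [j jk xj] := dyadic_block k x01.
rewrite (step_entropyE _ _ jk xj) (le_trans (ler_normD _ _))// mulr2n mulrDl mul1r.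
by rewrite lerD// entropy_bound// slope_itv.
Qed.

Lemma step_entropy_cvg F G x : 0 < x < 1 -> derivable F x 1 -> derivable G x 1 ->
  step_entropy F G k x @[k --> \oo] --> entropy (derive1 F x) + entropy (derive1 G x).
Proof.
move=> x01 dF dG.
have /choice[j jP] : forall k, exists j, (j < 2 ^ k)%N /\
    dyadic k j <= x < dyadic k j.+1.
  by move=> k; have [j jk xj] := dyadic_block k x01; exists j.
have jx k : dyadic k (j k) <= x < dyadic k (j k).+1 by have [] := jP k.
under eq_cvg => k do rewrite (@step_entropyE F G k x (j k)) ?(jP k).1//.
apply: cvgD; apply: continuous_cvg; try exact: entropy_continuous.
  exact: slope_cvg.
exact: slope_cvg.
Qed.

Lemma measurable_step_entropy F G k (D : set (measurableTypeR R)) :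
  measurable_fun D (step_entropy F G k).
Proof.
apply: measurable_sum => j; apply: measurable_funM => //.
exact: measurable_indic (measurable_itv _).
Qed.

(** Dominated convergence: at each point where F and G have derivatives the
    slopes of the interpolations converge, and the integrands are bounded by 2
    ln 2. *)
Lemma entropy_integral_cvg F G : profile F -> profile G ->
  ae_derivable F -> ae_derivable G ->
  dyadic_entropy k F + dyadic_entropy k G @[k --> \oo] -->
  \int[lebesgue_measure]_(x in `[0%R, 1%R]) (entropy (derive1 F x) + entropy (derive1 G x)).
Proof.
move=> pF pG [NF [mNF NF0 hF]] [NG [mNG NG0 hG]].
set f := fun x => entropy (derive1 F x) + entropy (derive1 G x).
pose N : set (measurableTypeR R) := NF `|` NG `|` [set 0; 1].
have [mN N0] : measurable N /\ lebesgue_measure N = 0%E.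
  by apply: null_with_endpoints; [exact: measurableU|exact: null_set_setU].
have good x : x \in `[0%R, 1%R] -> ~ N x ->
    [/\ 0 < x < 1, derivable F x 1 & derivable G x 1].
  move=> x01 Nx; have x01' : 0 < x < 1.
    move: x01; rewrite in_itv/= !le_eqVlt => /andP[/predU1P[x0|->]/=].
      by exfalso; apply: Nx; right; left.
    by move=> /predU1P[x1|//]; exfalso; apply: Nx; right; right.
  split=> //.
    apply: contrapT => nd; apply: Nx; left; left; apply: hF => /=.
    by move=> /(_ _)/nd; apply; rewrite in_itv.
  apply: contrapT => nd; apply: Nx; left; right; apply: hG => /=.
  by move=> /(_ _)/nd; apply; rewrite in_itv.
(* Set to 0 on N, the integrand is a limit of measurable functions. *)
pose g x : R := f x * \1_(~` N) x.
pose g_ k x : R := step_entropy F G k x * \1_(~` N) x.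
have mi : measurable_fun I01 (\1_(~` N) : measurableTypeR R -> R).
  by apply: measurable_indic; exact: measurableC.
have gcvg x : x \in `[0%R, 1%R] -> g_ ^~ x @ \oo --> g x.
  move=> x01; rewrite /g /g_; have [Nx|Nx] := pselect (N x).
    rewrite indicE memNset; last by apply.
    by rewrite mulr0; under eq_cvg do rewrite mulr0; exact: cvg_cst.
  have [x0 dF dG] := good _ x01 Nx.
  by apply: cvgMl; exact: step_entropy_cvg.
have mg : measurable_fun I01 g.
  apply: (@measurable_fun_cvg _ _ _ _ g_) => // k.
  by apply: measurable_funM => //; exact: measurable_step_entropy.
have int_eq : (\int[lebesgue_measure]_(x in `[0%R, 1%R]) (f x)%:E =
    \int[lebesgue_measure]_(x in `[0%R, 1%R]) (g x)%:E)%E.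
  apply: (integral_eq_off_null mN N0) => x _ Nx.
  by rewrite /g indicE mem_set ?mulr1.
have mstep k : measurable_fun I01 (fun x => (step_entropy F G k x)%:E).
  by apply/measurable_EFinP; exact: measurable_step_entropy.
have cvg_ae : {ae lebesgue_measure, forall x, I01 x ->
    (fun k => (step_entropy F G k x)%:E) @ \oo --> (g x)%:E}.
  exists N; split=> // x /=; apply: contra_notP => Nx x01.
  have [x0 dF dG] := good x x01 Nx.
  rewrite /g indicE mem_set// mulr1; apply: cvg_EFin; first by apply: nearW.
  exact: step_entropy_cvg.
have icst : lebesgue_measure.-integrable I01 (cst (2 * ln 2 : R)%:E).
  apply: (@integrable_I01 (cst (2 * ln 2)) (2 * ln 2)); first exact: measurable_cst.
  by move=> x _; rewrite ger0_norm// mulr_ge0// ln_ge0// ler1n.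
have bound_ae : {ae lebesgue_measure, forall x (k : nat), I01 x ->
    (`|(step_entropy F G k x)%:E| <= (2 * ln 2)%:E)%E}.
  exists N; split=> // x /=; apply: contra_notP => Nx k x01.
  have [x0 dF dG] := good x x01 Nx.
  by rewrite lee_fin; exact: step_entropy_bound.
have [ig _ cv] := @dominated_convergence _ (measurableTypeR R) R lebesgue_measure
  I01 measurable_I01 _ (EFin \o g) _ mstep
  ltac:(exact/measurable_EFinP) cvg_ae icst bound_ae.
have gE : \int[lebesgue_measure]_(x in `[0%R, 1%R]) f x =
    fine (\int[lebesgue_measure]_(x in `[0%R, 1%R]) (g x)%:E)%E.
  by rewrite /Rintegral int_eq.
rewrite gE; have /fineK gfin := integrable_fin_num measurable_I01 ig.
move: cv; rewrite /= -gfin => /fine_cvgP[_].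
apply: cvg_trans; apply: near_eq_cvg; near=> k.
by rewrite /= integral_step_entropy.
Unshelve. all: by end_near. Qed.

End entropy_integral.

(** * Absolutely continuous functions with slope in [0, 1] *)

(** Cousin's lemma. By the local property at the supremum of the t with P a t,
    this supremum belongs to the set and is not below b. *)
Lemma interval_induction (R : realType) (P : R -> R -> Prop) (a b : R) : a <= b ->
  (forall x y z, x <= y -> y <= z -> P x y -> P y z -> P x z) ->
  (forall t, a <= t <= b -> exists2 d, 0 < d & forall u v, a <= u -> u <= t ->
    t <= v -> v <= b -> t - u < d -> v - t < d -> P u v) ->
  P a b.
Proof.
move=> ab Padd Ploc.
have Paa : P a a.
  have [|d d0] := Ploc a; first by rewrite lexx.
  by apply; rewrite ?subrr.
pose S := [set t | a <= t <= b /\ P a t].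
have Sa : S a by split; rewrite ?lexx.
have Sub : ubound S b by move=> t [/andP[]].
have hS : has_sup S by split; [exists a|exists b].
have as_ : a <= sup S by apply: ub_le_sup => //; exists b.
have sb : sup S <= b by apply: ge_sup => //; exists a.
have [|d d0 Pd] := Ploc (sup S); first by rewrite as_.
have [t [/andP[at_ tb] Pat] ts] := sup_adherent d0 hS.
have tles : t <= sup S.
  by apply: ub_le_sup; [exists b|split=> //; rewrite at_ tb].
have Pas : P a (sup S).
  apply: (Padd _ t) => //; apply: Pd => //; last by rewrite subrr.
  by lra.
have [sltb|bles] := ltP (sup S) b; last first.
  by have -> : b = sup S by apply/le_anti; rewrite sb bles.
pose v := Num.min b (sup S + d / 2).
have vs : sup S < v by rewrite /v lt_min sltb ltrDl divr_gt0.
have vb : v <= b by rewrite /v ge_min lexx.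
have vd : v <= sup S + d / 2 by rewrite /v ge_min lexx orbT.
have : S v.
  split; first by rewrite vb andbT; lra.
  apply: (Padd _ (sup S)) => //; first exact: ltW.
  by apply: Pd => //; rewrite ?subrr//; lra.
by move/(ub_le_sup (ex_intro _ b Sub)); rewrite leNgt vs.
Qed.

Section absolutely_continuous.
Context {R : realType}.
Implicit Types (G : R -> R) (l : seq (R * R)) (U : set (measurableTypeR R)).

Fixpoint chain (u : R) l (v : R) : Prop :=
  if l is p :: l' then [/\ u <= p.1, p.1 <= p.2 & chain p.2 l' v] else u <= v.

Lemma chain_le u l v : chain u l v -> u <= v.
Proof.
by elim: l u => //= p l IHl u [up pp /IHl]; apply: le_trans; exact: le_trans pp.
Qed.

Lemma chain_cat u l1 v l2 w : chain u l1 v -> chain v l2 w -> chain u (l1 ++ l2) w.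
Proof.
elim: l1 u => [|p l1 IHl] u /=.
  case: l2 => [|q l2] /= uv; first exact: le_trans.
  by case=> vq qq c; split=> //; exact: le_trans vq.
by case=> up pp /IHl h /h c; split.
Qed.

Lemma chain_nth u l v i : chain u l v -> (i < size l)%N ->
  [/\ u <= (nth (0, 0) l i).1, (nth (0, 0) l i).1 <= (nth (0, 0) l i).2 &
      (nth (0, 0) l i).2 <= v].
Proof.
elim: l u i => // p l IHl u [|i] /= [up pp c] il.
  by split=> //; exact: chain_le c.
have [h1 h2 h3] := IHl _ _ c il; split=> //.
by rewrite (le_trans up)// (le_trans pp).
Qed.

Lemma chain_nth_lt u l v i j : chain u l v -> (i < j < size l)%N ->
  (nth (0, 0) l i).2 <= (nth (0, 0) l j).1.
Proof.
elim: l u i j => [|p l IHl] u i [|j]; rewrite ?ltn0 ?andbF//.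
case: i => [|i] /= [up pp c]; last exact: IHl c.
by move=> jl; have [] := chain_nth c jl.
Qed.

(** The intervals of a chain are disjoint. *)
Lemma chain_length u l v U : measurable U -> chain u l v ->
  (forall p, p \in l -> `]p.1, p.2] `<=` U) ->
  ((\sum_(p <- l) (p.2 - p.1))%:E <= lebesgue_measure (U `&` `]u, v]%classic))%E.
Proof.
move=> mU; elim: l u => [|p l IHl] u /=; first by rewrite big_nil measure_ge0.
case=> up pp c sub; rewrite big_cons EFinD.
have subl q : q \in l -> `]q.1, q.2] `<=` U by move=> ql; apply: sub; rewrite inE ql orbT.
have {}IHl := IHl _ c subl.
have plen := lebesgue_ocitv pp; have mp := @mitv R `]p.1, p.2]; have mv := @mitv R `]p.2, v].
apply: (@le_trans _ _ (lebesgue_measure (`]p.1, p.2] `|` (U `&` `]p.2, v]%classic)))).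
  rewrite measureU//; first by rewrite [X in (_ <= X + _)%E]plen leeD2l.
  - exact: measurableI.
  - apply/seteqP; split=> // x /= [] ; rewrite !in_itv/= => /andP[_ h1] [_ /andP[h2 _]].
    by have := lt_le_trans h2 h1; rewrite ltxx.
have pv := chain_le c.
apply: le_measure; rewrite ?inE.
- by apply: measurableU => //; exact: measurableI.
- exact: measurableI.
- move=> x [xp|[Ux]].
    split; first by apply: (sub p) => //; rewrite mem_head.
    move: xp; rewrite /= !in_itv/= => /andP[h1 h2].
    by rewrite (le_lt_trans up h1) (le_trans h2).
  rewrite /= !in_itv/= => /andP[h1 h2]; split=> //.
  by rewrite h2 andbT (le_lt_trans _ h1)// (le_trans up).
Qed.

Lemma chain_variation G e d l x y : 0 <= x -> y <= 1 ->
  (forall (k : nat) (u v : 'I_k -> R),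
      (forall i, 0 <= u i /\ u i <= v i /\ v i <= 1) ->
      (forall i j, i != j -> v i <= u j \/ v j <= u i) ->
      \sum_(i < k) (v i - u i) < d ->
      \sum_(i < k) `|G (v i) - G (u i)| < e) ->
  chain x l y -> \sum_(p <- l) (p.2 - p.1) < d ->
  \sum_(p <- l) `|G p.2 - G p.1| < e.
Proof.
move=> x0 y1 ac c; rewrite !(big_nth (0, 0)) !big_mkord => ld.
apply: (ac _ (fun i => (nth (0, 0) l i).1) (fun i => (nth (0, 0) l i).2)) => //.
  move=> i; have [h1 h2 h3] := chain_nth c (ltn_ord i).
  by split; [exact: le_trans h1|split=> //; exact: le_trans y1].
move=> i j; rewrite -val_eqE/= neq_ltn => /orP[ij|ji].
  by left; apply: (chain_nth_lt c); rewrite ij/=.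
by right; apply: (chain_nth_lt c); rewrite ji/=.
Qed.

(** Around a point where G has a derivative in [0, 1] the increments of G over
    small intervals satisfy the bounds up to a factor e. The other points form
    a null set; it has an open neighbourhood of measure less than d, and by
    absolute continuity the increments of G over disjoint intervals contained
    in it add up to less than e. By [interval_induction] such intervals can be
    put together. *)
Lemma calG_profile G : calG G -> profile G.
Proof.
move=> [ac G0 [N0 [mN0 N00 hN0]]]; split=> // x y x0 xy y1.
suff main e : 0 < e -> - e * (1 + (y - x)) <= G y - G x <= (y - x) + e * (1 + (y - x)).
  have yx : 0 < 1 + (y - x) by lra.
  apply/andP; split; apply/ler_addgt0Pr => e e0.
    have /andP[h _] := main _ (divr_gt0 e0 yx).
    by move: h; rewrite mulNr divfK ?gt_eqF//; lra.
  have /andP[_] := main _ (divr_gt0 e0 yx).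
  by rewrite divfK ?gt_eqF//.
move=> e0; have [d d0 acd] := ac e e0.
pose N : set (measurableTypeR R) := N0 `|` [set 0; 1].
have [mN muN] : measurable N /\ lebesgue_measure N = 0%E.
  exact: null_with_endpoints.
have [|U [oU NU dU]] := @lebesgue_regularity_outer R N d mN _ d0.
  by rewrite [X in (X < _)%E]muN ltry.
have muU : (lebesgue_measure U < d%:E)%E.
  have mU : measurable (U : set (measurableTypeR R)) by exact: open_measurable.
  have : (lebesgue_measure (N `|` (U `\` N)) <= lebesgue_measure N + lebesgue_measure (U `\` N))%E.
    by apply: measureU2 => //; exact: measurableD.
  by rewrite setDUK// [X in (_ <= X + _)%E]muN add0e => /le_lt_trans; apply.
(* The chain l records the intervals used around the exceptional points. *)
pose P (u v : R) := exists2 l, chain u l v /\ (forall p, p \in l -> `]p.1, p.2] `<=` U) &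
  - e * (v - u) - \sum_(p <- l) `|G p.2 - G p.1| <= G v - G u <=
  (1 + e) * (v - u) + \sum_(p <- l) `|G p.2 - G p.1|.
have [l [cl lU] lG] : P x y.
  apply: interval_induction => //.
    move=> u v w uv vw [l1 [c1 U1] /andP[L1 R1]] [l2 [c2 U2] /andP[L2 R2]].
    exists (l1 ++ l2); last by rewrite big_cat/=; apply/andP; split; lra.
    split; first exact: chain_cat c2.
    by move=> p; rewrite mem_cat => /orP[/U1|/U2].
  move=> t /andP[xt ty]; have [Nt|Nt] := pselect (N t).
    have /nbhs_ballP[r /= r0 rU] := open_nbhs_nbhs (conj oU (NU _ Nt)).
    exists r => // u v xu ut tv vy tur vtr; exists [:: (u, v)].
      split; first by split=> /=; [|exact: le_trans ut tv|].
      move=> p; rewrite inE => /eqP ->/= z; rewrite /= in_itv/= => /andP[uz zv].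
      by apply: rU; rewrite /ball/= ltr_distl; apply/andP; split; lra.
    have uv := le_trans ut tv.
    rewrite big_seq1/=.
    have := mulr_ge0 (ltW e0) (_ : 0 <= v - u); rewrite subr_ge0 => /(_ uv) h.
    have := ler_norm (G v - G u); have := ler_norm (- (G v - G u)); rewrite normrN.
    by move=> h1 h2; apply/andP; split; lra.
  have t01 : t \in `]0, 1[.
    rewrite in_itv/= !lt_neqAle (le_trans x0 xt) (le_trans ty y1) !andbT.
    by apply/andP; split; apply/eqP => E; apply: Nt; right; [left|right].
  have [dG /andP[D0 D1]] : derivable G t 1 /\ 0 <= derive1 G t <= 1.
    apply: contrapT => nd; apply: Nt; left; apply: hN0 => /= h.
    by apply: nd; exact: h.
  have [r r0 H] := straddle dG e0.
  exists r => // u v xu ut tv vy tur vtr; exists [::].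
    by split=> //=; exact: le_trans ut tv.
  rewrite big_nil subr0 addr0.
  have uv : 0 <= v - u by rewrite subr_ge0; exact: le_trans tv.
  have := H u v; rewrite ut tv => /(_ isT tur vtr); rewrite ler_norml => /andP[h1 h2].
  have := mulr_ge0 D0 uv; have := mulr_ge0 (_ : 0 <= 1 - derive1 G t) uv.
  by rewrite subr_ge0 => /(_ D1) h3 h4; apply/andP; split; lra.
have ld : \sum_(p <- l) (p.2 - p.1) < d.
  rewrite -lte_fin; apply: le_lt_trans muU.
  have mU : measurable (U : set (measurableTypeR R)) by exact: open_measurable.
  apply: le_trans (chain_length mU cl lU) _.
  apply: le_measure; rewrite ?inE//.
  by apply: measurableI => //; exact: measurable_itv.
have := chain_variation x0 y1 acd cl ld.
by move: lG => /andP[h1 h2] h3; apply/andP; split; lra.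
Qed.

End absolutely_continuous.

(** * Measures on [0, 1] with a density in [0, 1] *)

Section profile_measure.
Context {R : realType}.
Implicit Types (F : R -> R) (nu : unit_measure R).
Local Notation T := (measurableTypeR R).

(** Lebesgue measure is an outer measure computed by coverings with half-open
    intervals, and m is countably subadditive. *)
Lemma le_lebesgue (m : {measure set T -> \bar R}) :
  (forall x y : R, x <= y -> (m `]x, y]%classic <= (y - x)%:E)%E) ->
  forall A, measurable A -> (m A <= lebesgue_measure A)%E.
Proof.
move=> mlen A mA; rewrite /lebesgue_measure /lebesgue_stieltjes_measure.
rewrite /measure_extension /mu_ext; apply: le_ereal_inf_tmp => _ [F [mF AF] <-].
have mF' k : measurable (F k : set T) by apply: sub_sigma_algebra; exact: mF.
apply: le_trans (measure_sigma_subadditive _ mF' mA AF) _.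
apply: lee_nneseries => [k _ _|k _]; first exact: measure_ge0.
have /ocitvP[->|[[x y] /= xy ->]] := mF k; first by rewrite measure0 wlength_ge0.
by rewrite wlength_itv_bnd ?mlen// ltW.
Qed.

Definition unit_cdf nu (x : R) : R := fine (sval nu `[0, x]%classic).

Lemma nu_fin nu (A : set T) : measurable A -> sval nu A \is a fin_num.
Proof. by move=> mA; exact: fin_num_measure. Qed.

Lemma cdfE nu (x : R) : sval nu `[0, x]%classic = (unit_cdf nu x)%:E.
Proof. by rewrite /unit_cdf fineK// nu_fin//; exact: mitv. Qed.

Lemma nu_off nu (A : set T) : measurable A -> A `<=` ~` `[0%R, 1%R] -> sval nu A = 0%E.
Proof.
move=> mA A01; apply/le_anti; rewrite measure_ge0 andbT.
apply: (@le_trans _ _ (sval nu (~` `[0%R, 1%R]))); last by rewrite (svalP nu).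
apply: le_measure; rewrite ?inE//.
by apply: measurableC; exact: mitv.
Qed.

Lemma cdf_itv nu (x y : R) : 0 <= x -> x <= y ->
  sval nu `]x, y]%classic = (unit_cdf nu y - unit_cdf nu x)%:E.
Proof.
move=> x0 xy; have : sval nu `[0, y]%classic =
    (sval nu `[0%R, x]%classic + sval nu `]x, y]%classic)%E.
  rewrite -measureU//; try exact: mitv.
    by congr (sval nu _); rewrite -itv_bndbnd_setU// bnd_simp.
  apply/seteqP; split=> // t [] /=; rewrite !in_itv/= => /andP[_ h1] /andP[h2 _].
  by have := lt_le_trans h2 h1; rewrite ltxx.
rewrite !cdfE EFinB => ->; rewrite addeAC subee ?add0e//.
Qed.

Lemma lipschitz_continuous (f : R -> R) :
  (forall x y, x <= y -> 0 <= f y - f x <= y - x) -> continuous f.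
Proof.
move=> fP x; apply/cvgrPdist_le => e e0; near=> y.
have : `|x - y| <= e by near: y; exact: cvgr_dist_le.
rewrite !ler_norml => /andP[h1 h2]; have [xy|/ltW yx] := leP x y.
  by have /andP[h3 h4] := fP _ _ xy; apply/andP; split; lra.
by have /andP[h3 h4] := fP _ _ yx; apply/andP; split; lra.
Unshelve. all: by end_near. Qed.

Definition clamp (x : R) : R := Num.max 0 (Num.min x 1).

Lemma clamp_itv x : 0 <= clamp x <= 1.
Proof. by rewrite /clamp le_max lexx/= ge_max ler01 ge_min lexx orbT. Qed.

Lemma clamp_id x : 0 <= x <= 1 -> clamp x = x.
Proof. by move=> /andP[x0 x1]; rewrite /clamp min_l// max_r. Qed.

Lemma clamp_le x y : x <= y -> 0 <= clamp y - clamp x <= y - x.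
Proof.
move=> xy; rewrite /clamp /Num.max /Num.min.
case: (ltP x 1) => hx; case: (ltP y 1) => hy; rewrite ?ltr01.
- by case: (ltP 0 x) => ?; case: (ltP 0 y) => ?; apply/andP; split; lra.
- by case: (ltP 0 x) => ?; apply/andP; split; lra.
- by case: (ltP 0 y) => ?; apply/andP; split; lra.
- by apply/andP; split; lra.
Qed.

Lemma cdf_len nu : profile (unit_cdf nu) -> forall x y : R, x <= y ->
  (sval nu `]x, y]%classic <= (y - x)%:E)%E.
Proof.
move=> [F0 pF] x y xy; have /andP[d0 d1] := clamp_le xy; rewrite subr_ge0 in d0.
have /andP[x0 x1] := clamp_itv x; have /andP[y0 y1] := clamp_itv y.
have m1 : measurable (`]x, y] `&` ~` `[0, 1] : set T).
  apply: measurableI; first exact: mitv.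
  by apply: measurableC; exact: mitv.
have m2 : measurable ((`]x, y] `&` ~` `[0, 1] `|` [set 0]) : set T).
  by apply: measurableU => //; exact: measurable_set1.
have : (sval nu `]x, y]%classic <= sval nu (`]clamp x, clamp y]%classic `|`
    (`]x, y] `&` ~` `[0%R, 1%R] `|` [set 0%R])))%E.
  apply: le_measure; rewrite ?inE; [exact: mitv|by apply: measurableU => //; exact: mitv|].
  move=> t xty; have [t01|t01] := pselect (`[0%R, 1%R]%classic t); last by right; left.
  have [->|t0] := eqVneq t 0; first by right; right.
  left; move: xty t01; rewrite /= !in_itv/= => /andP[h1 h2] /andP[h3 h4].
  by rewrite /clamp gt_max gt_min h1 le_max le_min h2 h4 orbT lt_neqAle eq_sym t0 h3.
move=> /le_trans; apply; apply: le_trans (measureU2 _ (mitv _) m2) _.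
have e1 := cdf_itv nu x0 d0.
have e2 : sval nu (`]x, y] `&` ~` `[0%R, 1%R] `|` [set 0%R]) = 0%E.
  apply: null_set_setU; [exact: m1|exact: measurable_set1| |].
    by apply: (nu_off nu m1) => t [].
  by have := cdfE nu 0; rewrite F0 set_itv1.
rewrite [X in (X + _ <= _)%E]e1 [X in (_ + X <= _)%E]e2 adde0 lee_fin.
by have /andP[_ h] := pF _ _ x0 d0 y1; exact: le_trans d1.
Qed.

(** The measure is dominated by Lebesgue measure, so its Radon-Nikodym
    derivative exceeds 1 only on a null set. Truncated at 1 it is a density
    with values in [0, 1]. *)
Lemma cdf_density nu : profile (unit_cdf nu) -> exists rho, has_density nu rho.
Proof.
move=> pF; have leL := @le_lebesgue (sval nu) (cdf_len pF).
have dom : sval nu `<< (@lebesgue_measure R).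
  apply/null_content_dominatesP => A mA A0.
  apply/le_anti; rewrite measure_ge0 andbT; apply: le_trans (leL _ mA) _.
  by rewrite [X in (X <= _)%E]A0.
have [f [f0 ffin fint fE]] := radon_nikodym_sigma_finite dom.
have mf : measurable_fun setT f by exact: measurable_int fint.
have mI := @measurable_I01 R; have lamI := @lebesgue_I01 R.
pose I : set T := I01.
pose B : set T := I `&` [set x | (1 < f x)%E].
have mB : measurable B.
  by apply: emeasurable_fun_o_infty => //; exact: measurable_funS mf.
have lamB : (lebesgue_measure B <= 1)%E.
  by rewrite -lamI; apply: le_measure; rewrite ?inE// => x [].
have fB : lebesgue_measure.-integrable B f.
  by apply: integrableS fint.
have oneB : lebesgue_measure.-integrable B (cst 1%E).
  apply/integrableP; split; first exact: measurable_cst.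
  rewrite (eq_integral (cst 1%E)); last by move=> x _; rewrite gee0_abs.
  by rewrite integral_cst// mul1e; apply: le_lt_trans lamB _; rewrite ltry.
(* On B the density exceeds 1, but nu is at most Lebesgue measure there. *)
have B0 : lebesgue_measure B = 0%E.
  have intB : (\int[lebesgue_measure]_(x in B) `|f x - 1| = 0)%E.
    apply/le_anti; rewrite integral_ge0// andbT.
    rewrite (eq_integral (fun x => f x - 1)%E); last first.
      move=> x /set_mem[_ /= fx]; rewrite gee0_abs//.
      by rewrite -(fineK (ffin x)) -EFinB lee_fin subr_ge0 -lee_fin fineK// ltW.
    rewrite integralB// -fE// integral_cst// mul1e.
    rewrite sube_le0; first exact: leL.
  have mfB : measurable_fun B (fun x => f x - 1)%E.
    by apply: emeasurable_funB => //; exact: measurable_funS mf.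
  have [Z [mZ Z0 sub]] := (@ae_eq_integral_abs _ T R lebesgue_measure B mB _ mfB).1 intB.
  apply/le_anti; rewrite measure_ge0 andbT.
  apply: (@le_trans _ _ (lebesgue_measure Z)); last by rewrite [X in (X <= _)%E]Z0.
  apply: le_measure; rewrite ?inE// => x Bx; apply: sub => /= /(_ Bx) h.
  move: Bx => [_ /=]; rewrite -(fineK (ffin x)) lte_fin ltNge => /negP; apply.
  move: h; rewrite /= -(fineK (ffin x)) -EFinB => -[]/eqP.
  by rewrite subr_eq0 => /eqP ->.
pose rho x := fine (mine (f x) 1)%E.
have rhoE x : (rho x)%:E = (mine (f x) 1)%E.
  by rewrite fineK// /mine; case: ifP => // _.
exists rho; split.
- apply/measurable_EFinP; rewrite (_ : EFin \o rho = fun x => mine (f x) 1%E); last first.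
    by apply/funext => x; rewrite /= rhoE.
  apply: measurable_mine => //; first exact: measurable_funS mf.
- move=> x _; rewrite -!lee_fin rhoE le_min f0 lee_fin ler01/=.
  by rewrite ge_min lexx orbT.
- move=> A mA A01; rewrite fE//; apply: (integral_eq_off_null mB B0) => x Ax Bx.
  rewrite rhoE /mine; case: ltP => // h.
  apply/le_anti; rewrite h andbT leNgt; apply/negP => fx1; apply: Bx.
  by split; [exact: A01|].
Qed.

Section stieltjes.
Variables (F : R -> R) (pF : profile F).

(** F made constant outside of [0, 1], a cumulative function on the line. The
    proof that F is a profile is an argument because the canonical instance
    below depends on it. *)
Definition extended_profile of profile F := fun x : R => F (clamp x).

Lemma extended_profile_incr x y : x <= y ->
  0 <= extended_profile pF y - extended_profile pF x <= y - x.
Proof.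
move=> xy; have /andP[c1 c2] := clamp_le xy.
have /andP[x0 x1] := clamp_itv x; have /andP[y0 y1] := clamp_itv y.
have [_ /(_ (clamp x) (clamp y))] := pF; move=> /(_ x0).
rewrite subr_ge0 in c1 => /(_ c1 y1) /andP[h1 h2].
by rewrite h1 (le_trans h2).
Qed.

Lemma extended_profile_nd : {homo extended_profile pF : x y / x <= y}.
Proof. by move=> x y /extended_profile_incr/andP[]; rewrite subr_ge0. Qed.

Lemma extended_profile_rc : right_continuous (extended_profile pF).
Proof.
by apply: right_continuousW => x; apply: lipschitz_continuous; exact: extended_profile_incr.
Qed.

HB.instance Definition _ := isCumulative.Build R _ R (extended_profile pF)
  extended_profile_nd extended_profile_rc.

Let m := lebesgue_stieltjes_measure (extended_profile pF).

Lemma stieltjes_itv x y : x <= y ->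
  m `]x, y]%classic = (extended_profile pF y - extended_profile pF x)%:E.
Proof.
move=> xy; rewrite /m /lebesgue_stieltjes_measure /measure_extension.
rewrite measurable_mu_extE/=; last exact: is_ocitv.
by rewrite wlength_itv_bnd.
Qed.

Lemma stieltjes_fin : (m I01 < +oo)%E.
Proof.
apply: (@le_lt_trans _ _ (m `]-1, 1]%classic)).
  apply: le_measure; rewrite ?inE; [exact: mitv|exact: mitv|].
  by move=> x; rewrite /I01/= !in_itv/= => /andP[h1 ->]; rewrite andbT; lra.
by rewrite stieltjes_itv ?ltry//; lra.
Qed.

Definition profile_finite_measure : {finite_measure set T -> \bar R} :=
  mfrestr (@measurable_I01 R) stieltjes_fin.

Lemma profile_finite_measure_unit :
  profile_finite_measure (~` `[0%R, 1%R]) = 0%E.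
Proof. by rewrite /profile_finite_measure/= /mfrestr /mrestr setICl measure0. Qed.

Definition profile_measure : unit_measure R :=
  exist _ profile_finite_measure profile_finite_measure_unit.

(** The measure has no atom at 0: the extension is constant on the negative
    half-line. *)
Lemma cdf_profile_measure x : 0 <= x <= 1 -> unit_cdf profile_measure x = F x.
Proof.
move=> x01; have /andP[x0 x1] := x01.
rewrite /unit_cdf /profile_measure/= /mfrestr /mrestr setIidl; last first.
  by move=> t; rewrite /I01/= !in_itv/= => /andP[-> /le_trans]; apply.
transitivity (fine (m `[0%R, x]%classic)); first by [].
have -> : m `[0%R, x]%classic = (m [set 0%R] + m `]0%R, x]%classic)%E.
  have ms0 : measurable ([set 0%R] : set T) by exact: measurable_set1.
  rewrite -measureU; [|exact: ms0|exact: mitv|].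
    by congr (m _); rewrite -set_itv1 -itv_bndbnd_setU// bnd_simp.
  by apply/seteqP; split=> // t [->]; rewrite /= in_itv/= ltxx.
have -> : m [set 0%R] = 0%E.
  apply/le_anti; rewrite measure_ge0 andbT.
  apply: (@le_trans _ _ (m `]-1, 0]%classic)).
    apply: le_measure; rewrite ?inE; [exact: measurable_set1|exact: mitv|].
    by move=> t ->; rewrite /= in_itv/= lexx andbT; lra.
  rewrite stieltjes_itv; last lra.
  have cN : clamp (-1) = 0 by rewrite /clamp min_l ?max_l//; lra.
  by rewrite /extended_profile cN clamp_id ?lexx ?ler01// subrr.
rewrite add0e stieltjes_itv// /extended_profile !clamp_id//; last by rewrite lexx ler01.
by have [-> _] := pF; rewrite subr0.
Qed.

End stieltjes.

Section primitive.
Variables (rho : R -> R).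
Hypotheses (mrho : measurable_fun (I01 : set T) (rho : T -> T))
  (rho01 : forall x, x \in `[0, 1] -> 0 <= rho x <= 1).

Lemma integrable_rho x y (b0 b1 : bool) : 0 <= x -> y <= 1 ->
  lebesgue_measure.-integrable ([set` Interval (BSide b0 x) (BSide b1 y)] : set T) (EFin \o rho).
Proof.
move=> x0 y1; apply: (@integrableS _ _ _ _ I01); [exact: mitv|exact: mitv| |].
  move=> t; rewrite /I01/= !in_itv/= => /andP[h1 h2].
  apply/andP; split.
    by apply: (le_trans x0); case: b0 h1 => //= /ltW.
  by apply: le_trans y1; case: b1 h2 => //= /ltW.
apply: (@integrable_I01 _ rho 1) => // t t01; have /andP[h1 h2] := rho01 t01.
by rewrite ger0_norm.
Qed.

Lemma primitive_incr x y : 0 <= x -> x <= y -> y <= 1 ->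
  0 <= primitive rho y - primitive rho x <= y - x.
Proof.
move=> x0 xy y1.
have -> : primitive rho y - primitive rho x =
    \int[lebesgue_measure]_(t in `]x, y]) rho t.
  rewrite /primitive Rintegral_itvB//.
  exact: integrable_rho.
have sub t : t \in `]x, y] -> t \in `[0, 1].
  rewrite !in_itv/= => /andP[h1 h2].
  by rewrite (le_trans x0 (ltW h1)) (le_trans h2).
apply/andP; split.
  by apply: Rintegral_ge0 => t /sub/rho01/andP[].
have -> : y - x = \int[lebesgue_measure]_(t in `]x, y]) (1 : R).
  rewrite Rintegral_cst; last exact: mitv.
  rewrite mul1r [X in fine X](_ : _ = (y - x)%:E)//.
  exact: lebesgue_ocitv.
apply: le_Rintegral; [exact: mitv|exact: integrable_rho| |].
  apply: (@integrableS _ _ _ _ I01); [exact: mitv|exact: mitv| |].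
    by move=> t; exact: sub.
  apply: (@integrable_I01 _ (cst 1) 1); first exact: measurable_cst.
  by move=> t _; rewrite normr1.
by move=> t /sub/rho01/andP[].
Qed.

Lemma primitive0 : primitive rho 0 = 0.
Proof. by rewrite /primitive set_itv1 Rintegral_set1. Qed.

Lemma primitive_profile : profile (primitive rho).
Proof. by split; [exact: primitive0|exact: primitive_incr]. Qed.

(** Lebesgue's differentiation theorem. *)
Lemma primitive_ae : {ae lebesgue_measure, forall x : R, x \in `]0, 1[ ->
  derivable (primitive rho) x 1 /\ derive1 (primitive rho) x = rho x}.
Proof.
pose f := rho \_ I01.
have mf : measurable_fun setT (f : T -> R).
  by apply/(measurable_restrictT _ (@measurable_I01 R)).
have intf : lebesgue_measure.-integrable setT (EFin \o f).
  rewrite /f -restrict_EFin; apply/integrable_restrict => //.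
    exact: mitv.
  by rewrite setTI; exact: integrable_rho.
have intf' (y : R) : lebesgue_measure.-integrable (`[0, y]%classic : set T) (EFin \o f).
  by apply: integrableS intf => //; exact: mitv.
have locf : locally_integrable [set: R] f by apply: open_integrable_locally => //; exact: openT.
have := FTC1 intf' locf.
apply: filterS; first exact: (ae_filter_ringOfSetsType lebesgue_measure).
move=> x /= H; rewrite in_itv/= => /andP[x0 x1].
have [|dF dE] := H; first by rewrite lte_fin.
have E : \forall y \near x, \int[lebesgue_measure]_(t in `[0, y]) f t = primitive rho y.
  near=> y; apply: eq_Rintegral => t; rewrite inE/= in_itv/= => /andP[t0 ty].
  rewrite /f patchE mem_set// /I01/= in_itv/= t0 (le_trans ty)//.
  by apply/ltW; near: y; exact: lt_nbhsl.
split.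
  exact: near_eq_derivable dF.
rewrite -[RHS](_ : f x = rho x); last first.
  by rewrite /f patchE mem_set// /I01/= in_itv/= !ltW.
rewrite -dE !derive1E; apply: near_eq_derive.
by apply: filterS E => y ->.
Unshelve. all: by end_near. Qed.

Lemma primitive_calG : calG (primitive rho).
Proof.
split; [|exact: primitive0|].
  move=> e e0; exists e => // k u v uv _; apply: le_lt_trans.
  apply: ler_sum => i _; have [u0 [uvi v1]] := uv i.
  by have /andP[h1 h2] := primitive_incr u0 uvi v1; rewrite ger0_norm.
apply: filterS primitive_ae; first exact: (ae_filter_ringOfSetsType lebesgue_measure).
move=> x H x01; have [d ->] := H x01; split=> //; apply: rho01.
exact: subset_itv_oo_cc x01.
Qed.

Lemma primitive_ae_derivable : ae_derivable (primitive rho).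
Proof.
apply: filterS primitive_ae; first exact: (ae_filter_ringOfSetsType lebesgue_measure).
by move=> x H /H[].
Qed.

End primitive.

Lemma density_cdf nu rho x : has_density nu rho -> x <= 1 -> unit_cdf nu x = primitive rho x.
Proof.
move=> [_ _ h] x1; rewrite /unit_cdf /primitive /Rintegral h//.
by move=> t; rewrite /= !in_itv/= => /andP[-> /le_trans]; apply.
Qed.

End profile_measure.

(** * The cost without derivatives *)

Section cost.
Context {R : realType}.
Implicit Types (F G : R -> R) (nu : unit_measure R).

Definition inf_diff F G : R := inf [set (F x - G x)%R | x in `[0%R, 1%R]].

(** As ln 0 = 0, a vanishing parameter contributes 0; this is the value of the
    boundary term exactly for the pairs that are [admissible], see
    [boundary_term_admissible] and [boundary_term_fin]. *)
Definition profile_boundary (a b : R) F G : R :=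
  ln a * inf_diff F G + ln b * (inf_diff F G - (F 1 - G 1)).

Definition admissible (a b : R) F G : Prop :=
  (a = 0 -> inf_diff F G = 0) /\ (b = 0 -> inf_diff F G = F 1 - G 1).

(** The cost of the pair (F, G) is at most c. The entropy integral is the
    supremum of the dyadic entropies, which are continuous in the values of F
    and G, so this formulation survives limits of profiles in which derivatives
    do not converge. *)
Definition cost_le (a b c : R) F G : Prop :=
  [/\ profile F, profile G, admissible a b F G &
      forall k, dyadic_entropy k F + dyadic_entropy k G + profile_boundary a b F G <= c].

Definition eq01 F F' := forall x, 0 <= x <= 1 -> F x = F' x.

Lemma eq01_profile F F' : eq01 F F' -> profile F -> profile F'.
Proof.
move=> E [F0 pF]; split; first by rewrite -E ?lexx ?ler01.
move=> x y x0 xy y1; have x01 : 0 <= x <= 1 by rewrite x0 (le_trans xy).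
have y01 : 0 <= y <= 1 by rewrite y1 (le_trans x0).
by rewrite -!E// pF.
Qed.

Lemma eq01_dyadic_entropy F F' k : eq01 F F' ->
  dyadic_entropy k F = dyadic_entropy k F'.
Proof.
move=> E; apply: eq_bigr => j _; rewrite /increment !E//.
  by rewrite dyadic_ge0 dyadic_le1// ltnW.
by rewrite dyadic_ge0 dyadic_le1.
Qed.

Lemma eq01_inf_diff F F' G G' : eq01 F F' -> eq01 G G' ->
  inf_diff F G = inf_diff F' G'.
Proof.
move=> EF EG; congr inf; apply/seteqP; split=> _ /= [x x01 <-]; exists x => //;
  by move: x01; rewrite in_itv/= => x01; rewrite EF// EG.
Qed.

Lemma one01 : 0 <= (1 : R) <= 1. Proof. by rewrite ler01 lexx. Qed.

Lemma eq01_boundary a b F F' G G' : eq01 F F' -> eq01 G G' ->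
  profile_boundary a b F G = profile_boundary a b F' G'.
Proof.
move=> EF EG; rewrite /profile_boundary (eq01_inf_diff EF EG).
by rewrite (EF 1 one01) (EG 1 one01).
Qed.

Lemma eq01_admissible a b F F' G G' : eq01 F F' -> eq01 G G' ->
  admissible a b F G -> admissible a b F' G'.
Proof.
move=> EF EG; rewrite /admissible (eq01_inf_diff EF EG).
by rewrite (EF 1 one01) (EG 1 one01).
Qed.

Lemma eq01_cost_le a b c F F' G : eq01 F F' ->
  cost_le a b c F G -> cost_le a b c F' G.
Proof.
move=> E [pF pG adm cst]; have E' : eq01 G G by [].
split=> //; [exact: eq01_profile pF|exact: eq01_admissible adm|].
by move=> k; rewrite -(eq01_dyadic_entropy k E) -(eq01_boundary _ _ E E').
Qed.

Lemma profile_itv F x : profile F -> 0 <= x <= 1 -> 0 <= F x <= x.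
Proof.
move=> [F0 pF] /andP[x0 x1].
by have := pF 0 x (lexx _) x0 x1; rewrite F0 !subr0.
Qed.

Lemma profile_diff_ge F G x : profile F -> profile G -> 0 <= x <= 1 ->
  -1 <= F x - G x.
Proof.
move=> pF pG x01; have /andP[h1 h2] := profile_itv pF x01.
by have /andP[h3 h4] := profile_itv pG x01; move: x01 => /andP[x0 x1]; lra.
Qed.

Lemma inf_diff_le_lb F G (M x : R) : (forall y, 0 <= y <= 1 -> M <= F y - G y) ->
  0 <= x <= 1 -> inf_diff F G <= F x - G x.
Proof.
move=> h x01; apply: ge_inf; last by exists x => //=; rewrite in_itv.
by exists M => _ /= [y y01 <-]; apply: h; move: y01; rewrite in_itv.
Qed.

Lemma inf_diff_le F G x : profile F -> profile G -> 0 <= x <= 1 ->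
  inf_diff F G <= F x - G x.
Proof.
by move=> pF pG; apply: (inf_diff_le_lb (M := -1)) => y; exact: profile_diff_ge.
Qed.

Lemma inf_diff_ge F G (c : R) : (forall x, 0 <= x <= 1 -> c <= F x - G x) ->
  c <= inf_diff F G.
Proof.
move=> h; apply: lb_le_inf.
  by exists (F 0 - G 0); exists 0 => //=; rewrite in_itv/= lexx ler01.
by move=> _ /= [x x01 <-]; apply: h; move: x01; rewrite in_itv.
Qed.

Lemma inf_diff_itv F G : profile F -> profile G ->
  [/\ inf_diff F G <= 0, inf_diff F G <= F 1 - G 1 & -1 <= inf_diff F G].
Proof.
move=> pF pG; split.
- have := inf_diff_le pF pG (_ : 0 <= 0 <= 1); rewrite lexx ler01 => /(_ isT).
  by case: pF pG => -> _ [-> _]; rewrite subrr.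
- exact: inf_diff_le one01.
- by apply: inf_diff_ge => x; exact: profile_diff_ge.
Qed.

Lemma boundary_term_admissible (a b : R) F G : 0 <= a -> 0 <= b ->
  admissible a b F G ->
  boundary_term a b (inf_diff F G) (F 1 - G 1) = (profile_boundary a b F G)%:E.
Proof.
move=> a0 b0 [ha hb]; rewrite /boundary_term /profile_boundary.
set m := inf_diff F G in ha hb *; set d := F 1 - G 1 in hb *.
case: ifPn => [/andP[a0' b0']|ab].
  by congr _%:E; rewrite lnM//; ring.
have term (c t : R) : 0 <= c -> (c = 0 -> t = 0) -> (lne c%:E * t%:E = (ln c * t)%:E)%E.
  rewrite le_eqVlt => /predU1P[<- /(_ erefl) ->|c0 _]; first by rewrite mule0 mulr0.
  by rewrite lne_EFin.
rewrite (term a)// (term b)// => /hb ->; first by rewrite subrr.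
Qed.

(** The two summands are nonnegative or finite, so a finite sum forbids -oo
    times a negative number. *)
Lemma boundary_term_fin (a b : R) F G : 0 <= a -> 0 <= b ->
  profile F -> profile G ->
  (boundary_term a b (inf_diff F G) (F 1 - G 1)%R < +oo)%E -> admissible a b F G.
Proof.
move=> a0 b0 pF pG; have [m0 md _] := inf_diff_itv pF pG.
rewrite /boundary_term /admissible.
set m := inf_diff F G in m0 md *; set d := F 1 - G 1 in md *.
case: ifPn => [/andP[a0' b0'] _|ab].
  by split=> e; [move: a0'; rewrite e ltxx|move: b0'; rewrite e ltxx].
have inf0 (c t : R) : c = 0 -> t < 0 -> (lne c%:E * t%:E = +oo)%E.
  by move=> -> t0; rewrite le0_lneNy// mulNyr ltr0_sg// mulN1e.
have nNy (c t : R) : 0 <= c -> t <= 0 -> (lne c%:E * t%:E != -oo)%E.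
  move=> + t0; rewrite le_eqVlt => /predU1P[<-|c0]; last by rewrite lne_EFin.
  by move: t0; rewrite le_eqVlt => /predU1P[->|t0]; rewrite ?mule0// inf0.
move=> H; split=> e.
  apply/eqP/contraT => m1; exfalso; move: H.
  rewrite (inf0 a m)//; last by rewrite lt_neqAle m1.
  by rewrite addye ?ltxx// nNy// subr_le0.
apply/eqP/contraT => m1; exfalso; move: H.
rewrite (inf0 b (m - d))//; last by rewrite subr_lt0 lt_neqAle m1.
by rewrite addey ?ltxx// nNy.
Qed.

Lemma tasep_cost_admissible (a b : R) F G : 0 <= a -> 0 <= b ->
  admissible a b F G ->
  tasep_cost a b F G = (\int[lebesgue_measure]_(y in `[0%R, 1%R])
      (entropy (derive1 F y) + entropy (derive1 G y)) + profile_boundary a b F G)%:E.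
Proof.
by move=> a0 b0 adm; rewrite EFinD -boundary_term_admissible.
Qed.

Lemma dyadic_entropy_le_lim F G (l : R) k : profile F -> profile G ->
  dyadic_entropy k F + dyadic_entropy k G @[k --> \oo] --> l ->
  dyadic_entropy k F + dyadic_entropy k G <= l.
Proof.
move=> pF pG cv; have nd : nondecreasing_seq (fun k => dyadic_entropy k F + dyadic_entropy k G).
  by move=> i j ij; rewrite lerD// dyadic_entropy_nd.
have := nondecreasing_cvgn_le nd (cvgP _ cv) k.
by rewrite (cvg_lim _ cv).
Qed.

(** F and G are primitives of densities, of the given measure and of the one
    built from G, so that both are differentiable almost everywhere and the
    dyadic entropies converge to the entropy integral. *)
Lemma cost_le_rate (a b c : R) nu G : 0 <= a -> 0 <= b ->
  cost_le a b c (unit_cdf nu) G -> (I_tasep_measure a b nu <= c%:E)%E.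
Proof.
move=> a0 b0 [pF pG adm cst].
have [rho drho] := cdf_density pF.
have pG' : profile (unit_cdf (profile_measure pG)).
  by apply: (eq01_profile _ pG) => x x01; rewrite cdf_profile_measure.
have [g dg] := cdf_density pG'.
have EF : eq01 (unit_cdf nu) (primitive rho).
  by move=> x /andP[_ x1]; rewrite (density_cdf drho).
have EG : eq01 G (primitive g).
  by move=> x x01; rewrite -(density_cdf dg) ?(cdf_profile_measure pG)//; case/andP: x01.
apply: (@le_trans _ _ (I_tasep a b rho)).
  by apply: ereal_inf_lbound; exists rho.
have [mrho rho01 _] := drho; have [mg g01 _] := dg.
apply: (@le_trans _ _ (tasep_cost a b (primitive rho) (primitive g))).
  apply: ereal_inf_lbound; exists (primitive g) => //.
  exact: primitive_calG.
rewrite tasep_cost_admissible//; last exact: eq01_admissible adm.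
rewrite lee_fin -lerBrDr.
have cv := @entropy_integral_cvg R (primitive rho) (primitive g)
  (primitive_profile mrho rho01) (primitive_profile mg g01)
  (primitive_ae_derivable mrho rho01) (primitive_ae_derivable mg g01).
rewrite -(cvg_lim _ cv)//; apply: limr_le; first exact: cvgP cv.
apply: nearW => k; rewrite lerBrDr.
by rewrite -(eq01_dyadic_entropy k EF) -(eq01_dyadic_entropy k EG) -(eq01_boundary _ _ EF EG).
Qed.

(** The dyadic entropies increase to the entropy integral, so each of them is
    below it. *)
Lemma rate_cost_le (a b c : R) nu : 0 <= a -> 0 <= b ->
  (I_tasep_measure a b nu < c%:E)%E -> exists G, cost_le a b c (unit_cdf nu) G.
Proof.
move=> a0 b0 /ereal_inf_lt[_ [rho drho <-]] /ereal_inf_lt[_ [G cG <-]] lt.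
have [mrho rho01 _] := drho.
have EF : eq01 (primitive rho) (unit_cdf nu).
  by move=> x /andP[_ x1]; rewrite (density_cdf drho).
have pF := primitive_profile mrho rho01.
have pG := calG_profile cG.
have adm : admissible a b (primitive rho) G.
  apply: boundary_term_fin => //; rewrite ltey; apply: contraTN lt => /eqP h.
  by rewrite /tasep_cost [X in (_ + X)%E]h.
move: lt; rewrite tasep_cost_admissible// lte_fin => lt.
have dG : ae_derivable G.
  case: cG => _ _; apply: filterS; first exact: (ae_filter_ringOfSetsType lebesgue_measure).
  by move=> x H /H[].
have cv := entropy_integral_cvg pF pG (primitive_ae_derivable mrho rho01) dG.
exists G; apply: eq01_cost_le EF _; split=> // k.
apply: le_trans (ltW lt); rewrite lerD2r.
exact: dyadic_entropy_le_lim cv.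
Qed.

End cost.

(** * Weak convergence and distribution functions *)

Section ultralimit.
Context {R : realType} {T : Type} (U : set_system T) {UU : UltraFilter U}.

(** An ultrafilter on a compact interval converges. *)
Lemma ultra_cvg (u : T -> R) (a b : R) : (\forall t \near U, a <= u t <= b) ->
  exists2 l, a <= l <= b & u @ U --> l.
Proof.
move=> uab; have UF : ProperFilter (u @ U) by exact: fmap_proper_filter.
have [|l [lab cl]] := @segment_compact R a b (u @ U) UF.
  by apply: filterS uab => t; rewrite /= in_itv.
exists l; first by move: lab; rewrite /= in_itv.
move=> V nV; have [//|h] := in_ultra_setVsetC (u @^-1` V) UU.
have [x [nx Vx]] := cl (~` V) V h nV.
by [].
Qed.

End ultralimit.

Section weak_convergence.
Context {R : realType}.
Implicit Types (nu : unit_measure R).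
Local Notation T := (measurableTypeR R).

(** The weak topology is induced by the topology of pointwise convergence of
    the pairings. *)
Lemma unit_measure_cvg (S : Type) (F : set_system S) (FF : Filter F)
    (nu_ : S -> unit_measure R) nu :
  (forall f, pairing (nu_ t) f @[t --> F] --> (pairing nu f : R)) ->
  nu_ @ F --> nu.
Proof.
move=> h.
have P : (fun t => pairing (nu_ t)) @ F --> pairing nu.
  apply/cvg_sup => f; apply/cvg_image.
    by rewrite eqEsubset; split=> v // _; exists (cst v).
  move=> W hW; have FW := h f _ hW.
  exists ((fun g : test_function R -> R => g f) @^-1` W) => //.
  by rewrite eqEsubset; split=> [j [? + <-//]|j Wj]; exists (fun _ => j).
move=> A /= [_ [[B oB <-] Bnu sBA]].
have nB : nbhs (pairing nu) B by apply: open_nbhs_nbhs.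
have h1 : F ((fun t => pairing (nu_ t)) @^-1` B) := P _ nB.
by apply: (@filterS _ F _ _ _ _ h1) => t; exact: sBA.
Qed.

Lemma pairing_cvg nu (f : test_function R) :
  pairing nu' f @[nu' --> nu] --> (pairing nu f : R).
Proof.
have P : @pairing R @ nu --> pairing nu by exact: initial_continuous.
have Q : (fun g : {ptws test_function R -> R} => g f) @ (pairing nu) --> (pairing nu f : R).
  exact: (@proj_continuous (test_function R) (fun=> R) f (pairing nu)).
exact: (cvg_comp _ _ P Q).
Qed.

Section test_function.
Variable f : R -> R.
Hypothesis cf : {within `[0, 1], continuous f}.

Lemma test_measurable : measurable_fun (I01 : set T) (f : T -> T).
Proof. by apply: subspace_continuous_measurable_fun => //; exact: measurable_I01. Qed.

Lemma test_bounded : exists M, forall x, x \in `[0, 1] -> `|f x| <= M.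
Proof.
have [c1 _ h1] := EVT_max ler01 cf; have [c2 _ h2] := EVT_min ler01 cf.
exists (`|f c1| + `|f c2|) => x x01.
have := h1 x x01; have := h2 x x01.
have := ler_norm (f c1); have := ler_norm (- f c2); rewrite normrN => a1 a2 a3 a4.
have b1 := normr_ge0 (f c1); have b2 := normr_ge0 (f c2).
by rewrite ler_norml; apply/andP; split; lra.
Qed.

Lemma test_integrable nu (A : set T) : measurable A -> A `<=` I01 ->
  (sval nu).-integrable A (EFin \o f).
Proof.
move=> mA A01; have [M fM] := test_bounded.
apply: measurable_bounded_integrable => //.
- by rewrite ltey_eq nu_fin.
- by apply: measurable_funS test_measurable => //; exact: measurable_I01.
- exists M; split; first exact: num_real.
  move=> y My x /A01 x01 /=; apply: (le_trans (fM x _)); last exact: ltW.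
  by rewrite inE in x01 *.
Qed.

(** Uniform continuity of f. Otherwise there are pairs of points at vanishing
    distance on which f differs by more than e; along an ultrafilter both
    points have the same limit, at which f would not be continuous. *)
Lemma uniform_dyadic (e : R) : 0 < e -> exists k, forall j x, (j < 2 ^ k)%N ->
  dyadic k j <= x <= dyadic k j.+1 -> `|f x - f (dyadic k j.+1)| <= e.
Proof.
move=> e0; apply: contrapT => /forallNP H.
have H' k : exists xy : R * R, [/\ 0 <= xy.1 <= 1, 0 <= xy.2 <= 1,
    `|xy.1 - xy.2| <= 2 ^- k & e < `|f xy.1 - f xy.2|].
  apply: contrapT => /forallNP K; apply: (H k) => j x jk /andP[x1 x2].
  rewrite leNgt; apply/negP => he; apply: (K (x, dyadic k j.+1)); split=> //=.
  - rewrite (le_trans (dyadic_ge0 k j) x1) (le_trans x2)//.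
    exact: dyadic_le1.
  - by rewrite dyadic_ge0 dyadic_le1.
  - have E := dyadicS k j : _ = _ :> R.
    by rewrite ler_norml; apply/andP; split; lra.
have /choice[xy xyP] := H'.
have [U [UU sU]] := ultraFilterLemma (@eventually_filter).
have [l /andP[l0 l1] xl] : exists2 l : R, 0 <= l <= 1 & (fun k => (xy k).1) @ U --> l.
  by apply: ultra_cvg; apply: nearW => k; have [] := xyP k.
have d0 : (fun k => (xy k).1 - (xy k).2) @ U --> (0 : R).
  apply/norm_cvg0P.
  have e2 : (fun k => 2^-1 ^+ k : R) @ U --> (0 : R).
    by apply: cvg_trans (@half_power_cvg R) => A; exact: sU.
  apply: (@squeeze_cvgr _ _ _ _ (fun=> 0) (fun k => 2^-1 ^+ k : R)) e2.
    by apply: nearW => k; rewrite normr_ge0/= exprVn; have [] := xyP k.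
  exact: cvg_cst.
have yl : (fun k => (xy k).2) @ U --> l.
  rewrite (_ : (fun k => (xy k).2) = fun k => (xy k).1 - ((xy k).1 - (xy k).2)).
    by rewrite -[X in _ --> X](subr0 l); exact: cvgB.
  by apply/funext => k; rewrite opprB addrC subrK.
have fl (z : nat -> R) : (forall k, 0 <= z k <= 1) -> z @ U --> l ->
    (fun k => f (z k)) @ U --> f l.
  move=> z01 zl; have lin : `[0, 1]%classic l by rewrite /= in_itv/= l0.
  have h := (subspace_continuousP _ _).1 cf l lin.
  move=> V hV; have h1 := zl _ (h _ hV).
  apply: (@filterS _ U _ _ _ _ h1) => k /=; apply.
  by rewrite in_itv; exact: z01.
have f1 := fl _ (fun k => let: And4 h _ _ _ := xyP k in h) xl.
have f2 := fl _ (fun k => let: And4 _ h _ _ := xyP k in h) yl.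
have c : (fun k => f (xy k).1 - f (xy k).2) @ U --> (0 : R).
  by rewrite -[X in _ --> X](subrr (f l)); exact: cvgB.
have h : \forall k \near U, `|0 - (f (xy k).1 - f (xy k).2)| < e.
  by move/cvgrPdist_lt : c; apply.
have [k /=] := filter_ex h; rewrite sub0r normrN.
by have [_ _ _] := xyP k => /lt_trans h1 /h1; rewrite ltxx.
Qed.

(** The Riemann-Stieltjes sum of f. The blocks are open on the left, and the
    atom at 0 is counted apart. *)
Definition riemann k nu : R := f 0 * unit_cdf nu 0 +
  \sum_(j < 2 ^ k) f (dyadic k j.+1) * increment (unit_cdf nu) k j.

Lemma riemann_bound k (e : R) nu : 0 <= e -> (forall j x, (j < 2 ^ k)%N ->
    dyadic k j <= x <= dyadic k j.+1 -> `|f x - f (dyadic k j.+1)| <= e) ->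
  `|\int[sval nu]_(x in `[0, 1]) f x - riemann k nu| <= e * unit_cdf nu 1.
Proof.
move=> e0 fe.
suff main m : (m <= 2 ^ k)%N ->
  `|\int[sval nu]_(x in `[0, dyadic k m]) f x - (f 0 * unit_cdf nu 0 +
    \sum_(j < m) f (dyadic k j.+1) * increment (unit_cdf nu) k j)| <=
  e * unit_cdf nu (dyadic k m).
  have := main _ (leqnn _); rewrite (_ : dyadic k (2 ^ k) = 1)//.
  by rewrite /dyadic natrX divff// expf_neq0.
elim: m => [|m IHm] mk.
  rewrite (_ : dyadic k 0 = 0); last by rewrite /dyadic mul0r.
  rewrite big_ord0 addr0 (@eq_Rintegral _ _ _ _ _ (cst (f 0))); last first.
    by move=> x; rewrite inE set_itv1 => ->.
  rewrite Rintegral_cst; last exact: mitv.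
  rewrite subrr normr0 mulr_ge0//.
  by rewrite /unit_cdf fine_ge0// measure_ge0.
have d0 := dyadic_ge0 k m : 0 <= _ :> R; have d1 := dyadic_le1 mk : _ <= 1 :> R.
have dm : dyadic k m < dyadic k m.+1 :> R.
  by rewrite dyadicS ltrDl invr_gt0 exprn_gt0.
have U0 : [set` `[0%R, dyadic k m.+1]] =
    [set` `[0%R, dyadic k m]] `|` [set` `]dyadic k m, dyadic k m.+1]] :> set T.
  by rewrite -itv_bndbnd_setU// bnd_simp// ltW.
rewrite U0 Rintegral_setU; [|exact: mitv|exact: mitv| |]; last 2 first.
- rewrite -U0; apply: test_integrable; first exact: mitv.
  by move=> x; rewrite /I01/= !in_itv/= => /andP[-> /le_trans]; apply.
- apply/disj_setPS => x [] /=; rewrite !in_itv/= => /andP[_ h1] /andP[h2 _].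
  by have := lt_le_trans h2 h1; rewrite ltxx.
rewrite big_ord_recr/=.
have cE : increment (unit_cdf nu) k m = fine (sval nu `]dyadic k m, dyadic k m.+1]%classic).
  by rewrite (cdf_itv nu d0 (ltW dm)).
have c0 : 0 <= increment (unit_cdf nu) k m by rewrite cE fine_ge0// measure_ge0.
have isub : [set` `]dyadic k m, dyadic k m.+1]] `<=` (I01 : set T).
  move=> x; rewrite /I01/= !in_itv/= => /andP[h1 h2].
  by rewrite (le_trans d0 (ltW h1)) (le_trans h2).
have incr : `|\int[sval nu]_(x in `]dyadic k m, dyadic k m.+1]) f x -
    f (dyadic k m.+1) * increment (unit_cdf nu) k m| <= e * increment (unit_cdf nu) k m.
  have icst (c : R) : (sval nu).-integrable [set` `]dyadic k m, dyadic k m.+1]] (EFin \o cst c).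
    by apply: finite_measure_integrable_cst; exact: mitv.
  have ici (c : R) : \int[sval nu]_(x in `]dyadic k m, dyadic k m.+1]) c =
      c * increment (unit_cdf nu) k m.
    by rewrite Rintegral_cst ?cE//; exact: mitv.
  have ifx := test_integrable nu (mitv `]dyadic k m, dyadic k m.+1]) isub.
  rewrite ler_distl -mulrBl -mulrDl -!ici; apply/andP; split.
    apply: le_Rintegral; [exact: mitv|exact: icst|exact: ifx|].
    move=> x; rewrite /= in_itv/= => /andP[h1 h2].
    have := fe m x mk; rewrite (ltW h1) h2 => /(_ isT); rewrite ler_distl => /andP[] //.
  apply: le_Rintegral; [exact: mitv|exact: ifx|exact: icst|].
  move=> x; rewrite /= in_itv/= => /andP[h1 h2].
  have := fe m x mk; rewrite (ltW h1) h2 => /(_ isT); rewrite ler_distl => /andP[] //.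
have -> : unit_cdf nu (dyadic k m.+1) = unit_cdf nu (dyadic k m) + increment (unit_cdf nu) k m.
  by rewrite /increment addrC subrK.
have := lerD (IHm (ltnW mk)) incr; rewrite -mulrDr; apply: le_trans.
apply: (le_trans _ (ler_normD _ _)); rewrite le_eqVlt; apply/orP; left; apply/eqP.
by congr `|_|; ring.
Qed.

End test_function.

Lemma ler_dist3 (x y r s e : R) : `|x - r| <= e / 3 -> `|y - s| <= e / 3 ->
  `|r - s| <= e / 3 -> `|x - y| <= e.
Proof.
by rewrite !ler_distl => /andP[? ?] /andP[? ?] /andP[? ?]; apply/andP; split; lra.
Qed.

(** Riemann-Stieltjes sums involve finitely many values of the distribution
    function, and approximate the integrals uniformly over measures of bounded
    mass. *)
Lemma cdf_cvg (S : Type) (F : set_system S) (FF : ProperFilter F)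
    (nu_ : S -> unit_measure R) nu :
  (forall x, 0 <= x <= 1 -> unit_cdf (nu_ t) x @[t --> F] --> unit_cdf nu x) ->
  nu_ @ F --> nu.
Proof.
move=> cv; apply: unit_measure_cvg => -[f cf]; rewrite /pairing /=.
apply/cvgrPdist_le => e e0.
pose M := unit_cdf nu 1 + 1.
have nu0 : 0 <= unit_cdf nu 1 by rewrite /unit_cdf fine_ge0// measure_ge0.
have M0 : 0 < M by rewrite /M; lra.
have e1 : 0 < e / (3 * M) by rewrite divr_gt0// mulr_gt0.
have [k fk] := uniform_dyadic cf e1.
have rc : riemann f k (nu_ t) @[t --> F] --> riemann f k nu.
  apply: cvgD.
    by apply: cvgMr; apply: cv; rewrite lexx ler01.
  apply: cvg_big => [|j _]; first exact: add_continuous.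
  apply: cvgMr; apply: cvgB; apply: cv.
    by rewrite dyadic_ge0 dyadic_le1.
  by rewrite dyadic_ge0 dyadic_le1// ltnW.
have c1 := cv 1 (one01); near=> t.
have t1 : unit_cdf (nu_ t) 1 <= M.
  near: t; apply: (cvgr_le (unit_cdf nu 1)) => //; rewrite /M; lra.
have t2 : `|riemann f k nu - riemann f k (nu_ t)| <= e / 3.
  by near: t; apply: cvgr_dist_le => //; rewrite divr_gt0.
have b1 := riemann_bound cf nu (ltW e1) fk.
have b2 := riemann_bound cf (nu_ t) (ltW e1) fk.
have b1' := le_trans b1 (ler_wpM2l (ltW e1) (_ : unit_cdf nu 1 <= M)).
have b2' := le_trans b2 (ler_wpM2l (ltW e1) t1).
have eM : e / (3 * M) * M = e / 3 by rewrite invfM mulrA divfK// gt_eqF.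
move: b2' (b1' ltac:(rewrite /M; lra)); rewrite eM => {}b2 {}b1.
exact: ler_dist3 b1 b2 t2.
Unshelve. all: by end_near. Qed.

End weak_convergence.

(** * Limits of profiles and lower semicontinuity *)

Lemma le_limits (R : realType) (S : Type) (U : set_system S) {PU : ProperFilter U}
    (f g : S -> R) (l l' : R) :
  f @ U --> l -> g @ U --> l' -> (\forall t \near U, f t <= g t) -> l <= l'.
Proof.
move=> fl gl h; rewrite -subr_ge0; apply: (cvgr_to_ge (cvgB gl fl)).
by apply: filterS h => t; rewrite subr_ge0.
Qed.

Section profile_limits.
Context {R : realType} {S : Type}.
Implicit Types (F G : R -> R).

(** The values lie in compact intervals and hence converge along U; the
    inequalities pass to the limit, in which the error d vanishes. *)
Lemma near_profile_limit (U : set_system S) {UU : UltraFilter U} (F_ : S -> R -> R) (d : S -> R) :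
  d @ U --> (0 : R) ->
  (\forall t \near U, F_ t 0 = 0 /\ forall x y, 0 <= x -> x <= y -> y <= 1 ->
     0 <= F_ t y - F_ t x <= y - x + d t) ->
  exists2 F, profile F & forall x, 0 <= x <= 1 -> F_ t x @[t --> U] --> F x.
Proof.
move=> d0 nF.
have d1 : \forall t \near U, d t <= 1 by apply: (cvgr_le 0).
have /choice[F cF] : forall x, exists l : R, 0 <= x <= 1 -> F_ t x @[t --> U] --> l.
  move=> x; case: (boolP (0 <= x <= 1)) => x01; last by exists 0.
  have [|l _ cl] := @ultra_cvg R S U UU (fun t => F_ t x) 0 2; last by exists l.
  apply: filterS2 nF d1 => t [F0 Ft] dt; have /andP[x0 x1] := x01.
  by have := Ft 0 x (lexx _) x0 x1; rewrite F0 !subr0 => /andP[h1 h2]; apply/andP; split; lra.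
exists F => //; split.
  have c0 := cF 0 (_ : 0 <= 0 <= 1); rewrite lexx ler01 in c0.
  have h : F_ t 0 @[t --> U] --> (0 : R).
    by apply: cvg_near_cst; apply: filterS nF => t [].
  exact: (cvg_unique _ (c0 isT) h).
move=> x y x0 xy y1.
have cx := cF x (introT andP (conj x0 (le_trans xy y1))).
have cy := cF y (introT andP (conj (le_trans x0 xy) y1)).
have cyx : (fun t => F_ t y - F_ t x) @ U --> F y - F x by exact: cvgB.
apply/andP; split.
  apply: (cvgr_to_ge cyx).
  by apply: filterS nF => t [_ /(_ x y x0 xy y1)/andP[]].
have cd : (fun t => y - x + d t) @ U --> y - x.
  by rewrite -[X in _ --> X]addr0; apply: cvgD => //; exact: cvg_cst.
apply: (le_limits cyx cd).
by apply: filterS nF => t [_ /(_ x y x0 xy y1)/andP[]].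
Qed.

Lemma small_dyadic (e : R) : 0 < e -> exists k : nat, 2 ^- k <= e.
Proof.
move=> e0; have := @half_power_cvg R; move/cvgrPdist_le => /(_ e e0) h; have [k] := filter_ex h.
by rewrite sub0r normrN exprVn ger0_norm ?invr_ge0 ?exprn_ge0// => ?; exists k.
Qed.

Lemma harmonic_near (e : R) : 0 < e -> \forall n \near \oo, n.+1%:R^-1 <= e.
Proof.
have := @cvg_harmonic R; move/cvgrPdist_le => h /h; apply: filterS => n.
by rewrite sub0r normrN ger0_norm// invr_ge0.
Qed.

(** The infimum is 1-Lipschitz for the uniform distance. *)
Lemma inf_diff_close F F' G G' (e : R) : profile F -> profile G ->
  (forall x, 0 <= x <= 1 -> `|F' x - F x| <= e) ->
  (forall x, 0 <= x <= 1 -> `|G' x - G x| <= e) ->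
  `|inf_diff F' G' - inf_diff F G| <= 2 * e.
Proof.
move=> pF pG FF GG.
have h x : 0 <= x <= 1 -> F x - G x - 2 * e <= F' x - G' x <= F x - G x + 2 * e.
  move=> x01; move: (FF x x01) (GG x x01); rewrite !ler_norml => /andP[? ?] /andP[? ?].
  by apply/andP; split; lra.
have lb x : 0 <= x <= 1 -> inf_diff F G - 2 * e <= F' x - G' x.
  move=> x01; have := inf_diff_le pF pG x01; have /andP[] := h x x01; lra.
rewrite ler_norml; apply/andP; split.
  by have := inf_diff_ge lb; lra.
rewrite lerBlDr -lerBlDl; apply: inf_diff_ge => x x01.
by have := inf_diff_le_lb lb x01; have /andP[] := h x x01; lra.
Qed.

(** With q = e / (2 m), the exponential is at least (q (n + 1)) ^ (2 m). *)
Lemma poly_le_exp (e : R) m : 0 < e ->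
  \forall n \near \oo, n.+2%:R ^+ m <= expR (e * n.+1%:R) :> R.
Proof.
move=> e0; case: m => [|m].
  by apply: filterE => n; rewrite expr0 -expR0 ler_expR mulr_ge0// ltW.
pose q := e / (2 * m.+1%:R); have q0 : 0 < q by rewrite divr_gt0// mulr_gt0.
have : \forall n \near \oo, n.+1%:R^-1 <= q ^+ 2 / 2 :> R.
  by apply: harmonic_near; rewrite divr_gt0 ?exprn_gt0.
apply: filterS => n h; have N0 : (0 : R) < n.+1%:R by [].
have -> : e * n.+1%:R = m.+1%:R * (2 * (q * n.+1%:R)).
  have x0 : (m.+1%:R : R) != 0 by rewrite pnatr_eq0.
  by rewrite /q; move: (m.+1%:R : R) x0 => x x0; field.
rewrite expRM_natl lerXn2r ?nnegrE ?expR_ge0// expRM_natl.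
apply: (@le_trans _ _ ((q * n.+1%:R) ^+ 2)); last first.
  have qN : 0 <= q * n.+1%:R by rewrite mulr_ge0// ltW.
  rewrite lerXn2r ?nnegrE ?expR_ge0//.
  by apply: le_trans (expR_ge1Dx _); rewrite lerDr.
rewrite exprMn.
have : 2 * n.+1%:R <= q ^+ 2 * n.+1%:R ^+ 2.
  rewrite expr2 mulrA ler_pM2r//; move: h; rewrite ler_pdivlMr// => h.
  by rewrite -(@ler_pM2l _ n.+1%:R^-1) ?invr_gt0// mulrCA mulVf ?mulr1.
apply: le_trans; rewrite -[n.+2]addn1 natrD mulr2n mulrDl mul1r lerD2l.
by rewrite ler1n.
Qed.

Section uniform.
Variables (U : set_system S) (UU : ProperFilter U).

Definition monotone_near (F_ : S -> R -> R) := \forall t \near U, forall x y : R,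
  0 <= x -> x <= y -> y <= 1 -> F_ t x <= F_ t y.

Definition pointwise_cvg (F_ : S -> R -> R) (F : R -> R) :=
  forall x : R, 0 <= x <= 1 -> F_ t x @[t --> U] --> F x.

(** Polya's theorem: between two neighbouring grid points F_ t is controlled by
    its values there, by monotonicity, and F varies by at most the mesh. *)
Lemma pointwise_cvg_uniform (F_ : S -> R -> R) F : profile F ->
  monotone_near F_ -> pointwise_cvg F_ F ->
  forall e : R, 0 < e -> \forall t \near U, forall x, 0 <= x <= 1 -> `|F_ t x - F x| <= e.
Proof.
move=> [F0 pF] mF cF e e0.
have e2 : 0 < e / 2 by rewrite divr_gt0.
have [k ke] := small_dyadic e2.
have fin : \forall t \near U, forall j : 'I_(2 ^ k).+1,
    `|F (dyadic k j) - F_ t (dyadic k j)| <= e / 2.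
  apply: filter_forall => j; have jk : (j <= 2 ^ k)%N by rewrite -ltnS.
  have := cF (dyadic k j); rewrite dyadic_ge0 dyadic_le1// => /(_ isT).
  by move/cvgrPdist_le => /(_ _ e2).
apply: filterS2 mF fin => t mono fint x x01.
have fj j : (j <= 2 ^ k)%N -> `|F_ t (dyadic k j) - F (dyadic k j)| <= e / 2.
  by move=> jk; rewrite distrC; have := fint (Ordinal (jk : (j < (2 ^ k).+1)%N)).
have [x0|x0] := leP x 0.
  have -> : x = dyadic k 0.
    by rewrite /dyadic mul0r; apply/le_anti; rewrite x0; case/andP: x01.
  by apply: le_trans (fj 0%N _) _ => //; lra.
have [x1|x1] := leP 1 x.
  have -> : x = dyadic k (2 ^ k).
    rewrite /dyadic natrX divff ?expf_neq0//.
    by apply/le_anti; rewrite x1 andbT; case/andP: x01.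
  by apply: le_trans (fj _ (leqnn _)) _; lra.
have [|j jk /andP[jx xj]] := @dyadic_block R k x; first by rewrite x0.
have /andP[xx0 xx1] := x01.
have dj0 := dyadic_ge0 k j : 0 <= _ :> R; have dj1 := dyadic_le1 jk : _ <= 1 :> R.
have m1 := mono _ _ dj0 jx xx1; have m2 := mono _ _ xx0 (ltW xj) dj1.
have /andP[_ p1] := pF _ _ dj0 (ltW (le_lt_trans jx xj)) dj1.
have /andP[p2 _] := pF _ _ dj0 jx xx1.
have /andP[p3 _] := pF _ _ xx0 (ltW xj) dj1.
have := fj _ jk; have := fj _ (ltnW jk); rewrite !ler_norml => /andP[a1 a2] /andP[a3 a4].
have jS := dyadicS k j : _ = _ :> R.
by apply/andP; split; lra.
Qed.

Lemma inf_diff_cvg (F_ G_ : S -> R -> R) F G : profile F -> profile G ->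
  monotone_near F_ -> monotone_near G_ -> pointwise_cvg F_ F -> pointwise_cvg G_ G ->
  inf_diff (F_ t) (G_ t) @[t --> U] --> inf_diff F G.
Proof.
move=> pF pG mF mG cF cG; apply/cvgrPdist_le => e e0.
have e2 : 0 < e / 2 by rewrite divr_gt0.
have uF := pointwise_cvg_uniform pF mF cF e2; have uG := pointwise_cvg_uniform pG mG cG e2.
apply: filterS2 uF uG => t uF uG; rewrite distrC.
by apply: le_trans (inf_diff_close pF pG uF uG) _; lra.
Qed.

Lemma dyadic_entropy_cvg (F_ : S -> R -> R) F k : pointwise_cvg F_ F ->
  dyadic_entropy k (F_ t) @[t --> U] --> dyadic_entropy k F.
Proof.
move=> cF; apply: cvg_big => [|j _]; first exact: add_continuous.
apply: cvg_block_entropy; first exact: cvg_cst.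
apply: cvgB; apply: cF; first by rewrite dyadic_ge0 dyadic_le1.
by rewrite dyadic_ge0 dyadic_le1// ltnW.
Qed.

(** By [pointwise_cvg_uniform] the boundary term is continuous, and the
    constraints for vanishing parameters are closed. The h k are dyadic
    entropies in [rate_lsc], entropies of words in [pair_bound]. *)
Lemma cost_le_closed (a b c : R) (F_ G_ : S -> R -> R) F G (h : nat -> S -> R) :
  profile F -> profile G ->
  monotone_near F_ -> monotone_near G_ -> pointwise_cvg F_ F -> pointwise_cvg G_ G ->
  (\forall t \near U, admissible a b (F_ t) (G_ t)) ->
  (forall k, h k @ U --> dyadic_entropy k F + dyadic_entropy k G) ->
  (forall k, \forall t \near U, h k t + profile_boundary a b (F_ t) (G_ t) <= c) ->
  cost_le a b c F G.
Proof.
move=> pF pG mF mG cF cG adm ch hc.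
have cI := inf_diff_cvg pF pG mF mG cF cG.
have c1 : F_ t 1 - G_ t 1 @[t --> U] --> F 1 - G 1.
  by apply: cvgB; [apply: cF one01|apply: cG one01].
split=> //.
- split=> e.
    have c0 : inf_diff (F_ t) (G_ t) @[t --> U] --> (0 : R).
      by apply: cvg_near_cst; apply: filterS adm => t [/(_ e)].
    exact: (cvg_unique _ cI c0).
  have c2 : inf_diff (F_ t) (G_ t) @[t --> U] --> F 1 - G 1.
    apply: cvg_trans c1; apply: near_eq_cvg.
    by apply: filterS adm => t [_ /(_ e)].
  exact: (cvg_unique _ cI c2).
- move=> k; have cB : profile_boundary a b (F_ t) (G_ t) @[t --> U] --> profile_boundary a b F G.
    by apply: cvgD; apply: cvgMr => //; exact: cvgB.
  exact: (cvgr_to_le (cvgD (ch k) cB) (hc k)).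
Qed.

End uniform.
End profile_limits.

Section lower_semicontinuity.
Context {R : realType}.
Local Notation T := (measurableTypeR R).
Implicit Types (nu : unit_measure R).

Lemma clamp_continuous : continuous (@clamp R).
Proof. exact: lipschitz_continuous (@clamp_le R). Qed.

(** A continuous function between the indicators of [0, x] and of [0, y], which
    relates weak convergence to distribution functions. *)
Definition ramp (x y t : R) : R := clamp ((y - t) / (y - x)).

Lemma ramp_continuous x y : {within `[0, 1], continuous (ramp x y)}.
Proof.
apply: continuous_subspaceT => t; rewrite /ramp.
apply: (@continuous_comp _ _ _ (fun t => (y - t) / (y - x)) clamp); last exact: clamp_continuous.
by apply: cvgMl; apply: cvgB; [exact: cvg_cst|exact: cvg_id].
Qed.

Definition ramp_test x y : test_function R := exist _ (ramp x y) (@ramp_continuous x y).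

Lemma const_continuous (c : R) : {within (`[0, 1]%classic : set R), continuous (fun _ : R => c)}.
Proof. by apply: continuous_subspaceT => t; exact: cvg_cst. Qed.

Definition const_test (c : R) : test_function R := exist _ (fun=> c) (@const_continuous c).

Lemma pairing_const nu : pairing nu (const_test 1) = unit_cdf nu 1.
Proof. by rewrite /pairing/= Rintegral_cst ?mul1r//; exact: mitv. Qed.

Lemma Rintegral_indic01 nu (x : R) : x <= 1 ->
  \int[sval nu]_(t in `[0, 1]) (\1_(`[0, x]%classic : set T) t : R) = unit_cdf nu x.
Proof.
move=> x1; rewrite /Rintegral integral_indic; [|exact: mitv|exact: mitv].
rewrite /unit_cdf; congr (fine (sval nu _)); rewrite setIidl// => t.
by rewrite /= !in_itv/= => /andP[-> /le_trans]; apply.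
Qed.

Lemma indic_integrable nu (x : R) :
  (sval nu).-integrable (`[0, 1]%classic : set T) (EFin \o \1_(`[0, x]%classic : set T)).
Proof.
apply: measurable_bounded_integrable; first exact: mitv.
- by rewrite ltey_eq nu_fin//; exact: mitv.
- by apply: measurable_indic; exact: mitv.
- exists 1; split; first exact: num_real.
  move=> y y1 t _ /=; rewrite indicE; case: (_ \in _); rewrite ?normr1 ?normr0; lra.
Qed.

Lemma ramp_cdf nu x y : 0 <= x -> x < y -> y <= 1 ->
  unit_cdf nu x <= pairing nu (ramp_test x y) <= unit_cdf nu y.
Proof.
move=> x0 xy y1; have x1 := ltW (lt_le_trans xy y1).
have yx : 0 < y - x by rewrite subr_gt0.
have r01 t : 0 <= ramp x y t <= 1 by exact: clamp_itv.
have ir : (sval nu).-integrable (`[0, 1]%classic : set T) (EFin \o ramp x y).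
  by apply: test_integrable; [exact: ramp_continuous|exact: mitv|].
rewrite -!Rintegral_indic01// /pairing/=; apply/andP; split.
  apply: le_Rintegral; [exact: mitv|exact: indic_integrable|exact: ir|].
  move=> t _; rewrite indicE; case: (boolP (t \in _)) => [|_]; last by have /andP[] := r01 t.
  rewrite inE/= in_itv/= => /andP[_ tx]; rewrite /ramp /clamp min_r ?max_r//.
  by rewrite ler_pdivlMr// mul1r lerD2l lerN2.
apply: le_Rintegral; [exact: mitv|exact: ir|exact: indic_integrable|].
move=> t; rewrite /= in_itv/= => /andP[t0 t1].
rewrite indicE; case: (boolP (t \in _)) => [_|]; first by have /andP[] := r01 t.
rewrite notin_setE/= in_itv/= t0/= => /negP; rewrite -ltNge => yt.
have q : (y - t) / (y - x) < 0 by rewrite pmulr_llt0 ?invr_gt0// subr_lt0.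
by rewrite /ramp /clamp max_l// ge_min ltW.
Qed.

(** By [ramp_cdf] the limit F at x is between the values of the distribution
    function of nu slightly to the left and slightly to the right, and F is
    continuous. At the right end there is no room for a ramp, and the constant
    function 1 is used instead. *)
Lemma cdf_limit (U : set_system (unit_measure R)) (PU : ProperFilter U) nu F :
  U --> nu -> profile F ->
  (forall x, 0 <= x <= 1 -> unit_cdf nu' x @[nu' --> U] --> F x) ->
  eq01 F (unit_cdf nu).
Proof.
move=> Unu [F0 pF] cF.
have cp f : pairing nu' f @[nu' --> U] --> (pairing nu f : R).
  by move=> V hV; exact: (Unu _ (pairing_cvg hV)).
have F1 : F 1 = unit_cdf nu 1.
  rewrite -pairing_const.
  apply: (cvg_unique (@Rhausdorff R) (cF 1 one01)).
  have := cp (const_test 1); apply: cvg_trans; apply: near_eq_cvg.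
  by apply: nearW => nu'; rewrite /= pairing_const.
have le1 x y : 0 <= x -> x < y -> y <= 1 -> F x <= unit_cdf nu y.
  move=> x0 xy y1; have /andP[_ h] := ramp_cdf nu x0 xy y1; apply: le_trans h.
  have x01 : 0 <= x <= 1 by rewrite x0 (ltW (lt_le_trans xy y1)).
  apply: (le_limits (cF x x01) (cp _)); apply: nearW => nu'.
  by have /andP[] := ramp_cdf nu' x0 xy y1.
have le2 x y : 0 <= x -> x < y -> y <= 1 -> unit_cdf nu x <= F y.
  move=> x0 xy y1; have /andP[h _] := ramp_cdf nu x0 xy y1; apply: (le_trans h).
  have y01 : 0 <= y <= 1 by rewrite y1 (ltW (le_lt_trans x0 xy)).
  apply: (le_limits (cp _) (cF y y01)); apply: nearW => nu'.
  by have /andP[] := ramp_cdf nu' x0 xy y1.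
move=> x /andP[x0 x1]; apply/le_anti/andP; split.
  have [->|xn0] := eqVneq x 0; first by rewrite F0 /unit_cdf fine_ge0// measure_ge0.
  apply/ler_addgt0Pr => e e0; pose z := Num.max 0 (x - e).
  have zx : z < x by rewrite /z gt_max lt_neqAle eq_sym xn0 x0 ltrBlDr ltrDl.
  have z0 : 0 <= z by rewrite /z le_max lexx.
  have /andP[_ h] := pF z x z0 (ltW zx) x1.
  have := le1 z x z0 zx x1; have : x - e <= z by rewrite /z le_max lexx orbT.
  by lra.
have [->|xn1] := eqVneq x 1; first by rewrite F1.
apply/ler_addgt0Pr => e e0; pose z := Num.min 1 (x + e).
have zx : x < z by rewrite /z lt_min lt_neqAle xn1 x1 ltrDl.
have z1 : z <= 1 by rewrite /z ge_min lexx.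
have /andP[_ h] := pF x z x0 (ltW zx) z1.
have := le2 x z x0 zx z1; have : z <= x + e by rewrite /z ge_min lexx orbT.
by lra.
Qed.

(** If the sublevel set of c accumulated at nu, an ultrafilter on this set
    would converge to nu. Each of its measures has a second profile with cost
    at most c', and the limit of the second profiles along the ultrafilter
    would show that the rate at nu is at most c'. *)
Lemma rate_lsc (a b : R) : 0 <= a -> 0 <= b ->
  lower_semicontinuous (@I_tasep_measure R a b).
Proof.
move=> a0 b0 nu c cI.
have [c' cc' c'I] : exists2 c' : R, c < c' & (c'%:E < I_tasep_measure a b nu)%E.
  move: cI; case: (I_tasep_measure a b nu) => [r||]; rewrite ?lte_fin ?ltNge ?leNye// => cr.
    by exists ((c + r) / 2); rewrite ?lte_fin; lra.
  by exists (c + 1); [lra|rewrite ltry].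
apply: contrapT => nV.
(* The failure of lower semicontinuity is that nu is in the closure of D. *)
pose D : set (unit_measure R) := [set nu' | (I_tasep_measure a b nu' <= c%:E)%E].
have PD : ProperFilter (within D (nbhs nu)).
  apply: Build_ProperFilter => n0; apply: nV.
  exists (fun nu' => D nu' -> False) => // nu' h.
  by rewrite ltNge; apply/negP => Dn; exact: h.
have [U [UU sU]] := ultraFilterLemma PD.
have UD : U D by apply: sU; rewrite /within/=; apply: filterE => ?.
have Unu : U --> nu.
  by move=> A nA; apply: sU; rewrite /within/=; apply: filterS nA => ?.
have /choice[G_ GP] : forall nu', exists G, D nu' -> cost_le a b c' (unit_cdf nu') G.
  move=> nu'; have [Dn|Dn] := pselect (D nu'); last by exists (fun=> 0).
  have [|G GP] := @rate_cost_le R a b c' nu' a0 b0; last by exists G.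
  by apply: (le_lt_trans Dn); rewrite lte_fin.
have P nu' : D nu' -> profile (unit_cdf nu') /\ profile (G_ nu').
  by move=> /GP[].
have d0 : (fun=> 0 : R) @ U --> (0 : R) by exact: cvg_cst.
have [|F pF cF] := @near_profile_limit R _ U UU (@unit_cdf R) _ d0.
  apply: filterS UD => nu' /P[[F0 pF] _]; split=> // x y x0 xy y1.
  by rewrite addr0; exact: pF.
have [|G pG cG] := @near_profile_limit R _ U UU G_ _ d0.
  apply: filterS UD => nu' /P[_ [F0 pF']]; split=> // x y x0 xy y1.
  by rewrite addr0; exact: pF'.
have EF := cdf_limit (@ultra_proper _ _ UU) Unu pF cF.
have : cost_le a b c' (unit_cdf nu) G.
  apply: eq01_cost_le EF _.
  apply: (@cost_le_closed R _ U _ a b c' (@unit_cdf R) G_ F G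
    (fun k nu' => dyadic_entropy k (unit_cdf nu') + dyadic_entropy k (G_ nu'))) => //.
  - apply: filterS UD => nu' /P[[_ pF'] _] x y x0 xy y1.
    by have /andP[] := pF' x y x0 xy y1; rewrite subr_ge0.
  - apply: filterS UD => nu' /P[_ [_ pF']] x y x0 xy y1.
    by have /andP[] := pF' x y x0 xy y1; rewrite subr_ge0.
  - by apply: filterS UD => nu' /GP[].
  - by move=> k; apply: cvgD; exact: dyadic_entropy_cvg.
  - by move=> k; apply: filterS UD => nu' /GP[].
move/(cost_le_rate a0 b0) => /(lt_le_trans c'I).
by rewrite ltxx.
Qed.

End lower_semicontinuity.

(** * Counting words by the particle numbers of their blocks *)

Lemma particles_cat s t : particles (s ++ t) = (particles s + particles t)%N.
Proof. exact: count_cat. Qed.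

Lemma particles_le_size s : (particles s <= size s)%N.
Proof. exact: count_size. Qed.

Lemma particles_take_le s i j : (i <= j)%N ->
  (particles (take i s) <= particles (take j s) <= particles (take i s) + (j - i))%N.
Proof.
move=> ij; have -> : take j s = take i s ++ take (j - i) (drop i s).
  by rewrite -{1}(subnKC ij) takeD.
rewrite particles_cat leq_addr leq_add2l/=.
by apply: leq_trans (particles_le_size _) _; rewrite size_take_min geq_minl.
Qed.

Lemma deficit_ge s t i : size s = size t ->
  (particles (take i t) <= particles (take i s) + deficit s t)%N.
Proof.
elim: s t i => [|x s IHs] [|y t] [|i] //= [/(IHs _ i)].
by rewrite /particles/=; case: x; case: y => /=; lia.
Qed.

Lemma deficit_ex s t : size s = size t -> exists2 i, (i <= size s)%N &
  (particles (take i t) = particles (take i s) + deficit s t)%N.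
Proof.
elim: s t => [|x s IHs] [|y t] //=; first by move=> _; exists 0%N.
move=> [st].
have [i il ie] := IHs _ st.
have [e|e] := ltnP x (y + deficit s t); last by exists 0%N; rewrite ?take0//=; lia.
exists i.+1; rewrite ?ltnS//= /particles/= -!/(particles _).
by move: e; case: x; case: y => /=; lia.
Qed.

Lemma sum_words_cat (V : nmodType) (f : seq bool -> V) m n :
  \sum_(s <- words (m + n)) f s =
  \sum_(u <- words m) \sum_(v <- words n) f (u ++ v).
Proof.
elim: m f => [|m IHm] f; first by rewrite add0n /= big_seq1.
by rewrite addSn /= !big_cat !big_map /= !IHm.
Qed.

Lemma count_words n p : count (fun u => particles u == p) (words n) = 'C(n, p).
Proof.
elim: n p => [|n IHn] p; first by case: p.
rewrite /= count_cat !count_map; case: p => [|p].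
  rewrite bin0 (@eq_count _ _ pred0); last by move=> u.
  rewrite count_pred0 add0n (@eq_count _ _ (fun u => particles u == 0%N)); last by move=> u.
  by rewrite IHn bin0.
rewrite binS addnC; congr (_ + _)%N; rewrite -IHn; apply: eq_count => u //=.
Qed.

Section chernoff.
Context {R : realType}.
Implicit Types theta : R.

Lemma sum_bernoulli theta n :
  \sum_(u <- words n) theta ^+ particles u * (1 - theta) ^+ (n - particles u) = 1.
Proof.
elim: n => [|n IHn]; first by rewrite big_seq1 /= mulr1.
rewrite /= big_cat !big_map /=.
set S := (X in X = 1) in IHn; transitivity (theta * S + (1 - theta) * S); last first.
  by rewrite IHn !mulr1 addrC subrK.
rewrite /S !mulr_sumr; congr (_ + _).
  apply: eq_bigr => u _.
  by rewrite /particles/= add1n exprS subSS mulrA.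
apply: eq_big_seq => u.
rewrite mem_words => /eqP un; have := particles_le_size u; rewrite un => pn.
by rewrite /particles/= add0n -/(particles u) subSn// exprS mulrCA.
Qed.

Definition nat_entropy (n p : nat) : R := block_entropy n%:R p%:R.

(** The probability of a word with p particles under the Bernoulli measure of
    density p / n. *)
Lemma expR_nat_entropy n p : (0 < n)%N -> (p <= n)%N ->
  expR (nat_entropy n p) =
  (p%:R / n%:R : R) ^+ p * (1 - p%:R / n%:R) ^+ (n - p).
Proof.
move=> n0 pn; have n0' : (0 : R) < n%:R by rewrite ltr0n.
have [->|p0] := posnP p.
  by rewrite /nat_entropy block_entropy0 expR0 mul0r expr0 subr0 subn0 expr1n mul1r.
move: pn; rewrite leq_eqVlt => /predU1P[->|pn].
  by rewrite /nat_entropy block_entropyn expR0 divff ?gt_eqF// expr1n subnn mul1r.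
have p0' : (0 : R) < p%:R by rewrite ltr0n.
have np0 : (0 : R) < n%:R - p%:R by rewrite subr_gt0 ltr_nat.
have -> : 1 - p%:R / n%:R = (n%:R - p%:R) / n%:R :> R.
  by rewrite mulrBl divff// gt_eqF.
have a0 : (0 : R) < p%:R / n%:R by rewrite divr_gt0.
have b0 : (0 : R) < (n%:R - p%:R) / n%:R by rewrite divr_gt0.
rewrite -[X in _ = X * _]lnK ?posrE ?exprn_gt0// -[X in _ = _ * X]lnK ?posrE ?exprn_gt0//.
rewrite -expRD !lnXn// !ln_div ?posrE//; congr expR.
rewrite -!(mulr_natl (ln _ - _)) (natrB _ (ltnW pn)).
by rewrite /nat_entropy /block_entropy /xlnx; ring.
Qed.

(** By [expR_nat_entropy] the term of u is at most the sum over p = 0, ..., n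
    of the probabilities of u under the Bernoulli measures of density p / n,
    and each of these n + 1 measures has mass 1. *)
Lemma chernoff n : \sum_(u <- words n) expR (nat_entropy n (particles u)) <= n.+1%:R.
Proof.
case: n => [|n].
  by rewrite big_seq1 /nat_entropy block_entropy0 expR0.
have term u : u \in words n.+1 -> expR (nat_entropy n.+1 (particles u)) <=
    \sum_(p < n.+2) ((p%:R / n.+1%:R : R) ^+ particles u *
      (1 - p%:R / n.+1%:R) ^+ (n.+1 - particles u)).
  rewrite mem_words => /eqP un; have pn : (particles u < n.+2)%N.
    by rewrite ltnS -un particles_le_size.
  rewrite (bigD1 (Ordinal pn))//= expR_nat_entropy// lerDl.
  apply: sumr_ge0 => p _; rewrite mulr_ge0// exprn_ge0// ?divr_ge0// subr_ge0.
  by rewrite ler_pdivrMr ?ltr0n// mul1r ler_nat -ltnS.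
apply: (@le_trans _ _ (\sum_(u <- words n.+1) \sum_(p < n.+2)
  ((p%:R / n.+1%:R : R) ^+ particles u * (1 - p%:R / n.+1%:R) ^+ (n.+1 - particles u)))).
  by rewrite big_seq [leRHS]big_seq; exact: ler_sum.
rewrite exchange_big/= (eq_bigr (fun=> 1)); last by move=> p _; exact: (sum_bernoulli (p%:R / n.+1%:R) n.+1).
by rewrite sumr_const card_ord.
Qed.

(** The ratio of the binomial weights of k + 1 and k is at least 1 exactly
    below the mean, which is p here. *)
Lemma binomial_mode n p : (0 < p < n)%N -> forall k, (k <= n)%N ->
  'C(n, k)%:R * ((p%:R / n%:R : R) ^+ k * (1 - p%:R / n%:R) ^+ (n - k)) <=
  'C(n, p)%:R * ((p%:R / n%:R : R) ^+ p * (1 - p%:R / n%:R) ^+ (n - p)).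
Proof.
move=> /andP[p0 pn]; pose T k : R := 'C(n, k)%:R *
  ((p%:R / n%:R : R) ^+ k * (1 - p%:R / n%:R) ^+ (n - k)).
have n0 : (0 : R) < n%:R by rewrite ltr0n; lia.
have p0' : (0 : R) < p%:R by rewrite ltr0n.
have np0 : (0 : R) < n%:R - p%:R by rewrite subr_gt0 ltr_nat.
have E : 1 - p%:R / n%:R = (n%:R - p%:R) / n%:R :> R.
  by rewrite mulrBl divff// gt_eqF.
have T0 k : 0 <= T k.
  by rewrite /T E !mulr_ge0// exprn_ge0// divr_ge0// ltW.
have ratio k : (k < n)%N ->
    T k.+1 * (k.+1%:R * (n%:R - p%:R)) = T k * ((n - k)%:R * p%:R).
  move=> kn; rewrite /T E (_ : (n - k = (n - k.+1).+1)%N); last by lia.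
  have bin : 'C(n, k.+1)%:R * k.+1%:R = 'C(n, k)%:R * (n - k.+1).+1%:R :> R.
    have k1 : (n - k = (n - k.+1).+1)%N by lia.
    by rewrite -!natrM -k1 mulnC mul_bin_left mulnC.
  rewrite !exprS; set x := (p%:R / n%:R) ^+ k; set y := (_ / _) ^+ (n - k.+1).
  transitivity (('C(n, k.+1)%:R * k.+1%:R) * (p%:R / n%:R * x * y * (n%:R - p%:R))).
    by ring.
  by rewrite bin; field; rewrite gt_eqF.
have up k : (k < p)%N -> T k <= T k.+1.
  move=> kp; have kn : (k < n)%N by lia.
  have d0 : 0 < (k.+1%:R * (n%:R - p%:R) : R) by rewrite mulr_gt0.
  rewrite -(ler_pM2r d0) ratio//; apply: ler_wpM2l; first exact: T0.
  rewrite -natrB; last by lia.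
  rewrite -!natrM ler_nat; nia.
have down k : (p <= k < n)%N -> T k.+1 <= T k.
  move=> /andP[pk kn].
  have d0 : 0 < (k.+1%:R * (n%:R - p%:R) : R) by rewrite mulr_gt0.
  rewrite -(ler_pM2r d0) ratio//; apply: ler_wpM2l; first exact: T0.
  rewrite -natrB; last by lia.
  rewrite -!natrM ler_nat; nia.
have mono_up d k : (k + d <= p)%N -> T k <= T (k + d)%N.
  elim: d => [|d IHd]; first by rewrite addn0.
  by rewrite addnS => kd; apply: le_trans (IHd (ltnW kd)) (up _ kd).
have mono_down d : (p + d <= n)%N -> T (p + d)%N <= T p.
  elim: d => [|d IHd]; first by rewrite addn0.
  rewrite addnS => kd; apply: le_trans (IHd (ltnW kd)); apply: down; lia.
move=> k kn; rewrite -/(T k) -/(T p); have [kp|/ltnW pk] := leqP k p.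
  by have := mono_up (p - k)%N k; rewrite subnKC//; apply.
by have := mono_down (k - p)%N; rewrite subnKC//; apply.
Qed.

(** The largest of n + 1 probabilities of sum 1 is at least 1 / (n + 1). *)
Lemma binomial_ge n p : (p <= n)%N ->
  1 <= n.+1%:R * ('C(n, p)%:R * expR (nat_entropy n p)).
Proof.
move=> pn; have [p0|p0] := posnP p.
  by rewrite p0 /nat_entropy block_entropy0 expR0 bin0 !mulr1 ler1n.
move: pn; rewrite leq_eqVlt => /predU1P[->|pn].
  by rewrite /nat_entropy block_entropyn expR0 binn !mulr1 ler1n.
have n0 : (0 < n)%N by lia.
pose theta : R := p%:R / n%:R.
rewrite expR_nat_entropy//; last exact: ltnW.
rewrite -{1}(sum_bernoulli theta n).
have -> : \sum_(u <- words n) theta ^+ particles u * (1 - theta) ^+ (n - particles u) =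
    \sum_(k < n.+1) 'C(n, k)%:R * (theta ^+ k * (1 - theta) ^+ (n - k)).
  have E u : u \in words n -> theta ^+ particles u * (1 - theta) ^+ (n - particles u) =
      \sum_(k < n.+1) (particles u == k)%:R * (theta ^+ k * (1 - theta) ^+ (n - k)).
    rewrite mem_words => /eqP un; have pu : (particles u < n.+1)%N.
      by rewrite ltnS -un particles_le_size.
    rewrite (bigD1 (Ordinal pu))//= eqxx mul1r big1 ?addr0// => k.
    by rewrite -val_eqE/= eq_sym => /negbTE ->; rewrite mul0r.
  rewrite (eq_big_seq _ E) exchange_big/=; apply: eq_bigr => k _.
  rewrite -mulr_suml; congr (_ * _); rewrite -count_words -natr_sum; congr _%:R.
  by elim: (words n) => [|u w IHw]; rewrite ?big_nil ?big_cons//= IHw.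
apply: le_trans (_ : _ <= \sum_(k < n.+1) 'C(n, p)%:R *
    (theta ^+ p * (1 - theta) ^+ (n - p))) _.
  apply: ler_sum => k _; apply: binomial_mode; first by rewrite p0.
  by rewrite -ltnS.
by rewrite sumr_const card_ord -[leLHS]mulr_natl.
Qed.

Definition block_count (q : nat -> nat) (j : nat) (s : seq bool) : nat :=
  (particles (take (q j.+1) s) - particles (take (q j) s))%N.

(** A word of length q K is the concatenation of its blocks, which range over
    all words of their lengths independently. *)
Lemma sum_words_blocks (q : nat -> nat) (g : nat -> nat -> R) K :
  q 0%N = 0%N -> (forall j, (q j <= q j.+1)%N) ->
  \sum_(s <- words (q K)) \prod_(j < K) g j (block_count q j s) =
  \prod_(j < K) \sum_(v <- words (q j.+1 - q j)) g j (particles v).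
Proof.
move=> q0 qS; have qle : {homo q : i j / (i <= j)%N}.
  by apply: homo_leq => [//|? ? ?|//]; exact: leq_trans.
elim: K => [|K IHK]; first by rewrite q0 /= big_seq1 !big_ord0.
rewrite big_ord_recr/= -IHK -{1}(subnKC (qS K)) sum_words_cat mulr_suml.
apply: eq_big_seq => u; rewrite mem_words => /eqP uq; rewrite mulr_sumr.
apply: eq_big_seq => v; rewrite mem_words => /eqP vq; rewrite big_ord_recr/=.
congr (_ * g K _).
  apply: eq_bigr => j _; rewrite /block_count !takel_cat ?uq ?qle//.
  exact: ltnW.
rewrite /block_count take_oversize ?size_cat ?uq ?vq ?subnKC//.
by rewrite -uq take_size_cat// particles_cat addKn.
Qed.

Definition blocks_entropy (q : nat -> nat) K s : R :=
  \sum_(j < K) nat_entropy (q j.+1 - q j) (block_count q j s).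

Lemma blocks_chernoff q K : q 0%N = 0%N -> (forall j, (q j <= q j.+1)%N) ->
  \sum_(s <- words (q K)) expR (blocks_entropy q K s) <= (q K).+1%:R ^+ K.
Proof.
move=> q0 qS; under eq_bigr do rewrite expR_sum.
rewrite (sum_words_blocks (fun j p => expR (nat_entropy (q j.+1 - q j) p)))//.
have qle : {homo q : i j / (i <= j)%N}.
  by apply: homo_leq => [//|? ? ?|//]; exact: leq_trans.
have -> : (q K).+1%:R ^+ K = \prod_(j < K) (q K).+1%:R :> R.
  by rewrite prodr_const card_ord.
apply: ler_prod => j _.
apply/andP; split; first by apply: sumr_ge0 => v _; exact: expR_ge0.
apply: le_trans (chernoff _) _; rewrite ler_nat ltnS.
by apply: leq_trans (leq_subr _ _) _; exact: qle.
Qed.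

Lemma nat_entropy_subadd n1 p1 n2 p2 : (p1 <= n1)%N -> (p2 <= n2)%N ->
  nat_entropy (n1 + n2) (p1 + p2) <= nat_entropy n1 p1 + nat_entropy n2 p2.
Proof.
by move=> h1 h2; rewrite /nat_entropy !natrD block_entropy_subadd// ler0n ler_nat.
Qed.

Definition split_point N k j := (N * j %/ 2 ^ k)%N.

Lemma split_point0 N k : split_point N k 0 = 0%N.
Proof. by rewrite /split_point muln0 div0n. Qed.

Lemma split_point_le N k j : (split_point N k j <= split_point N k j.+1)%N.
Proof. by rewrite leq_div2r// leq_mul2l leqnSn orbT. Qed.

Lemma split_point_last N k : split_point N k (2 ^ k) = N.
Proof. by rewrite /split_point mulnK// expn_gt0. Qed.

Lemma split_point_double N k j : split_point N k.+1 j.*2 = split_point N k j.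
Proof. by rewrite /split_point expnS -muln2 mulnA mulnC divnMl. Qed.

Definition split_entropy N k s := blocks_entropy (split_point N k) (2 ^ k) s.

Lemma split_chernoff N k :
  \sum_(s <- words N) expR (split_entropy N k s) <= N.+1%:R ^+ (2 ^ k).
Proof.
have := @blocks_chernoff (split_point N k) (2 ^ k).
by rewrite split_point_last; apply; [exact: split_point0|exact: split_point_le].
Qed.

(** The split points of level k are those of even index at level k + 1. *)
Lemma split_entropyS N k s : split_entropy N k s <= split_entropy N k.+1 s.
Proof.
rewrite /split_entropy /blocks_entropy expnS mul2n.
rewrite (sum_double (fun j => nat_entropy (split_point N k.+1 j.+1 -
  split_point N k.+1 j) (block_count (split_point N k.+1) j s))).
apply: ler_sum => j _; rewrite -!(split_point_double N k) doubleS.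
set a0 := split_point _ _ _.*2; set a1 := split_point _ _ _.*2.+1.
set a2 := split_point _ _ _.*2.+2.
have h1 : (a0 <= a1)%N by exact: split_point_le.
have h2 : (a1 <= a2)%N by exact: split_point_le.
have -> : block_count (split_point N k) j s =
  (block_count (split_point N k.+1) j.*2 s + block_count (split_point N k.+1) j.*2.+1 s)%N.
  rewrite /block_count -!(split_point_double N k) doubleS -/a0 -/a1 -/a2.
  have /andP[? _] := particles_take_le s h1; have /andP[? _] := particles_take_le s h2; lia.
have -> : (a2 - a0 = (a1 - a0) + (a2 - a1))%N by lia.
rewrite nat_entropy_subadd// /block_count -/a0 -/a1 -/a2.
  by have := particles_take_le s h1; lia.
by have := particles_take_le s h2; lia.
Qed.

Lemma split_entropy_le N i j s : (i <= j)%N -> split_entropy N i s <= split_entropy N j s.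
Proof.
move=> ij; rewrite -(subnKC ij); elim: (j - i)%N => [|d IHd]; first by rewrite addn0.
by rewrite addnS (le_trans IHd)// split_entropyS.
Qed.

End chernoff.

(** * The profile of a word *)

Section word_profile.
Context {R : realType}.
Implicit Types (s t : seq bool) (x y : R).

(** The distribution function of the empirical measure, see
    [unit_cdf_empirical]. *)
Definition word_profile s x : R :=
  (particles (take (Num.truncn (x * (size s)%:R)) s))%:R / (size s)%:R.

Lemma word_profile0 s : word_profile s 0 = 0.
Proof. by rewrite /word_profile mul0r truncn0 take0 mul0r. Qed.

Lemma word_profile1 s : word_profile s 1 = (particles s)%:R / (size s)%:R.
Proof. by rewrite /word_profile mul1r natrK take_size. Qed.

Lemma word_profile_near s x y : (0 < size s)%N -> 0 <= x -> x <= y ->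
  0 <= word_profile s y - word_profile s x <= y - x + (size s)%:R^-1.
Proof.
move=> s0 x0 xy; have N0 : 0 < (size s)%:R :> R by rewrite ltr0n.
have xN : 0 <= x * (size s)%:R by rewrite mulr_ge0// ltW.
have xyN : x * (size s)%:R <= y * (size s)%:R by rewrite ler_pM2r.
have ij := le_truncn xyN; have /andP[h1 h2] := particles_take_le s ij.
rewrite /word_profile -mulrBl mulr_ge0 ?invr_ge0 ?(ltW N0) ?subr_ge0 ?ler_nat//=.
rewrite ler_pdivrMr// mulrDl mulVf ?gt_eqF// mulrBl.
have /andP[_ i1] := truncn_itv xN.
have /andP[j1 _] := truncn_itv (le_trans xN xyN).
move: h2; rewrite -(ler_nat R) natrD natrB//.
move: i1; rewrite -natr1; lra.
Qed.

Lemma word_profile_nat s i : (0 < size s)%N ->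
  word_profile s (i%:R / (size s)%:R) = (particles (take i s))%:R / (size s)%:R.
Proof. by move=> s0; rewrite /word_profile divfK ?natrK// gt_eqF// ltr0n. Qed.

Lemma truncn_dyadic N k j : Num.truncn (dyadic k j * N%:R : R) = split_point N k j.
Proof.
apply/truncn_def; rewrite /dyadic /split_point mulrAC -natrM mulnC -natrX.
have k0 : (0 : R) < (2 ^ k)%:R by rewrite ltr0n expn_gt0.
rewrite ler_pdivlMr// ltr_pdivrMr// -!natrM ler_nat ltr_nat leq_divM/=.
by rewrite ltn_ceil// expn_gt0.
Qed.

Lemma word_profile_dyadic s k j :
  word_profile s (dyadic k j) =
  (particles (take (split_point (size s) k j) s))%:R / (size s)%:R.
Proof. by rewrite /word_profile truncn_dyadic. Qed.

(** The difference of two word profiles only changes at sites, so its infimum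
    is attained at a prefix. *)
Lemma inf_diff_word s t : size s = size t -> (0 < size s)%N ->
  inf_diff (word_profile s) (word_profile t) = - (deficit s t)%:R / (size s)%:R.
Proof.
move=> st s0; have N0 : 0 < (size s)%:R :> R by rewrite ltr0n.
have lb y : 0 <= y <= 1 -> - (deficit s t)%:R / (size s)%:R <= word_profile s y - word_profile t y.
  move=> _; rewrite /word_profile -st -mulrBl ler_pM2r ?invr_gt0//.
  rewrite lerNl opprB lerBlDl -natrD ler_nat; exact: deficit_ge.
apply/le_anti; rewrite inf_diff_ge ?andbT//.
have [i il ie] := deficit_ex st.
have i01 : 0 <= (i%:R / (size s)%:R : R) <= 1.
  by rewrite divr_ge0//= ler_pdivrMr// mul1r ler_nat.
apply: le_trans (inf_diff_le_lb lb i01) _.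
rewrite word_profile_nat// [X in _ - word_profile t (_ / X%:R)]st word_profile_nat -?st//.
by rewrite ie -mulrBl ler_pM2r ?invr_gt0// natrD opprD addrA subrr add0r.
Qed.

Lemma particles_takeE s i : particles (take i s) =
  (\sum_(j < size s) nth false s j * (j < i))%N.
Proof.
elim: s i => [|x s IHs] [|i]; rewrite ?big_ord0 ?take0//.
  by rewrite big1// => j _; rewrite muln0.
by rewrite /= big_ord_recl/= muln1 /particles/= -/(particles _) IHs.
Qed.

Lemma unit_cdf_empirical n (eta : config n) x : 0 <= x ->
  unit_cdf (empirical_measure R eta) x = word_profile (word eta) x.
Proof.
move=> x0; rewrite /unit_cdf /= [X in fine X]empiricalE.
under eq_bigr => i _.
  rewrite diracE -EFinM; over.
rewrite sumEFin -EFinM/= mulrC /word_profile size_word particles_takeE size_word.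
congr (_ / _); rewrite natr_sum; apply: eq_bigr => i _.
rewrite natrM nth_word; congr (_ * _%:R); congr nat_of_bool.
rewrite mem_setE in_itv/= divr_ge0//= ler_pdivrMr ?ltr0n//.
by rewrite truncn_gt_nat.
Qed.

Variables a b : R.
Hypotheses (a0 : 0 <= a) (b0 : 0 <= b).

Lemma pair_weightE s t : size s = size t ->
  pair_weight a b 0 s t =
  a ^+ deficit s t * b ^+ (particles s + deficit s t - particles t).
Proof. by rewrite /pair_weight subn0 add0n. Qed.

Lemma inf_diff_sub_word s t : size s = size t -> (0 < size s)%N ->
  inf_diff (word_profile s) (word_profile t) - (word_profile s 1 - word_profile t 1) =
  - (particles s + deficit s t - particles t)%:R / (size s)%:R.
Proof.
move=> st s0; rewrite inf_diff_word// !word_profile1 -st natrB ?particles_deficit//.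
by rewrite natrD; ring.
Qed.

(** Both constraints say that an exponent of the pair weight vanishes. *)
Lemma word_admissibleP s t : size s = size t -> (0 < size s)%N ->
  admissible a b (word_profile s) (word_profile t) <->
  (a = 0 -> deficit s t = 0%N) /\
  (b = 0 -> (particles s + deficit s t - particles t = 0)%N).
Proof.
move=> st s0; have N0 : (size s)%:R^-1 != 0 :> R by rewrite invr_eq0 pnatr_eq0 gtn_eqF.
have zero (m : nat) : (- m%:R / (size s)%:R = 0 :> R) <-> (m = 0)%N.
  split=> [/eqP|->]; last by rewrite oppr0 mul0r.
  by rewrite mulf_eq0 (negbTE N0) orbF oppr_eq0 pnatr_eq0 => /eqP.
rewrite /admissible; split=> -[h1 h2]; split.
- by move=> /h1; rewrite inf_diff_word// zero.
- by move=> /h2 h; apply/zero; rewrite -inf_diff_sub_word// h subrr.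
- by move=> /h1 h; rewrite inf_diff_word// zero.
- by move=> /h2 h; apply/eqP; rewrite -subr_eq0 inf_diff_sub_word//; apply/eqP/zero.
Qed.

Lemma pair_weight_admissible s t : size s = size t -> (0 < size s)%N ->
  pair_weight a b 0 s t != 0 -> admissible a b (word_profile s) (word_profile t).
Proof.
move=> st s0; rewrite pair_weightE// => w0; apply/word_admissibleP => //.
split=> [a_0|b_0]; apply/eqP; apply: contraNT w0 => h.
  by rewrite a_0 expr0n (negbTE h) mul0r.
by rewrite b_0 expr0n (negbTE h) mulr0.
Qed.

(** Pair weights are the exponentials of the boundary terms of the word
    profiles, without any error; a vanishing parameter has exponent 0. *)
Lemma admissible_pair_weight s t : size s = size t -> (0 < size s)%N ->
  admissible a b (word_profile s) (word_profile t) ->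
  pair_weight a b 0 s t =
  expR (- (size s)%:R * profile_boundary a b (word_profile s) (word_profile t)).
Proof.
move=> st s0 /(word_admissibleP st s0)[ha hb].
have N0 : (size s)%:R != 0 :> R by rewrite pnatr_eq0 gtn_eqF.
have powE (c : R) m : 0 <= c -> (c = 0 -> m = 0%N) -> c ^+ m = expR (m%:R * ln c).
  rewrite le_eqVlt => /predU1P[<-/(_ erefl) ->|c0 _]; first by rewrite mul0r expR0.
  by rewrite expRM_natl lnK.
rewrite pair_weightE// !powE// -expRD; congr expR.
rewrite /profile_boundary inf_diff_sub_word// inf_diff_word//.
by field.
Qed.

End word_profile.

(** * The upper bound *)

Section split_entropy_limit.
Context {R : realType} {S : Type}.

Lemma split_entropyE (s : seq bool) k : (0 < size s)%N ->
  split_entropy (size s) k s / (size s)%:R =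
  \sum_(j < 2 ^ k) block_entropy
    ((split_point (size s) k j.+1 - split_point (size s) k j)%:R / (size s)%:R)
    (increment (word_profile s) k j) :> R.
Proof.
move=> s0; rewrite /split_entropy /blocks_entropy mulr_suml; apply: eq_bigr => j _.
have h := particles_take_le s (split_point_le (size s) k j).
have /andP[h1 h2] := h.
rewrite /increment !word_profile_dyadic -mulrBl -natrB// /nat_entropy.
rewrite ![_ / (size s)%:R]mulrC block_entropyZ ?invr_gt0 ?ltr0n//.
by rewrite ler0n/= ler_nat leq_subLR.
Qed.

Lemma split_width N k j : (0 < N)%N ->
  `|2 ^- k - (split_point N k j.+1 - split_point N k j)%:R / N%:R| <= N%:R^-1 :> R.
Proof.
move=> N0; have N0' : (0 : R) < N%:R by rewrite ltr0n.
have k0 : (0 : R) < (2 ^ k)%:R by rewrite ltr0n expn_gt0.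
have bnd i : (split_point N k i)%:R <= (N%:R * i%:R / 2 ^+ k : R) < (split_point N k i)%:R + 1.
  rewrite -natrX ler_pdivlMr// ltr_pdivrMr// natr1 -!natrM ler_nat ltr_nat leq_divM/=.
  by rewrite ltn_ceil// expn_gt0.
rewrite natrB ?split_point_le//.
have /andP[a1 a2] := bnd j; have /andP[b1 b2] := bnd j.+1.
have E : N%:R * j.+1%:R / 2 ^+ k = N%:R * j%:R / 2 ^+ k + N%:R * 2 ^- k :> R.
  by rewrite -natr1 mulrDr mulr1 mulrDl.
rewrite E in b1 b2.
rewrite -(@ler_pM2l _ N%:R)// -{1}(gtr0_norm N0') -normrM mulrBr.
rewrite [N%:R * (_ / _)]mulrC divfK ?mulfV ?gt_eqF//.
by rewrite ler_norml; apply/andP; split; lra.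
Qed.

Variables (U : set_system S) (UU : ProperFilter U).

Lemma split_entropy_cvg (s_ : S -> seq bool) (F : R -> R) k :
  (forall t, (0 < size (s_ t))%N) ->
  (size (s_ t))%:R^-1 @[t --> U] --> (0 : R) ->
  @pointwise_cvg R S U (fun t => word_profile (s_ t)) F ->
  split_entropy (size (s_ t)) k (s_ t) / (size (s_ t))%:R @[t --> U] --> dyadic_entropy k F.
Proof.
move=> s0 sU cF; under eq_fun do rewrite split_entropyE//.
apply: cvg_big => [|j _]; first exact: add_continuous.
apply: cvg_block_entropy.
  apply/cvgrPdist_le => e e0.
  have : \forall t \near U, (size (s_ t))%:R^-1 <= e :> R by apply: (cvgr_le 0).
  by apply: filterS => t; apply: le_trans; exact: split_width.
apply: cvgB; apply: cF; first by rewrite dyadic_ge0 dyadic_le1.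
by rewrite dyadic_ge0 dyadic_le1// ltnW.
Qed.

End split_entropy_limit.

Section upper_bound.
Context {R : realType}.
Variables a b : R.
Hypotheses (a0 : 0 <= a) (b0 : 0 <= b).

(** The core of the upper bound. Otherwise there are pairs of words violating
    the inequality at level m for every m, of lengths going to infinity. Their
    profiles converge along an ultrafilter, and as entropies increase with the
    level, at every fixed level the entropies of the limit profiles obey the
    bound. So the limit pair has cost at most c, while the limit of the
    empirical measures is in the closed set C. *)
Lemma pair_bound (C : set (unit_measure R)) (c : R) : closed C ->
  (forall nu, C nu -> (c%:E < I_tasep_measure a b nu)%E) ->
  exists k n0, forall n (eta : config n) t, (n0 <= n)%N ->
    C (empirical_measure R eta) -> size t = n.+1 ->
    pair_weight a b 0 (word eta) t <=
    expR (- c * n.+1%:R) *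
      (expR (split_entropy n.+1 k (word eta)) * expR (split_entropy n.+1 k t)).
Proof.
move=> cC cI; apply: contrapT => H.
have {H} H m : exists p : {n : nat & config n} * seq bool,
    [/\ (m <= tag p.1)%N, C (empirical_measure R (tagged p.1)),
        size p.2 = (tag p.1).+1 &
    expR (- c * (tag p.1).+1%:R) * (expR (split_entropy (tag p.1).+1 m (word (tagged p.1)))
      * expR (split_entropy (tag p.1).+1 m p.2))
    < pair_weight a b 0 (word (tagged p.1)) p.2].
  apply: contrapT => /forallNP K; apply: H; exists m, m => n eta t mn Ceta st.
  rewrite leNgt; apply/negP => lt.
  by apply: (K (Tagged config eta, t)); split.
have /choice[p pP] := H.
pose n_ m := tag (p m).1; pose eta_ m : config (n_ m) := tagged (p m).1.
pose s_ m := word (eta_ m); pose t_ m := (p m).2.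
have sE m : size (s_ m) = (n_ m).+1 by rewrite size_word.
have tE m : size (t_ m) = (n_ m).+1 by have [] := pP m.
have st m : size (s_ m) = size (t_ m) by rewrite sE tE.
have s0 m : (0 < size (s_ m))%N by rewrite sE.
have t0 m : (0 < size (t_ m))%N by rewrite tE.
have [U [UU sU]] := ultraFilterLemma eventually_filter.
have PU : ProperFilter U by exact: ultra_proper.
have d0 : (n_ m).+1%:R^-1 @[m --> U] --> (0 : R).
  apply/cvgrPdist_le => e /harmonic_near h; apply: sU; apply: filterS h => m.
  rewrite sub0r normrN ger0_norm ?invr_ge0//; apply: le_trans.
   rewrite lef_pV2 ?posrE ?ltr0n// ler_nat ltnS.
  by have [] := pP m.
have lim (w_ : nat -> seq bool) : (forall m, size (w_ m) = (n_ m).+1) ->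
    exists2 F : R -> R, profile F & pointwise_cvg U (fun m => word_profile (w_ m)) F.
  move=> wE; apply: (@near_profile_limit R _ U UU (fun m => word_profile (w_ m)) _ d0).
  apply: filterE => m; split; first exact: word_profile0.
  by move=> x y x0 xy _; rewrite -wE; apply: word_profile_near; rewrite ?wE.
have [F pF cF] := lim s_ sE; have [G pG cG] := lim t_ tE.
have ds : (size (s_ m))%:R^-1 @[m --> U] --> (0 : R) by under eq_fun do rewrite sE.
have dt : (size (t_ m))%:R^-1 @[m --> U] --> (0 : R) by under eq_fun do rewrite tE.
have w0 m : pair_weight a b 0 (s_ m) (t_ m) != 0.
  have [_ _ _] := pP m; rewrite -/(s_ m) -/(t_ m) => h.
  by rewrite gt_eqF//; apply: lt_trans h; rewrite !mulr_gt0// expR_gt0.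
have adm m : admissible a b (word_profile (s_ m)) (word_profile (t_ m)).
  exact: pair_weight_admissible.
(* The violation holds at level m, hence at all lower levels. *)
have le m j : (j <= m)%N ->
    split_entropy (size (s_ m)) j (s_ m) / (size (s_ m))%:R +
    split_entropy (size (t_ m)) j (t_ m) / (size (t_ m))%:R +
    profile_boundary a b (word_profile (s_ m)) (word_profile (t_ m)) <= c.
  move=> jm; have [_ _ _] := pP m; rewrite -/(s_ m) -/(t_ m) -/(n_ m) -/(eta_ m) -/(s_ m).
  rewrite admissible_pair_weight// -!expRD ltr_expR -tE -st => h.
  have N0 : (0 : R) < (size (s_ m))%:R by rewrite ltr0n.
  have h1 : split_entropy (size (s_ m)) j (s_ m) <= split_entropy (size (s_ m)) m (s_ m) :> R.
    exact: split_entropy_le.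
  have h2 : split_entropy (size (s_ m)) j (t_ m) <= split_entropy (size (s_ m)) m (t_ m) :> R.
    exact: split_entropy_le.
  rewrite -mulrDl -lerBrDr ler_pdivrMr//; lra.
have : cost_le a b c F G.
  apply: (@cost_le_closed R _ U _ a b c (fun m => word_profile (s_ m))
    (fun m => word_profile (t_ m)) F G
    (fun k m => split_entropy (size (s_ m)) k (s_ m) / (size (s_ m))%:R +
                split_entropy (size (t_ m)) k (t_ m) / (size (t_ m))%:R)) => //.
  - apply: filterE => m x y x0 xy _.
    by have /andP[] := word_profile_near (s0 m) x0 xy; rewrite subr_ge0.
  - apply: filterE => m x y x0 xy _.
    by have /andP[] := word_profile_near (t0 m) x0 xy; rewrite subr_ge0.
  - exact: filterE.
  - by move=> k; apply: cvgD; exact: split_entropy_cvg.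
  - move=> k; apply: sU; exists k => // m km; exact: le.
move=> cost; pose nu := profile_measure pF.
have EF : eq01 F (unit_cdf nu) by move=> x x01; rewrite cdf_profile_measure.
have Cnu : C nu.
  have cv : empirical_measure R (eta_ m) @[m --> U] --> nu.
    apply: cdf_cvg => x x01; rewrite -EF//.
    under eq_fun => m.
      rewrite unit_cdf_empirical; last by case/andP: x01.
      over.
    exact: cF.
  rewrite (closure_id C).1// => B nB.
  have /filter_ex[m Bm] : U ((fun m => empirical_measure R (eta_ m)) @^-1` B) := cv B nB.
  by exists (empirical_measure R (eta_ m)); split=> //; have [] := pP m.
have /(cost_le_rate a0 b0) := eq01_cost_le EF cost.
move=> /(lt_le_trans (cI _ Cnu)).
by rewrite ltxx.
Qed.

Definition config_weight n (A : set (unit_measure R)) : R :=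
  \sum_(eta : config n | empirical_measure R eta \in A) weight a b 0 (word eta).

(** Summed over both rows, the exponentials of the entropies are polynomial in
    n by [split_chernoff]. *)
Lemma config_weight_closed (C : set (unit_measure R)) (c c' : R) : closed C ->
  (forall nu, C nu -> (c%:E < I_tasep_measure a b nu)%E) -> c' < c ->
  \forall n \near \oo, config_weight n C <= expR (- c' * n.+1%:R).
Proof.
move=> cC cI c'c; have [k [n0 h]] := pair_bound cC cI.
have e0 : 0 < c - c' by rewrite subr_gt0.
have big : \forall n \near \oo, (n0 <= n)%N by exists n0.
near=> n; have n0n : (n0 <= n)%N by near: n.
have pol : n.+2%:R ^+ (2 ^ k).*2 <= expR ((c - c') * n.+1%:R) by near: n; exact: poly_le_exp.
pose M s : R := expR (split_entropy n.+1 k s).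
have M0 s : 0 <= M s by exact: expR_ge0.
apply: (@le_trans _ _ (\sum_(eta : config n) \sum_(t <- words n.+1)
    expR (- c * n.+1%:R) * (M (word eta) * M t))).
  rewrite /config_weight big_mkcond/=; apply: ler_sum => eta _; case: ifPn => Ceta.
    rewrite /weight size_word big_seq [leRHS]big_seq; apply: ler_sum => t.
    by rewrite mem_words => /eqP tn; apply: h => //; rewrite inE in Ceta.
  by apply: sumr_ge0 => t _; rewrite !mulr_ge0 ?expR_ge0.
under eq_bigr do rewrite -mulr_sumr -mulr_sumr.
rewrite -mulr_sumr -mulr_suml (sum_config n M).
have -> : expR (- c' * n.+1%:R) = expR (- c * n.+1%:R) * expR ((c - c') * n.+1%:R).
  by rewrite -expRD; congr expR; ring.
rewrite ler_wpM2l ?expR_ge0//; apply: le_trans pol; rewrite -addnn exprD.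
have S0 : 0 <= \sum_(s <- words n.+1) M s by apply: sumr_ge0.
have le1 : \sum_(s <- words n.+1) M s <= n.+2%:R ^+ (2 ^ k) := split_chernoff n.+1 k.
exact: ler_pM.
Unshelve. all: by end_near. Qed.

End upper_bound.

(** * Padded words with prescribed profiles *)

(** After the prefix the first row is L particles ahead, which absorbs the
    fluctuations inside the blocks of length l < L: only the counts at the ends
    of the blocks matter. The suffix gives the advance back. *)
Lemma padded_deficit_le (L l K M : nat) (u v z : seq bool) :
  (0 < l)%N -> (l < L)%N -> size u = (l * K)%N -> size v = (l * K)%N ->
  (forall j, (j <= K)%N ->
     (particles (take (l * j) v) <= (particles (take (l * j) u) + M).+1)%N) ->
  (particles v <= particles u + M)%N ->
  (deficit (nseq L true ++ u ++ z ++ nseq L false)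
           (nseq L false ++ v ++ z ++ nseq L true) <= M)%N.
Proof.
move=> l0 lL su sv uv uvM.
have st : size (nseq L true ++ u ++ z ++ nseq L false) =
          size (nseq L false ++ v ++ z ++ nseq L true).
  by rewrite !size_cat !size_nseq su sv.
have [i _ ie] := deficit_ex st.
suff : (particles (take i (nseq L false ++ v ++ z ++ nseq L true)) <=
        particles (take i (nseq L true ++ u ++ z ++ nseq L false)) + M)%N by lia.
have false0 m : particles (nseq m false) = 0%N by rewrite /particles count_nseq.
have true1 m : particles (nseq m true) = m by rewrite /particles count_nseq mul1n.
rewrite !take_cat !size_nseq; case: ltnP => iL.
  by rewrite [take i (nseq L false)]take_nseq ?false0// ltnW.
rewrite su sv; case: ltnP => iK.
  set i' := (i - L)%N in iK *; set j := (i' %/ l)%N.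
  have jK : (j <= K)%N by rewrite ltnW // ltn_divLR // mulnC.
  have ji : (l * j <= i')%N by rewrite mulnC leq_divM.
  have ij : (i' < l * j + l)%N by rewrite addnC -mulnS mulnC ltn_ceil.
  have /andP[_ h1] := particles_take_le v ji.
  have /andP[h2 _] := particles_take_le u ji.
  have h3 := uv j jK.
  rewrite !particles_cat false0 true1; lia.
case: ltnP => iz; rewrite !particles_cat false0 true1; first lia.
have := particles_le_size (take (i - L - l * K - size z) (nseq L true)).
have := size_take_min (i - L - l * K - size z) (nseq L true); rewrite size_nseq.
lia.
Qed.

Lemma sum_words_fix (R : realType) (f : seq bool -> R) m x y : (forall s, 0 <= f s) ->
  \sum_(u <- words m) f (x ++ u ++ y) <= \sum_(s <- words (size x + (m + size y))) f s.
Proof.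
move=> f0; rewrite sum_words_cat [leRHS](bigD1_seq x) ?mem_words ?words_uniq//=.
apply: ler_wpDr; first by apply: sumr_ge0 => x' _; apply: sumr_ge0.
rewrite sum_words_cat; apply: ler_sum => u _.
rewrite (bigD1_seq y) ?mem_words ?words_uniq//=.
by apply: ler_wpDr => //; apply: sumr_ge0.
Qed.

Section grid.
Context {R : realType}.
Implicit Types F G : R -> R.

(** The number of particles that m sites with profile F have up to the grid
    point j, rounded down. *)
Definition grid_count (m k : nat) F (j : nat) : nat :=
  Num.truncn (m%:R * F (dyadic k j)).

Lemma grid_count0 m k F : profile F -> grid_count m k F 0 = 0%N.
Proof. by move=> [F0 _]; rewrite /grid_count /dyadic mul0r F0 mulr0 truncn0. Qed.

Lemma grid_count_itv m k F j : profile F -> (j <= 2 ^ k)%N ->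
  (grid_count m k F j)%:R <= m%:R * F (dyadic k j) < (grid_count m k F j).+1%:R.
Proof.
move=> pF jk; apply: truncn_itv; rewrite mulr_ge0//.
by have /andP[] := profile_itv pF (introT andP (conj (dyadic_ge0 k j) (dyadic_le1 jk))).
Qed.

Lemma grid_count_step l k F j : profile F -> (j < 2 ^ k)%N ->
  (grid_count (l * 2 ^ k) k F j <= grid_count (l * 2 ^ k) k F j.+1
   <= grid_count (l * 2 ^ k) k F j + l)%N.
Proof.
move=> pF jk; have /andP[i0 i1] := increment_itv pF jk.
have k0 : (0 : R) < 2 ^+ k by rewrite exprn_gt0.
have le1 : (l * 2 ^ k)%:R * F (dyadic k j) <= (l * 2 ^ k)%:R * F (dyadic k j.+1).
  by rewrite ler_wpM2l// -subr_ge0.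
apply/andP; split; first exact: le_truncn.
have /andP[_ h1] := grid_count_itv (l * 2 ^ k) pF (ltnW jk).
have /andP[h2 _] := grid_count_itv (l * 2 ^ k) pF jk.
rewrite -ltnS -(ltr_nat R) -addSn natrD.
apply: le_lt_trans h2 _; rewrite -ltrBlDr; apply: le_lt_trans h1.
rewrite lerBlDr -lerBlDl -mulrBr natrM natrX -mulrA ler_piMr//.
by rewrite mulrC -ler_pdivlMr// div1r.
Qed.

(** At the ends of the blocks, s differs from F by the rounding and the r sites
    outside of the blocks; in between, both vary by at most about 2 ^- k. *)
Lemma grid_close (L l r k : nat) F (s : seq bool) : profile F ->
  size s = (l * 2 ^ k + r)%N -> (0 < size s)%N -> (L <= r)%N ->
  (forall j, (j <= 2 ^ k)%N -> (grid_count (l * 2 ^ k) k F j <=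
     particles (take (L + l * j) s) <= grid_count (l * 2 ^ k) k F j + L)%N) ->
  forall x, 0 <= x <= 1 ->
  `|word_profile s x - F x| <= 2 / 2 ^+ k + (2 * r + 2)%:R / (size s)%:R.
Proof.
move=> pF sE s0 Lr sP x x01; set N : R := (size s)%:R.
have N0 : 0 < N by rewrite ltr0n.
have k0 : (0 : R) < 2 ^+ k by rewrite exprn_gt0.
have [j [jk /andP[jx xj]]] : exists j, (j <= 2 ^ k)%N /\ dyadic k j <= x <= dyadic k j + 2 ^- k.
  have /andP[x0 x1] := x01; have xk0 : 0 <= x * 2 ^+ k by rewrite mulr_ge0 ?exprn_ge0.
  have /andP[h1 h2] := truncn_itv xk0; exists (Num.truncn (x * 2 ^+ k)); split.
    rewrite -(ler_nat R) natrX; apply: le_trans h1 _; exact: ler_piMl (ltW k0) x1.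
  rewrite -dyadicS /dyadic ler_pdivrMr// ler_pdivlMr// h1/=; exact: ltW.
pose y : R := (L + l * j)%:R / N.
have y0 : 0 <= y by rewrite divr_ge0// ltW.
have NE : N = l%:R * 2 ^+ k + r%:R by rewrite /N sE natrD natrM natrX.
set D : R := dyadic k j in jx xj *.
have D01 : 0 <= D <= 1 by rewrite dyadic_ge0 dyadic_le1.
have FD := profile_itv pF D01.
have lD : l%:R * 2 ^+ k * D = l%:R * j%:R.
  by rewrite -mulrA; congr (_ * _); rewrite /D /dyadic mulrC divfK// gt_eqF.
have yN : y * N = L%:R + l%:R * j%:R.
  by rewrite /y divfK ?gt_eqF// natrD natrM.
have Lr' : (L%:R : R) <= r%:R by rewrite ler_nat.
have L0 : (0 : R) <= L%:R by [].
have r0 : (0 : R) <= r%:R by [].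
have rD : 0 <= r%:R * D <= r%:R.
  by have /andP[h1 h2] := D01; rewrite mulr_ge0//= ler_piMr.
have dist : `|D - y| <= r%:R / N.
  rewrite ler_norml -mulNr ler_pdivrMr// ler_pdivlMr// mulrBl yN {1}NE.
  have -> : D * N = l%:R * j%:R + r%:R * D by rewrite NE -lD; ring.
  by apply/andP; split; move: rD => /andP[]; lra.
have A : `|word_profile s x - word_profile s y| <= `|x - y| + N^-1.
  have /andP[x0 _] := x01.
  have [xy|/ltW yx] := leP x y.
    have /andP[h1 h2] := word_profile_near s0 x0 xy.
    by rewrite distrC (distrC x) !ger0_norm ?subr_ge0// -subr_ge0.
  have /andP[h1 h2] := word_profile_near s0 y0 yx.
  by rewrite !ger0_norm ?subr_ge0// -subr_ge0.
have B : `|word_profile s y - F D| <= (r%:R + 1) / N.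
  rewrite /y word_profile_nat// -/N.
  have /andP[p1 p2] := sP j jk; have /andP[q1 q2] := grid_count_itv (l * 2 ^ k) pF jk.
  rewrite -/D natrM natrX in q1 q2.
  move: p1 p2 q2; rewrite -(ler_nat R) -(ler_nat R) natrD -natr1.
  set p : R := (particles _)%:R; set P : R := (grid_count _ _ _ _)%:R in q1 *.
  move=> p1 p2 q2.
  have rF : 0 <= r%:R * F D <= r%:R.
    move: FD D01 => /andP[h1 h2] /andP[h3 h4]; rewrite mulr_ge0//= ler_piMr//.
    exact: le_trans h2 h4.
  rewrite ler_norml -mulNr ler_pdivrMr// ler_pdivlMr// mulrBl divfK ?gt_eqF//.
  have -> : F D * N = l%:R * 2 ^+ k * F D + r%:R * F D by rewrite NE; ring.
  by apply/andP; split; move: rF => /andP[]; lra.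
have C : `|F D - F x| <= 2 ^- k.
  have /andP[x0 x1] := x01; have /andP[D0 D1] := D01.
  have [_ /(_ D x D0 jx x1)/andP[h1 h2]] := pF.
  by rewrite distrC ger0_norm//; lra.
have E : `|x - y| <= 2 ^- k + r%:R / N.
  rewrite -(subrKA D) (le_trans (ler_normD _ _))// lerD//.
  by rewrite ger0_norm ?subr_ge0// lerBlDl.
rewrite -(subrKA (word_profile s y)) (le_trans (ler_normD _ _))//.
rewrite -(subrKA (F D) (word_profile s y)).
have := ler_normD (word_profile s y - F D) (F D - F x).
have -> : (2 * r + 2)%:R / N = (r%:R + 1) / N + r%:R / N + N^-1.
  by rewrite natrD natrM; field; rewrite gt_eqF.
lra.
Qed.

End grid.

(** * The lower bound for one dyadic level *)

Section boundary_close.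
Context {R : realType}.
Implicit Types F G : R -> R.

Lemma boundary_close (a b : R) F F' G G' (e : R) : profile F -> profile G ->
  (forall x, 0 <= x <= 1 -> `|F' x - F x| <= e) ->
  (forall x, 0 <= x <= 1 -> `|G' x - G x| <= e) ->
  profile_boundary a b F' G' <=
  profile_boundary a b F G + (2 * `|ln a| + 4 * `|ln b|) * e.
Proof.
move=> pF pG FF GG; have I := inf_diff_close pF pG FF GG.
have F1 := FF 1 one01; have G1 := GG 1 one01.
have mul_le (c x y : R) : `|x| <= y -> c * x <= `|c| * y.
  by move=> xy; apply: le_trans (ler_norm _) _; rewrite normrM ler_wpM2l.
rewrite /profile_boundary -lerBlDl.
set m' := inf_diff F' G' in I *; set m := inf_diff F G in I *.
have A := mul_le (ln a) _ _ I.
have B : ln b * (m' - m - (F' 1 - F 1) + (G' 1 - G 1)) <= `|ln b| * (4 * e).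
  apply: mul_le; rewrite !ler_norml in I F1 G1 *.
  by move: I F1 G1 => /andP[? ?] /andP[? ?] /andP[? ?]; apply/andP; split; lra.
by have := lerD A B; lra.
Qed.

End boundary_close.

Section prescribed_counts.
Context {R : realType}.
Variables (l K : nat) (P : nat -> nat).

Definition follows (u : seq bool) : bool :=
  [forall j : 'I_K, block_count (muln l) j u == (P j.+1 - P j)%N].

Lemma followsP u j : P 0%N = 0%N -> (forall j, (j < K)%N -> (P j <= P j.+1)%N) ->
  follows u -> (j <= K)%N -> particles (take (l * j) u) = P j.
Proof.
move=> P0 PS /forallP h; elim: j => [|j IHj] jK; first by rewrite muln0 take0 P0.
have /eqP := h (Ordinal jK); rewrite /block_count/= IHj; last exact: ltnW.
have jj : (l * j <= l * j.+1)%N by rewrite leq_mul2l leqnSn orbT.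
have /andP[le2 _] := particles_take_le u jj.
by move: le2 (PS j jK); rewrite IHj; [lia|exact: ltnW].
Qed.

(** The blocks are chosen independently, each among the words with the
    prescribed particle number. *)
Lemma count_follows : \sum_(u <- words (l * K)) (follows u)%:R =
  \prod_(j < K) 'C(l, P j.+1 - P j)%:R :> R.
Proof.
have <- : \prod_(j < K) \sum_(v <- words (l * j.+1 - l * j))
    (particles v == (P j.+1 - P j)%N)%:R = \prod_(j < K) 'C(l, P j.+1 - P j)%:R :> R.
  apply: eq_bigr => j _; rewrite mulnS addnK -count_words -natr_sum; congr _%:R.
  by elim: (words l) => [|u w IHw]; rewrite ?big_nil ?big_cons//= IHw.
rewrite -(sum_words_blocks (fun j p => (p == (P j.+1 - P j)%N)%:R))//; last 2 first.
- by rewrite muln0.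
- by move=> j; rewrite leq_mul2l leqnSn orbT.
apply: eq_bigr => u _; rewrite -[LHS]/((nat_of_bool (follows u))%:R).
have [/forallP h|/forallPn[j jP]] := boolP (follows u).
  by rewrite big1// => j _; rewrite (eqP (h j)) eqxx.
by rewrite (bigD1 j)//= (negbTE jP) mul0r.
Qed.

Lemma prod_binomial_ge : (forall j, (j < K)%N -> (P j.+1 - P j <= l)%N) ->
  expR (- \sum_(j < K) nat_entropy l (P j.+1 - P j)) <=
  l.+1%:R ^+ K * \prod_(j < K) 'C(l, P j.+1 - P j)%:R :> R.
Proof.
move=> Pl; rewrite -sumrN expR_sum.
have -> : l.+1%:R ^+ K = \prod_(j < K) l.+1%:R :> R by rewrite prodr_const card_ord.
rewrite -big_split/=; apply: ler_prod => j _; rewrite expR_ge0/= expRN.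
rewrite -div1r ler_pdivrMr ?expR_gt0// -mulrA; apply: binomial_ge; exact: Pl.
Qed.

End prescribed_counts.

(** The sites are divided into 2 ^ k blocks of this length and [slack]
    remaining ones, used as padding. Dividing by 2 ^ k + 3 leaves at least
    three block lengths of padding, and half of that exceeds one block. *)
Definition block_length k n := (n.+1 %/ (2 ^ k + 3))%N.

Definition slack k n := (n.+1 - block_length k n * 2 ^ k)%N.

Lemma slackE k n : (block_length k n * 2 ^ k + slack k n = n.+1)%N.
Proof.
rewrite subnKC// (leq_trans _ (leq_divM _ (2 ^ k + 3)))//.
by rewrite leq_mul2l leq_addr orbT.
Qed.

Lemma slack_ge k n : (3 * block_length k n <= slack k n)%N.
Proof.
by have := leq_divM n.+1 (2 ^ k + 3); have := slackE k n; rewrite -/(block_length k n); lia.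
Qed.

Lemma slack_le k n : (slack k n <= 3 * block_length k n + 2 ^ k + 3)%N.
Proof.
have := @ltn_ceil n.+1 (2 ^ k + 3); rewrite -/(block_length k n) => h.
by have := slackE k n; rewrite addn3 in h; have := h (ltn0Sn _); lia.
Qed.

(** The first row is padded with c = true, the second one with c = false. If
    the padding has odd length, its middle site is occupied in both rows and
    does not change their difference. *)
Definition padded (k n : nat) (c : bool) (u : seq bool) : seq bool :=
  nseq (slack k n)./2 c ++ u ++ nseq (odd (slack k n)) true ++ nseq (slack k n)./2 (~~ c).

Lemma padded_size k n c u : size u = (block_length k n * 2 ^ k)%N ->
  size (padded k n c u) = n.+1.
Proof.
move=> su; rewrite /padded !size_cat !size_nseq su -[RHS](slackE k n).
by have := odd_double_half (slack k n); lia.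
Qed.

Section lower_bound.
Context {R : realType}.
Variables a b : R.
Hypotheses (a0 : 0 <= a) (b0 : 0 <= b).

Let count_at k n (F : R -> R) := grid_count (block_length k n * 2 ^ k) k F.

Lemma padded_close k n c u F : profile F -> size u = (block_length k n * 2 ^ k)%N ->
  (forall j, (j <= 2 ^ k)%N -> particles (take (block_length k n * j) u) = count_at k n F j) ->
  forall x, 0 <= x <= 1 -> `|word_profile (padded k n c u) x - F x| <=
    2 / 2 ^+ k + (2 * slack k n + 2)%:R / n.+1%:R.
Proof.
move=> pF su uP x x01.
have sE := padded_size c su; rewrite -sE.
apply: (@grid_close R (slack k n)./2 (block_length k n) (slack k n) k F) => //.
- by rewrite sE slackE.
- by rewrite sE.
- by have := odd_double_half (slack k n); lia.
- move=> j jk; rewrite /padded takeD take_size_cat ?size_nseq// drop_size_cat ?size_nseq//.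
  rewrite takel_cat; last by rewrite su leq_mul2l jk orbT.
  rewrite particles_cat uP// -/(count_at k n F) leq_addl addnC leq_add2l.
  by rewrite (leq_trans (particles_le_size _))// size_nseq.
Qed.

(** If a = 0, then F >= G and the deficit has to vanish. If b = 0, then F - G
    is smallest at 1 and the deficit has to be attained at the last site. The
    rounding of the counts violates these relations by at most one particle,
    which the padding absorbs. *)
Lemma padded_admissible k n u v F G : profile F -> profile G -> admissible a b F G ->
  (2 * (2 ^ k + 3) <= n.+1)%N ->
  size u = (block_length k n * 2 ^ k)%N -> size v = (block_length k n * 2 ^ k)%N ->
  (forall j, (j <= 2 ^ k)%N -> particles (take (block_length k n * j) u) = count_at k n F j) ->
  (forall j, (j <= 2 ^ k)%N -> particles (take (block_length k n * j) v) = count_at k n G j) ->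
  admissible a b (word_profile (padded k n true u)) (word_profile (padded k n false v)).
Proof.
move=> pF pG [ha hb] nk su sv uP vP.
have l2 : (2 <= block_length k n)%N by rewrite leq_divRL// addnS.
have L2 : (block_length k n < (slack k n)./2)%N.
  by have := slack_ge k n; have := odd_double_half (slack k n); lia.
have d01 j : (j <= 2 ^ k)%N -> 0 <= (dyadic k j : R) <= 1.
  by move=> jk; rewrite dyadic_ge0 dyadic_le1.
have uK : particles u = count_at k n F (2 ^ k) by rewrite -uP// -su take_size.
have vK : particles v = count_at k n G (2 ^ k) by rewrite -vP// -sv take_size.
have D M := @padded_deficit_le _ _ (2 ^ k) M u v (nseq (odd (slack k n)) true)
  (ltnW l2) L2 su sv.
have d1 : dyadic k (2 ^ k) = 1 :> R by rewrite /dyadic natrX divff.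
apply/word_admissibleP; rewrite ?padded_size//; split.
  move=> /ha I0; apply/eqP; rewrite -leqn0; apply: D => [j jk|].
    rewrite addn0 uP// vP// leqW//; apply: le_truncn; rewrite ler_wpM2l//.
    by have := inf_diff_le pF pG (d01 j jk); rewrite I0 subr_ge0.
  rewrite addn0 uK vK; apply: le_truncn; rewrite ler_wpM2l//.
  by have := inf_diff_le pF pG (d01 _ (leqnn _)); rewrite I0 subr_ge0.
move=> /hb I1; have [I0 _ _] := inf_diff_itv pF pG.
have PQ : (count_at k n F (2 ^ k) <= count_at k n G (2 ^ k))%N.
  by apply: le_truncn; rewrite ler_wpM2l// d1; move: I0; rewrite I1 subr_le0.
have ED : (deficit (padded k n true u) (padded k n false v) <=
    count_at k n G (2 ^ k) - count_at k n F (2 ^ k))%N.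
  apply: D => [j jk|]; last by rewrite uK vK; lia.
  rewrite uP// vP//.
  have := inf_diff_le pF pG (d01 j jk); rewrite I1 => le1.
  have /andP[p1 p2] := grid_count_itv (block_length k n * 2 ^ k) pF jk.
  have /andP[q1 q2] := grid_count_itv (block_length k n * 2 ^ k) pG jk.
  have /andP[p3 p4] := grid_count_itv (block_length k n * 2 ^ k) pF (leqnn (2 ^ k)).
  have /andP[q3 q4] := grid_count_itv (block_length k n * 2 ^ k) pG (leqnn (2 ^ k)).
  rewrite -!/(count_at k n _ _) d1 in p1 p2 q1 q2 p3 p4 q3 q4.
  set m : R := (block_length k n * 2 ^ k)%:R in p1 p2 q1 q2 p3 p4 q3 q4.
  have m0 : 0 <= m by [].
  have le2 : m * (F 1 - G 1) <= m * (F (dyadic k j) - G (dyadic k j)) by rewrite ler_wpM2l.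
  rewrite !mulrBr in le2.
  have aux (x y z w : nat) : (z <= w)%N -> (x + z < y + w + 2)%N ->
      (x <= (y + (w - z)).+1)%N by clear; lia.
  apply: aux => //; rewrite -(ltr_nat R) !natrD; rewrite -natr1 in p2 q4.
  by rewrite -natr1 in q4; lra.
rewrite /padded !particles_cat in ED *.
have c0 m : particles (nseq m false) = 0%N by rewrite /particles count_nseq.
have c1 m : particles (nseq m true) = m by rewrite /particles count_nseq mul1n.
by rewrite !c0 !c1 uK vK; lia.
Qed.

(** Only words of the form [padded] with the block counts of F and G are kept.
    Their number is a product of binomial coefficients, and their profiles are
    within d of F and G, so that [boundary_close] bounds their weights. *)
Lemma config_weight_lb (U : set (unit_measure R)) F G k n (d : R) :
  (forall eta : config n, (forall x, 0 <= x <= 1 -> `|word_profile (word eta) x - F x| <= d) ->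
     U (empirical_measure R eta)) ->
  profile F -> profile G -> admissible a b F G ->
  (2 * (2 ^ k + 3) <= n.+1)%N ->
  2 / 2 ^+ k + (2 * slack k n + 2)%:R / n.+1%:R <= d ->
  expR (- n.+1%:R * (profile_boundary a b F G + (2 * `|ln a| + 4 * `|ln b|) * d)) *
    (\prod_(j < 2 ^ k) 'C(block_length k n, count_at k n F j.+1 - count_at k n F j)%:R *
     \prod_(j < 2 ^ k) 'C(block_length k n, count_at k n G j.+1 - count_at k n G j)%:R) <=
  config_weight a b n U.
Proof.
move=> near_U pF pG adm nk kd; set W := expR _.
pose K := (2 ^ k)%N; pose l := block_length k n.
pose near s := `[< forall x : R, 0 <= x <= 1 -> `|word_profile s x - F x| <= d >].
pose f s : R := if near s then \sum_(t <- words n.+1) pair_weight a b 0 s t else 0.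
have f0 s : 0 <= f s.
  by rewrite /f; case: ifP => // _; apply: sumr_ge0 => t _; exact: pair_weight_ge0.
apply: (@le_trans _ _ (\sum_(eta : config n) f (word eta))); last first.
  rewrite /config_weight [leRHS]big_mkcond/=; apply: ler_sum => eta _.
  rewrite /f; case: (boolP (near _)) => [/asboolP /near_U Ueta|_].
    by rewrite mem_set// /weight size_word.
  by case: ifP => // _; rewrite ltW// weight_gt0.
rewrite (sum_config n f).
have at_grid H u : profile H -> follows l K (count_at k n H) u ->
    forall j, (j <= K)%N -> particles (take (l * j) u) = count_at k n H j.
  move=> pH fu j jK; apply: followsP fu jK; first exact: grid_count0.
  by move=> i iK; have /andP[] := grid_count_step l pH iK.
have close c H u : profile H -> size u = (l * K)%N -> follows l K (count_at k n H) u ->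
    forall x, 0 <= x <= 1 -> `|word_profile (padded k n c u) x - H x| <= d.
  move=> pH su fu x x01; apply: le_trans kd; apply: padded_close => //.
  exact: at_grid.
have sizeE : ((slack k n)./2 + (l * K + (odd (slack k n) + (slack k n)./2)) = n.+1)%N.
  by rewrite -[RHS](slackE k n) -/l -/K; have := odd_double_half (slack k n); clear; lia.
rewrite -!(@count_follows R l K (count_at k n _)).
apply: (@le_trans _ _ (\sum_(u <- words (l * K)) f (padded k n true u))); last first.
  have := sum_words_fix (l * K) (nseq (slack k n)./2 true)
    (nseq (odd (slack k n)) true ++ nseq (slack k n)./2 false) f0.
  by rewrite size_cat !size_nseq sizeE.
rewrite mulr_suml mulr_sumr big_seq [leRHS]big_seq; apply: ler_sum => u.
rewrite mem_words => /eqP su.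
have [fu|_] := boolP (follows _ _ _ u); last by rewrite mul0r mulr0.
have nu : near (padded k n true u) by apply/asboolP; exact: close.
rewrite mul1r /f nu.
apply: (@le_trans _ _ (\sum_(v <- words (l * K))
    pair_weight a b 0 (padded k n true u) (padded k n false v))); last first.
  have := sum_words_fix (f := pair_weight a b 0 (padded k n true u)) (l * K)
    (nseq (slack k n)./2 false) (nseq (odd (slack k n)) true ++ nseq (slack k n)./2 true)
    (fun t => pair_weight_ge0 a0 b0 0 _ t).
  by rewrite size_cat !size_nseq sizeE.
rewrite mulr_sumr big_seq [leRHS]big_seq; apply: ler_sum => v.
rewrite mem_words => /eqP sv.
have [fv|_] := boolP (follows _ _ _ v); last by rewrite mulr0 pair_weight_ge0.
rewrite mulr1 admissible_pair_weight ?padded_size//; last first.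
  by apply: padded_admissible adm nk su sv _ _ => //; exact: at_grid.
rewrite ler_expR !mulNr lerN2 ler_wpM2l//.
by apply: boundary_close => //; exact: close.
Qed.

End lower_bound.

(** * The lower bound *)

Section lower_bound_limit.
Context {R : realType}.

Lemma real_between (x : \bar R) (r : R) : (x < r%:E)%E ->
  exists c : R, (x < c%:E)%E /\ c < r.
Proof.
case: x => [x||]//; rewrite ?lte_fin => h.
  by exists ((x + r) / 2); rewrite lte_fin; split; lra.
by exists (r - 1); rewrite ltNyr; split=> //; lra.
Qed.

(** Otherwise there are configurations outside of U whose profiles converge to
    the distribution function of nu, hence whose empirical measures converge to
    nu. *)
Lemma open_near (U : set (unit_measure R)) nu : open U -> U nu ->
  exists2 d : R, 0 < d & forall n (eta : config n),
    (forall x, 0 <= x <= 1 -> `|word_profile (word eta) x - unit_cdf nu x| <= d) ->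
    U (empirical_measure R eta).
Proof.
move=> oU Unu; apply: contrapT => H.
have {H} H m : exists p : {n : nat & config n},
    (forall x, 0 <= x <= 1 ->
       `|word_profile (word (tagged p)) x - unit_cdf nu x| <= m.+1%:R^-1) /\
    ~ U (empirical_measure R (tagged p)).
  apply: contrapT => /forallNP K; apply: H; exists m.+1%:R^-1; first by rewrite invr_gt0.
  move=> n eta near; apply: contrapT => nU.
  by apply: (K (Tagged config eta)).
have /choice[p pP] := H.
have cv : empirical_measure R (tagged (p m)) @[m --> \oo] --> nu.
  apply: cdf_cvg => x x01; have /andP[x0 _] := x01.
  apply/cvgrPdist_le => e /harmonic_near; apply: filterS => m.
  apply: le_trans; rewrite distrC unit_cdf_empirical//.
  by have [h _] := pP m; exact: h.
have nU : nbhs nu U by apply: open_nbhs_nbhs.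
have /filter_ex[m Um] : \oo ((fun m => empirical_measure R (tagged (p m))) @^-1` U) := cv U nU.
by have [_] := pP m; apply.
Qed.

Lemma cvg_harmonic_bound (u : nat -> R) (l : R) :
  (forall n, `|l - u n| <= n.+1%:R^-1) -> u @ \oo --> l.
Proof.
move=> h; apply/cvgrPdist_le => e /harmonic_near; apply: filterS => n.
exact: le_trans.
Qed.

Lemma block_length_cvg k :
  (block_length k n)%:R / n.+1%:R @[n --> \oo] --> ((2 ^ k + 3)%:R^-1 : R).
Proof.
apply: cvg_harmonic_bound => n; rewrite -[leRHS]mul1r; set l := block_length k n.
have K0 : (0 : R) < (2 ^ k + 3)%:R by rewrite ltr0n addn3.
have h1 : l%:R * (2 ^ k + 3)%:R <= n.+1%:R :> R by rewrite -natrM ler_nat leq_divM.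
have h2 : n.+1%:R < (l%:R + 1) * (2 ^ k + 3)%:R :> R.
  by rewrite natr1 -natrM ltr_nat ltn_ceil// addn3.
have N0 : (0 : R) < n.+1%:R by [].
rewrite ler_distl; apply/andP; split.
  rewrite -mulrBl ler_pdivrMr// mulrC -ler_pdivrMr ?invr_gt0// invrK. nra.
by rewrite -mulrDl ler_pdivlMr// mulrC ler_pdivrMr// ltW.
Qed.

Lemma grid_count_cvg k (F : R -> R) j : profile F -> (j <= 2 ^ k)%N ->
  (grid_count (block_length k n * 2 ^ k) k F j)%:R / n.+1%:R @[n --> \oo] -->
  (2 ^+ k / (2 ^ k + 3)%:R * F (dyadic k j) : R).
Proof.
move=> pF jk; set c := _ * F _.
rewrite (_ : (fun n => _) = (fun n => (block_length k n)%:R / n.+1%:R * (2 ^+ k * F (dyadic k j))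
  + ((grid_count (block_length k n * 2 ^ k) k F j)%:R / n.+1%:R -
     (block_length k n)%:R / n.+1%:R * (2 ^+ k * F (dyadic k j))))); last first.
  by apply/funext => n; rewrite addrC subrK.
rewrite -[c]addr0 (_ : c = (2 ^ k + 3)%:R^-1 * (2 ^+ k * F (dyadic k j))); last by rewrite /c mulrAC mulrC.
apply: cvgD; first by apply: cvgMl; exact: block_length_cvg.
apply: cvg_harmonic_bound => n; rewrite -[leRHS]mul1r sub0r normrN.
have /andP[h1 h2] := grid_count_itv (block_length k n * 2 ^ k) pF jk.
rewrite mulrAC -mulrBl normrM (ger0_norm (_ : 0 <= n.+1%:R^-1)) ?invr_ge0//.
rewrite ler_pM2r ?invr_gt0// distrC ger0_norm; move: h1 h2; rewrite natrM natrX -natr1; lra.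
Qed.

(** The blocks only cover the fraction 2 ^ k / (2 ^ k + 3) of the sites, whence
    the factor. *)
Lemma grid_entropy_cvg k (F : R -> R) : profile F ->
  (\sum_(j < 2 ^ k) nat_entropy (block_length k n)
     (grid_count (block_length k n * 2 ^ k) k F j.+1 -
      grid_count (block_length k n * 2 ^ k) k F j)) / n.+1%:R @[n --> \oo] -->
  2 ^+ k / (2 ^ k + 3)%:R * dyadic_entropy k F.
Proof.
move=> pF; set c : R := 2 ^+ k / _.
have k0 : (0 : R) < 2 ^+ k by rewrite exprn_gt0.
have c0 : 0 < c by rewrite divr_gt0// ltr0n addn3.
have -> : c * dyadic_entropy k F = \sum_(j < 2 ^ k)
    block_entropy ((2 ^ k + 3)%:R^-1) (c * F (dyadic k j.+1) - c * F (dyadic k j)).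
  rewrite mulr_sumr; apply: eq_bigr => j _; rewrite -mulrBr -/(increment F k j).
  rewrite -block_entropyZ ?increment_itv//; congr block_entropy.
  by rewrite /c mulrAC mulfV ?gt_eqF// mul1r.
under eq_fun do rewrite mulr_suml.
apply: cvg_big => [|j _]; first exact: add_continuous.
under eq_fun => n.
  have /andP[h1 h2] := grid_count_step (block_length k n) pF (ltn_ord j).
  rewrite /nat_entropy mulrC -block_entropyZ ?invr_gt0//; last first.
    by rewrite ler0n/= ler_nat leq_subLR.
  rewrite natrB// mulrBr ![n.+1%:R^-1 * _]mulrC.
  over.
apply: cvg_block_entropy; first exact: block_length_cvg.
by apply: cvgB; apply: grid_count_cvg => //; exact: ltnW.
Qed.

Lemma dyadic_entropy_ge k (F : R -> R) : profile F -> - ln 2 <= dyadic_entropy k F.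
Proof.
move=> pF; have -> : - ln 2 = \sum_(j < 2 ^ k) (- 2 ^- k * ln 2) :> R.
  by rewrite sumr_const card_ord -[RHS]mulr_natl natrX mulNr mulrN mulrA mulfV ?mul1r.
by apply: ler_sum => j _; apply: block_entropy_ge; exact: increment_itv.
Qed.

Variables a b : R.
Hypotheses (a0 : 0 <= a) (b0 : 0 <= b).

(** Let F be the distribution function of nu and G such that (F, G) has cost
    below c. The bound of [config_weight_lb] at a level k and a distance d
    chosen according to the difference between c and this cost has the right
    exponential rate. *)
Lemma config_weight_open (U : set (unit_measure R)) nu (c : R) : open U -> U nu ->
  (I_tasep_measure a b nu < c%:E)%E ->
  \forall n \near \oo, expR (- c * n.+1%:R) <= config_weight a b n U.
Proof.
move=> oU Unu Ic; have [c0 [Ic0 c0c]] := real_between Ic.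
have [G [pF pG adm cst]] := rate_cost_le a0 b0 Ic0.
set F := unit_cdf nu in pF adm cst.
have [d d0 dU] := open_near oU Unu.
pose M := 2 * `|ln a| + 4 * `|ln b|; have M0 : 0 <= M by rewrite addr_ge0// mulr_ge0.
pose e := c - c0; have e0 : 0 < e by rewrite subr_gt0.
(* The loss is at most e / 4 in the boundary term, e / 8 in the entropy of each
   row and e / 4 in the polynomial factors. *)
pose d' := Num.min d (e / (4 * (M + 1))).
have M1 : 0 < M + 1 by rewrite ltr_wpDl.
have d'0 : 0 < d' by rewrite lt_min d0/= divr_gt0// mulr_gt0.
have Md : M * d' <= e / 4.
  have : d' <= e / (4 * (M + 1)) by rewrite ge_min lexx orbT.
  rewrite ler_pdivlMr ?mulr_gt0//; nra.
have [k kd] : exists k : nat, 2 ^- k <= Num.min (d' / 16) (e / 64).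
  by apply: small_dyadic; rewrite lt_min !divr_gt0.
have /andP[kd1 kd2] : (2 ^- k <= d' / 16) && (2 ^- k <= e / 64) by rewrite -le_min.
pose S (n : nat) (H : R -> R) : R := \sum_(j < 2 ^ k) nat_entropy (block_length k n)
     (grid_count (block_length k n * 2 ^ k) k H j.+1 -
      grid_count (block_length k n * 2 ^ k) k H j).
pose q : R := 2 ^+ k / (2 ^ k + 3)%:R.
have k0 : (0 : R) < 2 ^+ k by rewrite exprn_gt0.
have K3 : (2 ^ k + 3)%:R = 2 ^+ k + 3 :> R by rewrite natrD natrX.
have q1 : 1 - q <= 3 * 2 ^- k.
  rewrite /q K3 -[X in X - _](@mulfV _ (2 ^+ k + 3)); last by rewrite gt_eqF//; lra.
  rewrite -mulrBl addrAC subrr add0r ler_pM2l// lef_pV2 ?posrE//; lra.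
have q0 : 0 <= 1 - q.
  by rewrite /q K3 subr_ge0 ler_pdivrMr ?mul1r ?lerDl// ltr_wpDr.
have ln21 : ln 2 <= 1 :> R.
  by have := @le_ln1Dx R 1; rewrite (_ : 1 + 1 = 2 :> R)//; [apply; lra].
have Sup H : profile H -> \forall n \near \oo, S n H <= (dyadic_entropy k H + e / 8) * n.+1%:R.
  move=> pH; have : \forall n \near \oo, S n H / n.+1%:R <= q * dyadic_entropy k H + e / 16.
    apply: (cvgr_le (q * dyadic_entropy k H)); first exact: grid_entropy_cvg.
    by rewrite ltrDl divr_gt0.
  apply: filterS => n; rewrite ler_pdivrMr// => /le_trans; apply.
  have E1 : 0 <= dyadic_entropy k H + 1.
    by have := dyadic_entropy_ge k pH; move: ln21; lra.
  by rewrite ler_pM2r//; have := mulr_ge0 q0 E1; move: kd2 q1; lra.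
have size_ok : \forall n \near \oo, (2 * (2 ^ k + 3) <= n.+1)%N.
  by exists (2 * (2 ^ k + 3))%N => // n /= /leqW.
have slack_ok : \forall n \near \oo, 2 / 2 ^+ k + (2 * slack k n + 2)%:R / n.+1%:R <= d'.
  have : \forall n \near \oo, (2 ^+ k * 2 + 8) / n.+1%:R <= d' / 2 :> R.
    have K0 : 0 < 2 ^+ k * 2 + 8 :> R by lra.
    have : \forall n \near \oo, n.+1%:R^-1 <= d' / 2 / (2 ^+ k * 2 + 8) :> R.
      by apply: harmonic_near; rewrite !divr_gt0.
    by apply: filterS => n; rewrite ler_pdivlMr// mulrC.
  apply: filterS => n h.
  have sl : (2 * slack k n + 2)%:R <= 6 * (block_length k n)%:R + (2 ^+ k * 2 + 8) :> R.
    have -> : 6 * (block_length k n)%:R + (2 ^+ k * 2 + 8) =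
        (6 * block_length k n + (2 ^ k * 2 + 8))%:R :> R.
      by rewrite natrD natrM natrD natrM natrX.
    by rewrite ler_nat; have := slack_le k n; clear; lia.
  have bl : 6 * (block_length k n)%:R <= 6 * 2 ^- k * n.+1%:R :> R.
    have := leq_divM n.+1 (2 ^ k + 3); rewrite -/(block_length k n) -(ler_nat R) natrM K3 => h'.
    rewrite -mulrA ler_pM2l// mulrC ler_pdivlMr//.
    have : 0 <= (block_length k n)%:R :> R by []. lra.
  have : (2 * slack k n + 2)%:R / n.+1%:R <= 6 * 2 ^- k + d' / 2.
    rewrite ler_pdivrMr// mulrDl; move: h; rewrite ler_pdivrMr//; lra.
  move: kd1; move: (2 ^- k : R) ((2 * slack k n + 2)%:R / n.+1%:R : R) => y z; clear; lra.
have e8 : 0 < e / 4 by rewrite divr_gt0.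
near=> n.
have N0 : (0 : R) < n.+1%:R by [].
have nk : (2 * (2 ^ k + 3) <= n.+1)%N by near: n.
have nd : 2 / 2 ^+ k + (2 * slack k n + 2)%:R / n.+1%:R <= d' by near: n.
have SF : S n F <= (dyadic_entropy k F + e / 8) * n.+1%:R by near: n; exact: Sup.
have SG : S n G <= (dyadic_entropy k G + e / 8) * n.+1%:R by near: n; exact: Sup.
have pol : n.+2%:R ^+ (2 ^ k).*2 <= expR (e / 4 * n.+1%:R) :> R by near: n; exact: poly_le_exp.
have dU' (eta : config n) : (forall x, 0 <= x <= 1 -> `|word_profile (word eta) x - F x| <= d') ->
    U (empirical_measure R eta).
  move=> h; apply: dU => x x01; apply: le_trans (h x x01) _.
  by rewrite ge_min lexx.
have := config_weight_lb a0 b0 dU' pF pG adm nk nd.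
apply: le_trans.
have prodge H : profile H -> expR (- S n H) <= n.+2%:R ^+ (2 ^ k) *
    \prod_(j < 2 ^ k) 'C(block_length k n, grid_count (block_length k n * 2 ^ k) k H j.+1 -
      grid_count (block_length k n * 2 ^ k) k H j)%:R :> R.
  move=> pH; apply: le_trans (prod_binomial_ge _) _.
    move=> j jk; have /andP[h1 h2] := grid_count_step (block_length k n) pH jk.
    by rewrite leq_subLR.
  rewrite ler_wpM2r ?prodr_ge0// lerXn2r ?nnegrE// ler_nat ltnS.
  by rewrite (leq_trans (leq_div _ _)).
set BF := \prod_(j < _) _; set BG := \prod_(j < _) _.
have hF : expR (- S n F) <= n.+2%:R ^+ (2 ^ k) * BF by exact: prodge.
have hG : expR (- S n G) <= n.+2%:R ^+ (2 ^ k) * BG by exact: prodge.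
have hFG := ler_pM (expR_ge0 _) (expR_ge0 _) hF hG.
have B0 : 0 <= BF * BG by rewrite mulr_ge0// prodr_ge0.
have {hFG} hFG : expR (- S n F - S n G - e / 4 * n.+1%:R) <= BF * BG.
  rewrite expRD expRN ler_pdivrMr ?expR_gt0// expRD; apply: le_trans hFG _.
  by rewrite mulrACA -exprD addnn mulrC ler_wpM2l.
apply: le_trans (ler_wpM2l (expR_ge0 _) hFG).
rewrite -expRD ler_expR -/M.
have := cst k; move: SF SG Md.
set pb := profile_boundary a b F G; set EF := dyadic_entropy k F; set EG := dyadic_entropy k G.
move=> SF SG Md h.
have : (EF + EG + pb + M * d' + e / 2) * n.+1%:R <= c * n.+1%:R.
  have -> : c = c0 + e by rewrite /e addrC subrK.
  by rewrite ler_pM2r//; move: h Md e0; clear; lra.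
lra.
Unshelve. all: by end_near.
Qed.

End lower_bound_limit.

(** * Normalization and the large deviation principle *)

Section limits.
Context {R : realType}.

Lemma limn_esup_near (u : nat -> \bar R) (l : \bar R) :
  (\forall n \near \oo, (u n <= l)%E) -> (limn_esup u <= l)%E.
Proof.
move=> ul; apply: (@le_trans _ _ (ereal_sup (u @` [set n | (u n <= l)%E]))).
  by apply: ereal_inf_lbound; exists [set n | (u n <= l)%E].
by apply: ge_ereal_sup => _ [n un <-].
Qed.

Lemma limn_einf_near (u : nat -> \bar R) (l : \bar R) :
  (\forall n \near \oo, (l <= u n)%E) -> (l <= limn_einf u)%E.
Proof.
move=> ul; rewrite /limn_einf leeNr; apply: limn_esup_near.
by apply: filterS ul => n; rewrite leeN2.
Qed.

Lemma le_of_real_ub (x y : \bar R) : (forall r : R, (y < r%:E)%E -> (x <= r%:E)%E) ->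
  (x <= y)%E.
Proof.
move=> h; rewrite leNgt; apply/negP => yx.
case: x yx h => [x||]// yx h.
- by have [c [yc cx]] := real_between yx; have := h c yc; rewrite lee_fin leNgt cx.
- case: y yx h => [y||]// _ h; first by have := h (y + 1); rewrite lte_fin ltrDl ltr01 => /(_ isT).
  by have := h 0; rewrite ltNyr => /(_ isT).
- by move: yx; rewrite ltNge leNye.
Qed.

Lemma log_rate_le (p N r : R) : 0 < N -> p <= expR (r * N) ->
  (N^-1%:E * lne p%:E <= r%:E)%E.
Proof.
move=> N0 pr; have [p0|p0] := leP p 0.
  by rewrite le0_lneNy ?lee_fin// gt0_muleNy ?lte_fin ?invr_gt0// leNye.
rewrite lne_EFin// -EFinM lee_fin mulrC ler_pdivrMr//.
by rewrite -ler_expR lnK.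
Qed.

Lemma log_rate_ge (p N r : R) : 0 < N -> expR (r * N) <= p ->
  (r%:E <= N^-1%:E * lne p%:E)%E.
Proof.
move=> N0 pr; have p0 : 0 < p := lt_le_trans (expR_gt0 _) pr.
rewrite lne_EFin// -EFinM lee_fin mulrC ler_pdivlMr//.
by rewrite -ler_expR lnK.
Qed.

End limits.

Section normalization.
Context {R : realType}.
Variables a b : R.
Hypotheses (a0 : 0 <= a) (b0 : 0 <= b).
Local Notation I := (@I_tasep_measure R a b).

Lemma cost_le_lb c F G : cost_le a b c F G -> - (2 * ln 2 + `|ln a| + 2 * `|ln b|) <= c.
Proof.
move=> [pF pG _ /(_ 0%N)]; apply: le_trans.
have [m0 md m1] := inf_diff_itv pF pG.
have /andP[F0 F1] := profile_itv pF one01; have /andP[G0 G1] := profile_itv pG one01.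
have mul_ge (c' x y : R) : `|x| <= y -> - (`|c'| * y) <= c' * x.
  by move=> xy; rewrite lerNl -mulrN; apply: le_trans (ler_norm _) _;
    rewrite normrM normrN ler_wpM2l.
have A : - (`|ln a| * 1) <= ln a * inf_diff F G.
  by apply: mul_ge; rewrite ler_norml; apply/andP; split; lra.
have B : - (`|ln b| * 2) <= ln b * (inf_diff F G - (F 1 - G 1)).
  by apply: mul_ge; rewrite ler_norml; apply/andP; split; lra.
have := dyadic_entropy_ge 0 pF; have := dyadic_entropy_ge 0 pG.
by rewrite /profile_boundary; lra.
Qed.

Lemma half_profile : profile (fun x : R => x / 2).
Proof. by split=> [|x y x0 xy y1]; [rewrite mul0r|apply/andP; split; lra]. Qed.

(** Entropies and boundary terms of profiles are bounded below, and F = G = x /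
    2 has no boundary term. *)
Lemma inf_rate_fin : exists i : R, ereal_inf (range I) = i%:E.
Proof.
have lb : ((- (2 * ln 2 + `|ln a| + 2 * `|ln b|))%:E <= ereal_inf (range I))%E.
  apply: le_ereal_inf_tmp => _ [nu _ <-]; rewrite leNgt; apply/negP => lt.
  have [c [c1 c2]] : exists c : R, (I nu < c%:E)%E /\ c < - (2 * ln 2 + `|ln a| + 2 * `|ln b|).
    exact: real_between.
  have [G /cost_le_lb] := rate_cost_le a0 b0 c1.
  by rewrite leNgt c2.
have ub : (ereal_inf (range I) <= 0)%E.
  have pH := half_profile; set H := fun x : R => x / 2 in pH.
  apply: (@le_trans _ _ (I (profile_measure pH))).
    by apply: ereal_inf_lbound; exists (profile_measure pH).
  apply: (@cost_le_rate _ _ _ _ _ H) => //.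
  have EH : eq01 H (unit_cdf (profile_measure pH)).
    by move=> x x01; rewrite cdf_profile_measure.
  apply: eq01_cost_le EH _.
  have I0 : inf_diff H H = 0.
    rewrite /inf_diff (_ : [set _ | _ in _] = [set 0]) ?inf1//.
    apply/seteqP; split=> [_ [x _ <-]|_ ->]; first by rewrite /= subrr.
    by exists 0; rewrite ?subrr//= in_itv/= lexx ler01.
  split=> //; first by rewrite /admissible I0 subrr.
  move=> k; rewrite /profile_boundary I0 !subrr !mulr0 !addr0.
  have E0 : dyadic_entropy k H <= 0.
    by apply: sumr_le0 => j _; apply: block_entropy_le0; exact: increment_itv.
  lra.
have : ereal_inf (range I) \is a fin_num.
  rewrite fin_numE; apply/andP; split; apply/eqP => e.
    by move: lb; rewrite e.
  by move: ub; rewrite e.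
by move=> /fineK <-; exists (fine (ereal_inf (range I))).
Qed.

End normalization.

Section large_deviations_tasep.
Context {R : realType}.
Variables (alpha beta a b : R) (mu : forall n : nat, config n -> R).
Hypotheses (alpha0 : 0 < alpha) (beta0 : 0 < beta) (a0 : 0 <= a) (b0 : 0 <= b).
Hypotheses (ha : alpha * (1 + a) = 1) (hb : beta * (1 + b) = 1).
Arguments mu : clear implicits.
Hypothesis hmu : forall n : nat, tasep_invariant alpha beta (mu n).
Local Notation I := (@I_tasep_measure R a b).
Local Notation Q n A := (config_weight a b n A).

Lemma empirical_lawE n (A : set (unit_measure R)) :
  empirical_law (mu n) A = Q n A / Q n setT.
Proof.
have muE := invariant_weight alpha0 beta0 a0 b0 ha hb (hmu n).
rewrite /empirical_law (eq_bigr _ (fun eta _ => muE eta)) -mulr_suml; congr (_ / _).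
rewrite -(sum_config n (weight a b 0)) /config_weight; apply: eq_bigl => eta.
by rewrite mem_set.
Qed.

Lemma total_weight_gt0 n : 0 < Q n setT.
Proof.
have all_in (eta : config n) : empirical_measure R eta \in setT by rewrite mem_set.
rewrite /config_weight (bigD1 [ffun=> false])//= ltr_pwDl ?weight_gt0//.
by apply: sumr_ge0 => eta _; rewrite ltW// weight_gt0.
Qed.

(** The invariant measure gives C the weight of C divided by the total weight.
    The numerator is bounded by [config_weight_closed], and the denominator is
    bounded below by [config_weight_open] at a measure of nearly minimal rate.
    *)
Lemma law_upper (C : set (unit_measure R)) (c i r : R) : closed C ->
  (forall nu, C nu -> (c%:E < I nu)%E) -> (ereal_inf (range I) < i%:E)%E -> i - c < r ->
  (limn_esup (fun n => (n.+1%:R)^-1%:E * lne (empirical_law (mu n) C)%:E) <= r%:E)%E.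
Proof.
move=> cC cI /ereal_inf_lt[_ [nu _ <-] nui] icr; apply: limn_esup_near.
have irc : i - r < c by lra.
have ub := config_weight_closed a0 b0 cC cI irc.
have lb := config_weight_open a0 b0 openT (Logic.I : [set: unit_measure R] nu) nui.
near=> n; apply: log_rate_le => //; rewrite empirical_lawE ler_pdivrMr ?total_weight_gt0//.
have ubn : Q n C <= expR (- (i - r) * n.+1%:R) by near: n.
have lbn : expR (- i * n.+1%:R) <= Q n setT by near: n.
apply: le_trans ubn _; apply: le_trans (ler_wpM2l (expR_ge0 _) lbn).
by rewrite -expRD ler_expR; lra.
Unshelve. all: by end_near. Qed.

(** The roles are exchanged: [config_weight_open] at nu for the numerator,
    [config_weight_closed] for the set of all measures for the total weight. *)
Lemma law_lower (U : set (unit_measure R)) nu (c i r : R) : open U -> U nu ->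
  (I nu < c%:E)%E -> (i%:E < ereal_inf (range I))%E -> r < i - c ->
  (r%:E <= limn_einf (fun n => (n.+1%:R)^-1%:E * lne (empirical_law (mu n) U)%:E))%E.
Proof.
move=> oU Unu nuc iI ric; apply: limn_einf_near.
have iI' nu' : [set: unit_measure R] nu' -> (i%:E < I nu')%E.
  by move=> _; apply: (lt_le_trans iI); apply: ereal_inf_lbound; exists nu'.
have cri : c + r < i by lra.
have ub := config_weight_closed a0 b0 closedT iI' cri.
have lb := config_weight_open a0 b0 oU Unu nuc.
near=> n; apply: log_rate_ge => //; rewrite empirical_lawE ler_pdivlMr ?total_weight_gt0//.
have lbn : expR (- c * n.+1%:R) <= Q n U by near: n.
have ubn : Q n setT <= expR (- (c + r) * n.+1%:R) by near: n.
apply: le_trans lbn; apply: le_trans (ler_wpM2l (expR_ge0 _) ubn) _.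
by rewrite -expRD ler_expR; lra.
Unshelve. all: by end_near. Qed.

End large_deviations_tasep.

Theorem theorem4p8 (R : realType) (alpha beta a b : R)
    (halpha : 0 < alpha <= 1) (hbeta : 0 < beta <= 1)
    (ha : a = (1 - alpha) / alpha) (hb : b = (1 - beta) / beta)
    (hab : a * b < 1)
    (mu : forall n : nat, config n -> R)
    (hmu : forall n : nat, tasep_invariant alpha beta (mu n)) :
  large_deviations (fun n : nat => n.+1%:R)
    (fun n : nat => empirical_law (mu n))
    (normalized (I_tasep_measure a b)).
Proof.
have [/andP[alpha0 alpha1] /andP[beta0 beta1]] := (halpha, hbeta).
have a0 : 0 <= a by rewrite ha divr_ge0 ?subr_ge0// ltW.
have b0 : 0 <= b by rewrite hb divr_ge0 ?subr_ge0// ltW.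
have ha1 : alpha * (1 + a) = 1 by rewrite ha; field; rewrite gt_eqF.
have hb1 : beta * (1 + b) = 1 by rewrite hb; field; rewrite gt_eqF.
have [i infE] := inf_rate_fin a0 b0.
set I := @I_tasep_measure R a b in infE *.
have i_le nu : (i%:E <= I nu)%E by rewrite -infE; apply: ereal_inf_lbound; exists nu.
have JE nu : normalized I nu = (I nu - i%:E)%E by rewrite /normalized infE.
split.
- by move=> nu; rewrite JE sube_ge0.
- move=> nu c; rewrite JE lteBrDr// -EFinD => /(rate_lsc a0 b0)[V nV VI].
  by exists V => // nu' /VI; rewrite JE lteBrDr// -EFinD.
- move=> C cC; apply: le_of_real_ub => r Lr.
  have [r' [Lr' r'r]] := real_between Lr.
  apply: (law_upper alpha0 beta0 a0 b0 ha1 hb1 hmu (c := i - r') (i := i + (r - r') / 2)) => //.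
  + move=> nu Cnu; move: Lr'; rewrite lteNl => Lr'.
    have : ((- r')%:E < normalized I nu)%E.
      by rewrite EFinN; apply: (lt_le_trans Lr'); apply: ereal_inf_lbound; exists nu.
    by rewrite JE lteBrDr// -EFinD addrC.
  + by rewrite -/I infE lte_fin; lra.
  + lra.
- move=> U oU; rewrite leeNl; apply: le_ereal_inf_tmp => _ [nu Unu <-].
  apply: le_of_real_ub => r; rewrite JE lteBlDr// -EFinD => /real_between[c [nuc cr]].
  rewrite leeNl -EFinN.
  apply: (law_lower alpha0 beta0 a0 b0 ha1 hb1 hmu (c := c) (i := i - (r + i - c) / 2) (nu := nu)) => //.
  + by rewrite -/I infE lte_fin; lra.
  + lra.
Qed.
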